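(* Let $G$ be a non-compact compactly generated (locally compact) abelian group, let $\omega$ be a weight on $G$, and let $1<p,q<\infty$ be such that $1/p+1/q=1$. Suppose that $(L^p_\omega(G),* )$ is a Banach algebra. (i) For $1<p\le2$, $L^p_\omega(G)$ is weakly amenable if and only if there exists no nonzero continuous group homomorphism $\xi:G\to\mathbb{C}$ such that $\tilde\xi\in L^\infty(G)$, where $$\tilde\xi(s):=\frac{\xi(s)}{\omega(s)\,\omega(s^{-1})}\qquad(s\in G).$$ (ii) For $p>2$, if $\omega$ is of the form $\omega(t)=e^{\nu(|t|)}$ ($t\in G$), where $|\cdot|$ is the length function on $G$ and $\nu:\mathbb{N}\cup\{0\}\to[0,\infty)$ is an increasing subadditive function with $\nu(0)=0$ and $\lim_{n\to\infty}\nu(n)=\infty$, and if $1/\omega\in L^q(G)$, then $L^p_\omega(G)$ is not weakly amenable.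
   Context: $G$ carries a fixed Haar measure $ds$, and $\mathbb{C}$ is regarded as an additive group. Length function: by the structure theorem, $G\cong\mathbb{R}^k\times\mathbb{Z}^m\times T$ with $k,m\in\mathbb{N}\cup\{0\}$ and $T$ a compact abelian group. Fixing this identification, let $U=(-1,1)^k\times\{-1,0,1\}^m\times T$, a generating set of $G$, let $U^n$ be the set of all sums of $n$ elements of $U$, and set $|s|=\inf\{n\in\mathbb{N}:s\in U^n\}$ for $s\ne e$, $|e|=0$. Weights: a weight on $G$ is a locally integrable measurable function $\omega:G\to(0,\infty)$ with $\omega(e)=1$, $1/\omega\in L^\infty(G)$, and such that for some $C>0$, $\omega(st)\le C\omega(s)\omega(t)$ for all $s,t\in G$ (group operation written multiplicatively). $L^p_\omega(G)=\{f: f\omega\in L^p(G)\}$ with norm $\|f\|_{p,\omega}=\|f\omega\|_p$. ''$(L^p_\omega(G),* )$ is a Banach algebra'' means that it is a Banach algebra under convolution $*$, where multiplication is only required to be bounded ($\|f*g\|\le K\|f\|\|g\|$ for some constant $K$), not contractive. A Banach algebra $A$ is weakly amenable if every bounded derivation $D:A\to A^*$ is inner. *)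

(* Defs.v *)
From HB Require Import structures.
From mathcomp Require Import all_boot all_order all_algebra.
From mathcomp Require Import generic_quotient ring_quotient.
From mathcomp Require Import all_classical all_reals all_analysis.
From mathcomp Require Import measurable_realfun.
From mathcomp Require Export complex.

Set Implicit Arguments.
Unset Strict Implicit.
Unset Printing Implicit Defensive.

Import Order.TTheory GRing.Theory Num.Theory.
Import numFieldNormedType.Exports.
Import Quotient.

Local Open Scope classical_set_scope.
Local Open Scope ring_scope.
Local Open Scope complex_scope.
Local Open Scope quotient_scope.

Local Notation normc := Normc.normc.

Section complex_functions.
Context d (T : measurableType d) (R : realType).
Variable mu : {measure set T -> \bar R}.
Implicit Types f g : T -> R[i].

Definition cmeasurable f :=
  measurable_fun [set: T] (fun x => complex.Re (f x)) /\
  measurable_fun [set: T] (fun x => complex.Im (f x)).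

Definition cintegrable f :=
  mu.-integrable [set: T] (fun x => (complex.Re (f x))%:E) /\
  mu.-integrable [set: T] (fun x => (complex.Im (f x))%:E).

Definition cintegral f : R[i] :=
  (\int[mu]_x complex.Re (f x)) +i* (\int[mu]_x complex.Im (f x)).

Definition cLp (p : \bar R) f :=
  cmeasurable f /\ finite_norm mu p (fun x => normc (f x)).

End complex_functions.

Lemma normcE_sqrt (R : rcfType) (z : R[i]) :
  normc z = Num.sqrt (complex.Re z ^+ 2 + complex.Im z ^+ 2).
Proof. by case: z. Qed.

Section cLp_closed.
Context d (T : measurableType d) (R : realType).
Variable mu : {measure set T -> \bar R}.
Implicit Types f g : T -> R[i].

Let measurable_norm_powR (p : R) (k : T -> R) : measurable_fun [set: T] k ->
  measurable_fun [set: T] (fun x => `|k x| `^ p).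
Proof.
move=> mk; apply: (measurableT_comp (measurable_powR p)).
exact: measurableT_comp.
Qed.

Lemma cmeasurable_normc f :
  cmeasurable f -> measurable_fun [set: T] (fun x => normc (f x)).
Proof.
move=> [mr mi].
rewrite (_ : (fun x => _) = Num.sqrt \o
  (fun x => complex.Re (f x) ^+ 2 + complex.Im (f x) ^+ 2)); last first.
  by apply/funext => x; rewrite /= normcE_sqrt.
apply: measurableT_comp.
  exact: (continuous_measurable_fun (@sqrt_continuous R)).
apply: measurable_funD; exact: measurable_funX.
Qed.

Lemma cmeasurableD f g :
  cmeasurable f -> cmeasurable g -> cmeasurable (f \+ g).
Proof.
move=> [fr fi] [gr gi]; split.
  rewrite (_ : (fun x => _) =
    (fun x => complex.Re (f x)) \+ (fun x => complex.Re (g x))).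
    exact: measurable_funD.
  by apply/funext => x /=; move: (f x) (g x) => [? ?] [].
rewrite (_ : (fun x => _) =
  (fun x => complex.Im (f x)) \+ (fun x => complex.Im (g x))).
  exact: measurable_funD.
by apply/funext => x /=; move: (f x) (g x) => [? ?] [].
Qed.

Lemma cmeasurableZ (a : R[i]) f :
  cmeasurable f -> cmeasurable (fun x => a * f x).
Proof.
case: a => ar ai [fr fi]; split.
  rewrite (_ : (fun x => _) = (fun x => ar * complex.Re (f x))
     \- (fun x => ai * complex.Im (f x))).
    by apply: measurable_funB; apply: measurable_funM.
  by apply/funext => x /=; case: (f x).
rewrite (_ : (fun x => _) = (fun x => ar * complex.Im (f x))
   \+ (fun x => ai * complex.Re (f x))).
  by apply: measurable_funD; apply: measurable_funM.
by apply/funext => x /=; case: (f x) => ? ? /=.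
Qed.

Lemma cLnorm0 (p : R) : 1 <= p ->
  ('N[mu]_(p%:E)[(fun x : T => (normc (0 : R[i]))%:E)] = 0)%E.
Proof.
move=> p1; rewrite Normc.normc0; apply: Lnorm0.
by rewrite eqe gt_eqF// (lt_le_trans _ p1).
Qed.

Lemma le_cLnorm (p : R) (f g : T -> R) : 1 <= p ->
  measurable_fun [set: T] f -> measurable_fun [set: T] g ->
  (forall x, 0 <= f x <= g x) ->
  ('N[mu]_(p%:E)[EFin \o f] <= 'N[mu]_(p%:E)[EFin \o g])%E.
Proof.
move=> p1 mf mg fg; rewrite unlock.
have p0 : 0 <= p by rewrite (le_trans _ p1).
apply: gt0_ler_poweR.
- by rewrite invr_ge0.
- by rewrite in_itv/= leey andbT integral_ge0// => x _; exact: poweR_ge0.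
- by rewrite in_itv/= leey andbT integral_ge0// => x _; exact: poweR_ge0.
have h (k : T -> R) : measurable_fun [set: T] k ->
    measurable_fun [set: T] (fun x => `|(EFin \o k) x| `^ p)%E.
  move=> mk; apply/measurable_EFinP.
  exact: measurable_norm_powR.
apply: ge0_le_integral => //; try exact: h; try by move=> x _; exact: poweR_ge0.
- move=> x _ /=; rewrite lee_fin.
  have /andP[f0 fgx] := fg x.
  rewrite ge0_ler_powR// ?nnegrE ?normr_ge0//.
  by rewrite !ger0_norm// (le_trans f0).
Qed.

Lemma cLnormD (p : R) f g : 1 <= p -> cmeasurable f -> cmeasurable g ->
  ('N[mu]_(p%:E)[(fun x => (normc (f x + g x))%:E)] <=
   'N[mu]_(p%:E)[(fun x => (normc (f x))%:E)] +
   'N[mu]_(p%:E)[(fun x => (normc (g x))%:E)])%E.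
Proof.
move=> p1 mf mg.
have mnf := cmeasurable_normc mf; have mng := cmeasurable_normc mg.
have mnD := cmeasurable_normc (cmeasurableD mf mg).
apply: le_trans (minkowski_EFin mu mnf mng p1).
apply: (le_cLnorm p1 mnD).
  exact: measurable_funD.
move=> x; rewrite /= le_normcD andbT normcE_sqrt; exact: sqrtr_ge0.
Qed.

Lemma cLnormZ (p : R) (a : R[i]) f : 1 <= p -> cmeasurable f ->
  ('N[mu]_(p%:E)[(fun x => (normc (a * f x))%:E)] =
   (normc a)%:E * 'N[mu]_(p%:E)[(fun x => (normc (f x))%:E)])%E.
Proof.
move=> p1 mf; rewrite unlock.
have p0 : 0 < p by rewrite (lt_le_trans _ p1).
have na : 0 <= normc a by rewrite normcE_sqrt sqrtr_ge0.
under eq_integral do rewrite Normc.normcM EFinM abseM poweRM ?abse_ge0//.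
rewrite ge0_integralZl//; last 3 first.
- apply/measurable_EFinP/measurable_norm_powR.
  exact: cmeasurable_normc.
- by move=> x _; exact: poweR_ge0.
- exact: poweR_ge0.
rewrite poweRM ?poweR_ge0 ?integral_ge0//; last first.
  by move=> x _; exact: poweR_ge0.
by rewrite -poweRrM mulfV ?gt_eqF// poweRe1 ?abse_ge0// gee0_abs.
Qed.

End cLp_closed.

(* [g_sigma_algebraType] asks for a pointed type: [G] is pointed by [0] under
   this alias only. *)
Definition pointed_group (G : topologicalZmodType) : Type := G.

HB.instance Definition _ (G : topologicalZmodType) :=
  Choice.copy (pointed_group G) G.
HB.instance Definition _ (G : topologicalZmodType) :=
  isPointed.Build (pointed_group G) (0 : G).

Definition borel_type (G : topologicalZmodType) :=
  @g_sigma_algebraType (pointed_group G) (@open G).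

Section haar_weights.
Variables (R : realType) (G : topologicalZmodType).
Variable mu : {measure set (borel_type G) -> \bar R}.

(* Nonzero translation-invariant Radon measure; positivity on nonempty open
   sets is equivalent to being nonzero. *)
Record haar_measure : Prop := HaarMeasure {
  haar_invariant : forall (s : G) (A : set (borel_type G)), measurable A ->
    mu [set s + t | t in A] = mu A;
  haar_compact : forall K : set G, compact K -> (mu K < +oo)%E;
  haar_open : forall O : set G, open O -> O !=set0 -> (0 < mu O)%E;
  haar_outer_regular : forall A : set (borel_type G), measurable A ->
    mu A = ereal_inf [set mu O | O in [set O : set G | open O /\ A `<=` O]];
  haar_inner_regular : forall O : set G, open O ->
    mu O = ereal_sup [set mu K | K in [set K : set G | compact K /\ K `<=` O]]
}.

Record weight := Weight {
  weight_fun :> G -> R;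
  weight_measurable :
    measurable_fun [set: borel_type G] (weight_fun : borel_type G -> R);
  weight_gt0 : forall s, 0 < weight_fun s;
  weight_locally_integrable : forall K : set G, compact K ->
    mu.-integrable K (fun s => (weight_fun s)%:E);
  weight0 : weight_fun 0 = 1;
  weight_inv_bounded : (fun s => (weight_fun s)^-1) \in Lfun mu +oo%E;
  weight_submul : exists2 C : R, 0 < C &
    forall s t, weight_fun (s + t) <= C * weight_fun s * weight_fun t
}.

End haar_weights.

Section weighted_Lp.
Variables (R : realType) (G : topologicalZmodType).
Variable mu : {measure set (borel_type G) -> \bar R}.
Variables (w : weight mu) (p : R).

Definition weighted (f : G -> R[i]) (s : borel_type G) : R[i] :=
  f s * (w s)%:C.

Definition Lpw_norm (f : G -> R[i]) : \bar R :=
  'N[mu]_(p%:E)[(fun s => (normc (weighted f s))%:E)]%E.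

Variable p1 : 1 <= p.

Definition Lpw_pred of 1 <= p : {pred G -> R[i]} :=
  mem [set f | cLp mu p%:E (weighted f)].

Let Lpw_predE f : (f \in Lpw_pred p1) <-> cLp mu p%:E (weighted f).
Proof. by rewrite inE. Qed.

Let weightedD (f g : G -> R[i]) : weighted (f + g) = weighted f \+ weighted g.
Proof. by apply/funext => s; rewrite /weighted/= mulrDl. Qed.

Let weightedZ a (f : G -> R[i]) :
  weighted (a *: f) = fun s => a * weighted f s.
Proof. by apply/funext => s; rewrite /weighted/= mulrA. Qed.

Lemma Lpw_normD (f g : G -> R[i]) : f \in Lpw_pred p1 -> g \in Lpw_pred p1 ->
  (Lpw_norm (f + g)%R <= Lpw_norm f + Lpw_norm g)%E.
Proof.
move=> /Lpw_predE[mf _] /Lpw_predE[mg _].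
by rewrite /Lpw_norm weightedD; exact: cLnormD.
Qed.

Lemma Lpw_normZ (a : R[i]) (f : G -> R[i]) : f \in Lpw_pred p1 ->
  (Lpw_norm (a *: f)%R = (normc a)%:E * Lpw_norm f)%E.
Proof.
by move=> /Lpw_predE[mf _]; rewrite /Lpw_norm weightedZ; exact: cLnormZ.
Qed.

Lemma Lpw_norm_fin (f : G -> R[i]) : f \in Lpw_pred p1 ->
  ((fine (Lpw_norm f))%:E = Lpw_norm f)%E.
Proof.
move=> /Lpw_predE[_ fin]; rewrite fineK// ge0_fin_numE//; exact: Lnorm_ge0.
Qed.

Lemma Lpw_submod_closed : submod_closed (Lpw_pred p1).
Proof.
split=> [|a f g fP gP].
  apply/Lpw_predE; rewrite (_ : weighted 0 = cst 0); last first.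
    by apply/funext => s; rewrite /weighted mul0r.
  split; first by split; exact: measurable_cst.
  by rewrite /finite_norm [X in (X < _)%E]cLnorm0.
have afP : a *: f \in Lpw_pred p1.
  apply/Lpw_predE; move/Lpw_predE : (fP) => [mf ff]; split.
    by rewrite weightedZ; exact: cmeasurableZ.
  rewrite /finite_norm [X in (X < _)%E](Lpw_normZ a fP) lte_mul_pinfty//.
  by rewrite lee_fin normcE_sqrt sqrtr_ge0.
apply/Lpw_predE; split.
  rewrite weightedD; apply: cmeasurableD.
    by move/Lpw_predE : afP => [].
  by move/Lpw_predE : gP => [].
rewrite /finite_norm (le_lt_trans (Lpw_normD afP gP))// lte_add_pinfty//.
- by move/Lpw_predE : afP => [].
- by move/Lpw_predE : gP => [].
Qed.


HB.instance Definition _ :=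
  GRing.isSubmodClosed.Build R[i] (G -> R[i]) (Lpw_pred p1) Lpw_submod_closed.

Record Lpw_fun := LpwFun {
  Lpw_val :> G -> R[i];
  Lpw_valP : Lpw_val \in Lpw_pred p1
}.

HB.instance Definition _ := [isSub for Lpw_val].
HB.instance Definition _ := [Choice of Lpw_fun by <:].
HB.instance Definition _ := [SubChoice_isSubLmodule of Lpw_fun by <:].

Definition ae_null : {pred Lpw_fun} :=
  mem [set f : Lpw_fun | {ae mu, forall s : borel_type G, f s = 0}].

Lemma ae_nullP (f : Lpw_fun) :
  (f \in ae_null) <-> {ae mu, forall s : borel_type G, f s = 0}.
Proof. by rewrite inE. Qed.

Lemma ae_null_zmod_closed : zmod_closed ae_null.
Proof.
split=> [|f g /ae_nullP f0 /ae_nullP g0]; first exact/ae_nullP/aeW.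
apply/ae_nullP; apply: filterS2 f0 g0 => s fs gs.
by rewrite -[LHS]/(f s - g s) fs gs subrr.
Qed.

HB.instance Definition _ :=
  GRing.isZmodClosed.Build Lpw_fun ae_null ae_null_zmod_closed.

Lemma Lpw_norm_null (f : Lpw_fun) : (f \in ae_null) <-> (Lpw_norm f = 0)%E.
Proof.
have p0 : 0 < p by rewrite (lt_le_trans _ p1).
have := Lpw_valP f; rewrite inE => -[mf _].
have mn : measurable_fun [set: borel_type G]
    (fun s => (normc (weighted f s))%:E).
  by apply/measurable_EFinP; exact: cmeasurable_normc.
split=> [/ae_nullP f0|Nf0].
- rewrite -(@cLnorm0 _ (borel_type G) R mu p p1) /Lpw_norm unlock.
  congr (_ `^ _)%E; apply: ae_eq_integral => //.
  + apply/measurable_EFinP/(measurableT_comp (measurable_powR p)).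
    by apply: measurableT_comp => //; exact: cmeasurable_normc.
  + apply: filterS f0 => s fs _ /=.
    by rewrite /weighted fs mul0r.
- apply/ae_nullP; have := Lnorm_eq0_eq0 mn _ Nf0; rewrite lte_fin => /(_ p0).
  apply: filterS => s /(_ I)/= [] /Normc.eq0_normc/eqP.
  rewrite mulf_eq0 => /orP[/eqP//|]; rewrite -[0]/((0 : R)%:C) => /eqP[/eqP].
  by rewrite gt_eqF// weight_gt0.
Qed.

(* Equality in [Lpw] is equality almost everywhere, see [Lpw_classP]. *)
Definition Lpw : Type := {quot ae_null}.

HB.instance Definition _ := GRing.Zmodule.on Lpw.

Definition Lpw_class (f : Lpw_fun) : Lpw := \pi_({quot ae_null}) f.

Definition Lpw_repr (x : Lpw) : Lpw_fun := repr (x : {quot ae_null}).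

Lemma Lpw_reprK x : Lpw_class (Lpw_repr x) = x.
Proof. exact: reprK. Qed.

Lemma Lpw_classP (f g : Lpw_fun) :
  Lpw_class f = Lpw_class g <-> {ae mu, forall s : borel_type G, f s = g s}.
Proof.
apply: (@iff_trans _ (f - g \in ae_null)).
  by rewrite idealrBE; split => [fg|/eqP//]; exact/eqP.
apply: (iff_trans (ae_nullP _)); split; apply: filterS => s.
  by move=> /eqP; rewrite -[X in X == 0]/(f s - g s) subr_eq0 => /eqP.
by move=> fg; rewrite -[LHS]/(f s - g s) fg subrr.
Qed.

Lemma Lpw_classD f g : Lpw_class (f + g) = Lpw_class f + Lpw_class g.
Proof. exact: pi_add. Qed.

Lemma Lpw_class0 : Lpw_class 0 = 0.
Proof. by rewrite /Lpw_class -[RHS](@pi_zeror _ _ _ _ _ {quot ae_null}). Qed.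

Definition Lpw_scale (a : R[i]) (x : Lpw) : Lpw := Lpw_class (a *: Lpw_repr x).

Lemma Lpw_classZ a f : Lpw_class (a *: f) = Lpw_scale a (Lpw_class f).
Proof.
apply/Lpw_classP; have /Lpw_classP := Lpw_reprK (Lpw_class f).
apply: filterS => s fs.
by rewrite -[LHS]/(a * f s) -[RHS]/(a * Lpw_repr (Lpw_class f) s) fs.
Qed.

Let scalerA_Lpw a b x : Lpw_scale a (Lpw_scale b x) = Lpw_scale (a * b) x.
Proof. by rewrite -(Lpw_reprK x) -!Lpw_classZ scalerA. Qed.

Let scale1r_Lpw : left_id 1 Lpw_scale.
Proof. by move=> x; rewrite -(Lpw_reprK x) -Lpw_classZ scale1r. Qed.

Let scalerDr_Lpw : right_distributive Lpw_scale +%R.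
Proof.
move=> a x y; rewrite -(Lpw_reprK x) -(Lpw_reprK y) -Lpw_classD -!Lpw_classZ.
by rewrite -Lpw_classD scalerDr.
Qed.

Let scalerDl_Lpw x : {morph Lpw_scale^~ x : a b / a + b}.
Proof.
by move=> a b; rewrite -(Lpw_reprK x) -!Lpw_classZ -Lpw_classD scalerDl.
Qed.

HB.instance Definition _ := GRing.Zmodule_isLmodule.Build R[i] Lpw
  scalerA_Lpw scale1r_Lpw scalerDr_Lpw scalerDl_Lpw.

Definition Lpw_normr (x : Lpw) : R[i] := (fine (Lpw_norm (Lpw_repr x)))%:C.

Lemma Lpw_normr_class f : Lpw_normr (Lpw_class f) = (fine (Lpw_norm f))%:C.
Proof.
have le (g h : Lpw_fun) : Lpw_class g = Lpw_class h ->
    fine (Lpw_norm g) <= fine (Lpw_norm h).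
  move=> /eqP gh; rewrite -lee_fin !(Lpw_norm_fin (Lpw_valP _)).
  have /Lpw_norm_null n0 : g - h \in ae_null by rewrite idealrBE.
  rewrite -[X in Lpw_norm X](subrK (Lpw_val h)).
  rewrite (le_trans (Lpw_normD _ _))//.
  - exact: (Lpw_valP (g - h)).
  - exact: Lpw_valP.
  - by rewrite [X in (X + _)%E]n0 add0e.
by congr (_ %:C); apply/eqP; rewrite eq_le !le// Lpw_reprK.
Qed.

Let ler_normD_Lpw x y : Lpw_normr (x + y) <= Lpw_normr x + Lpw_normr y.
Proof.
rewrite -(Lpw_reprK x) -(Lpw_reprK y) -Lpw_classD !Lpw_normr_class.
rewrite -rmorphD/= lecR -lee_fin EFinD !(Lpw_norm_fin (Lpw_valP _)).
rewrite (Lpw_norm_fin (Lpw_valP (Lpw_repr x + Lpw_repr y))).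
exact: (Lpw_normD (Lpw_valP (Lpw_repr x)) (Lpw_valP (Lpw_repr y))).
Qed.

Let normrZ_Lpw (a : R[i]) (x : Lpw) : Lpw_normr (a *: x) = `|a| * Lpw_normr x.
Proof.
rewrite -(Lpw_reprK x) -[_ *: _]Lpw_classZ !Lpw_normr_class.
rewrite [`|a|](_ : _ = (normc a)%:C)// -rmorphM/=; congr (_ %:C).
apply/EFin_inj; rewrite EFinM !(Lpw_norm_fin (Lpw_valP _)).
rewrite (Lpw_norm_fin (Lpw_valP (a *: Lpw_repr x))).
exact: (Lpw_normZ _ (Lpw_valP (Lpw_repr x))).
Qed.

Let normr0_eq0_Lpw x : Lpw_normr x = 0 -> x = 0.
Proof.
rewrite -(Lpw_reprK x) Lpw_normr_class -[0]/((0 : R)%:C) => -[Nx].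
apply/eqP; rewrite -Lpw_class0.
apply/eqP/Lpw_classP; apply/ae_nullP/Lpw_norm_null.
by rewrite -(Lpw_norm_fin (Lpw_valP _)) Nx.
Qed.

HB.instance Definition _ := Lmodule_isNormed.Build R[i] Lpw
  ler_normD_Lpw normrZ_Lpw normr0_eq0_Lpw.

End weighted_Lp.

Section banach_algebras.
Variables (K : numFieldType) (A : normedModType K) (mul : A -> A -> A).

(* The product is only required to be bounded, not contractive. *)
Record banach_algebra : Prop := BanachAlgebra {
  ba_complete : forall F : set_system A, ProperFilter F -> cauchy F -> cvg F;
  ba_linearl : forall b, linear (mul ^~ b);
  ba_linearr : forall a, linear (mul a);
  ba_assoc : associative mul;
  ba_bounded : exists C : K, forall a b, `|mul a b| <= C * `|a| * `|b|
}.

Definition dual_space : set (A -> K^o) :=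
  [set phi | linear phi /\ exists C : K, forall a, `|phi a| <= C * `|a|].

(* The bimodule structure of the dual: (a.phi)(c) = phi(ca) and
   (phi.a)(c) = phi(ac). *)
Definition dual_lact (a : A) (phi : A -> K^o) : A -> K^o :=
  fun c => phi (mul c a).

Definition dual_ract (phi : A -> K^o) (a : A) : A -> K^o :=
  fun c => phi (mul a c).

Record bounded_derivation (D : A -> (A -> K^o)) : Prop := BoundedDerivation {
  derivation_dual : forall a, dual_space (D a);
  derivation_linear : linear D;
  derivation_bounded :
    exists C : K, forall a c, `|D a c| <= C * `|a| * `|c|;
  derivation_leibniz : forall a b,
    D (mul a b) = dual_lact a (D b) + dual_ract (D a) b
}.

Definition inner_derivation (D : A -> (A -> K^o)) : Prop :=
  exists2 phi, dual_space phi &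
    forall a, D a = dual_lact a phi - dual_ract phi a.

Definition weakly_amenable : Prop :=
  forall D, bounded_derivation D -> inner_derivation D.

End banach_algebras.

Section convolution.
Variables (R : realType) (G : topologicalZmodType).
Variable mu : {measure set (borel_type G) -> \bar R}.
Variables (w : weight mu) (p : R) (p1 : 1 <= p).

Definition Lpw_eval (x : Lpw w p1) (s : borel_type G) : R[i] :=
  Lpw_val (Lpw_repr x) s.

(* The convolution of the representatives of [f] and [g] converges absolutely
   almost everywhere and represents the class [mul f g]; the classes do not
   depend on the representatives when [mu] is a Haar measure. *)
Definition is_convolution (mul : Lpw w p1 -> Lpw w p1 -> Lpw w p1) : Prop :=
  forall f g, {ae mu, forall s : borel_type G,
    let h := fun t : borel_type G =>
      Lpw_eval f t * Lpw_eval g ((s : G) - (t : G)) in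
    cintegrable mu h /\ Lpw_eval (mul f g) s = cintegral mu h}.

End convolution.

Definition compactly_generated (G : topologicalZmodType) : Prop :=
  exists2 K : set G, compact K &
    forall H : {pred G}, zmod_closed H ->
      (forall s, K s -> s \in H) -> forall s, s \in H.

Section homomorphisms.
Variables (R : realType) (G : topologicalZmodType).
Variable mu : {measure set (borel_type G) -> \bar R}.

Definition continuous_hom (xi : G -> R[i]) : Prop :=
  {morph xi : s t / s + t} /\ continuous (xi : G -> R[i]^o).

Definition hom_tilde (w : weight mu) (xi : G -> R[i]) (s : borel_type G)
    : R[i] :=
  xi s / (w s * w (- (s : G)))%:C.

End homomorphisms.

Section length_function.
Variables (R : realType) (G T : topologicalZmodType) (k m : nat).

Record structure_iso := StructureIso {
  iso_to :> G -> 'rV[R]_k * 'rV[int]_m * T;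
  iso_of : 'rV[R]_k * 'rV[int]_m * T -> G;
  iso_toK : cancel iso_to iso_of;
  iso_ofK : cancel iso_of iso_to;
  iso_morph : {morph iso_to : s t / s + t};
  iso_to_continuous : continuous
    (iso_to : G -> 'rV[R]_k * discrete_topology 'rV[int]_m * T);
  iso_of_continuous : continuous
    (iso_of : 'rV[R]_k * discrete_topology 'rV[int]_m * T -> G)
}.

Variable phi : structure_iso.

Definition generating_set : set G := [set s |
  (forall i, -1 < (phi s).1.1 0 i < 1) /\
  (forall j, (phi s).1.2 0 j \in [:: -1; 0; 1 : int])].

Definition sumset (U : set G) (n : nat) : set G :=
  [set s | exists2 f : 'I_n -> G, (forall i, U (f i)) & s = \sum_(i < n) f i].

(* The least element of [A], and 0 when [A] is empty. *)
Definition inf_nat (A : set nat) : nat :=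
  xget 0%N [set n | A n /\ forall j, A j -> (n <= j)%N].

Definition group_length (s : G) : nat :=
  if s == 0 then 0%N
  else inf_nat [set n | (0 < n)%N /\ sumset generating_set n s].

End length_function.

(* Main.v *)
From HB Require Import structures.
Require Import Defs.
From mathcomp Require Import all_boot all_order all_algebra.
From mathcomp Require Import all_classical all_reals all_analysis.
From mathcomp Require Import measurable_realfun ess_sup_inf zify ring lra.

Set Implicit Arguments.
Unset Strict Implicit.
Unset Printing Implicit Defensive.
Import Order.TTheory GRing.Theory Num.Theory.
Import numFieldNormedType.Exports.

Local Open Scope classical_set_scope.
Local Open Scope ring_scope.

(** The algebra A = L^p_w(G) is commutative, so the two actions of A on its
dual coincide and the only inner derivation is 0: weak amenability says that
every bounded derivation D : A -> A^* vanishes.  Put beta(f, g) = D(f)(g) for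
continuous compactly supported f and g.  These functions are dense
([dual_dense]), and the Leibniz rule reads
  beta(f * g, c) = beta(g, c * f) + beta(f, g * c).

If no homomorphism exists, D = 0, for every p.  Let T_s denote translation by
s.  The expression beta(T_s a, b * c) - beta(a, T_s (b * c)) is invariant under
cyclic permutations of a, b, c, by the Leibniz rule and T_s a * b = a * T_s b.
Therefore
  xi(s) = beta(T_s a, T_(-s) (b * c)) - beta(a, b * c)
is additive in s ([translation_cocycle_additive]).  It is continuous, and since
T_s has norm at most C w(-s) it is bounded by a multiple of w(s) w(-s)
([xi_bounded]): it is one of the excluded homomorphisms unless it is 0.  So
beta(T_s a, x) = beta(a, T_s x) whenever x = b * c.  A convolution g * f is
approximated by linear combinations of translates of f, the same combination
serving for g * x ([conv_riemann]); hence beta(g * f, x) = beta(f, g * x), and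
the Leibniz rule leaves beta(g, x * f) = 0.  Approximate units and density give
D = 0 ([derivation_vanish]).

Conversely let eta be a nonzero continuous real homomorphism: the real or the
imaginary part of the given one when p <= 2, a coordinate of G when p > 2.  For
k >= 0 continuous with compact support, the formula
  D(f)(g) = iint f(t) eta(t) g(s) k(s + t) ds dt
defines a derivation, by Fubini and the additivity of eta, and it is nonzero
for a good k.  What has to be proved is that D is bounded.  On the support of
k one has w(-t) <= W w(s), so the integrand is at most
  W theta(t) a b k(s + t), where a = |f w|(t), b = |g w|(s) and
  theta(t) = |eta(t)| / (w(t) w(-t)).
Because k is bounded and has the same integral along every section, it suffices
to have theta(t) a b <= c0 (a^p + b^p + a^p b^p + h(t)) with h integrable
([kernel_bound], [hom_not_weakly_amenable]).

For p <= 2 the function theta is essentially bounded by assumption and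
a b <= a^p + b^p + a^p b^p ([mulr_le_powR]).  For p > 2 one takes
h(t) = w(t)^(-q) + w(-t)^(-q).  Let N = |t|: a small neighbourhood of 0 has N
disjoint translates in the ball of radius N, on which w <= w(t), so the
integrability of w^(-q) forces |eta(t)| <= |t| <= C w(t)^q ([hom_le_weight]).
With m the smaller of w(t) and w(-t) this gives
theta(t) <= C m^(q-2) = C tau^(p-2) for tau = m^(-1/(p-1)), and then
tau^(p-2) a b <= a^p + b^p + tau^p, where tau^p = m^(-q) <= h(t)
([conjugate_weight_bound]). *)

(** * Topology of the group, compactly supported functions *)

Notation set_add K L := [set z | exists2 x, K x & exists2 y, L y & z = x + y].

Section topological_group.
Context {G : topologicalZmodType}.
Implicit Types (s t : G) (K L V O : set G).

Lemma continuous_add (T : topologicalType) (f g : T -> G) :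
  continuous f -> continuous g -> continuous (fun x => f x + g x).
Proof.
move=> cf cg x.
apply: (@continuous_comp _ _ _ (fun x => (f x, g x))
  (fun z : G * G => z.1 + z.2)); last exact: add_continuous.
by apply: cvg_pair; [exact: cf|exact: cg].
Qed.

Lemma continuous_opp (T : topologicalType) (f : T -> G) :
  continuous f -> continuous (fun x => - f x).
Proof.
move=> cf x; apply: (@continuous_comp _ _ _ f (fun z : G => - z)).
  exact: cf.
exact: opp_continuous.
Qed.

Lemma continuous_translate s : continuous (fun t : G => t + s).
Proof. by apply: continuous_add => x; [exact: cvg_id|exact: cvg_cst]. Qed.

Lemma compact_add K L : compact K -> compact L ->
  compact (set_add K L).
Proof.
move=> cK cL; rewrite (_ : [set z | _] =
  (fun z : G * G => z.1 + z.2) @` (K `*` L)); last first.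
  apply/seteqP; split=> z /=.
    by case=> x Kx [y Ly ->]; exists (x, y).
  by case=> -[x y] [/= Kx Ly] <-; exists x => //; exists y.
apply: continuous_compact; last exact: compact_setX.
by apply: continuous_subspaceT => x; exact: add_continuous.
Qed.

Lemma compact_opp K : compact K -> compact [set z | K (- z)].
Proof.
move=> cK; rewrite (_ : [set z | _] = -%R @` K).
  apply: continuous_compact => //.
  by apply: continuous_subspaceT => x; exact: opp_continuous.
apply/seteqP; split=> z /=; first by exists (- z); rewrite ?opprK.
by case=> y Ky <-; rewrite opprK.
Qed.

Lemma nbhs_translate s V : nbhs 0 V -> nbhs s [set t | V (t - s)].
Proof.
move=> V0; have := @continuous_translate (- s) s V.
by rewrite /= subrr; apply.
Qed.

Lemma nbhs0_half V : nbhs 0 V -> exists W : set G,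
  [/\ open W, W 0, (forall x, W x -> W (- x)) & forall x y, W x -> W y -> V (x + y)].
Proof.
move=> V0; have := @add_continuous G (0, 0) V; rewrite /= addr0 => /(_ V0).
move=> [[A B] /= [A0 B0] AB].
pose W0 := A `&` B; have : nbhs 0 W0 by exact: filterI.
rewrite nbhsE => -[W1 [oW1 W10] W1W0].
exists (W1 `&` [set x | W1 (- x)]); split.
- apply: openI => //.
  by apply: (@open_comp _ _ (-%R : G -> G)) => // x _; exact: opp_continuous.
- by split => //=; rewrite oppr0.
- by move=> x [? ?]; split => //=; rewrite opprK.
- move=> x y [/W1W0[Ax _] _] [/W1W0[_ By] _]; exact: (AB (x, y)).
Qed.

Hypothesis hG : hausdorff_space G.
Hypothesis lcG : locally_compact [set: G].

Lemma compact_nbhs0 : exists2 V : set G, compact V & nbhs 0 V.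
Proof.
have [V V0 [cV _]] := lcG (I : [set: G] 0).
by exists V => //; rewrite withinET in V0.
Qed.

Lemma compact_nbhs K : compact K -> exists2 L, compact L &
  exists2 O, open O & K `<=` O /\ O `<=` L.
Proof.
move=> cK; have [V cV V0] := compact_nbhs0.
exists (set_add K V).
  exact: compact_add.
exists (\bigcup_(x in K) [set t | V^° (t - x)]).
  apply: bigcup_open => x _.
  apply: (@open_comp _ _ (fun t => t - x)); last exact: open_interior.
  by move=> y _; exact: continuous_translate.
split=> [x Kx|z [x Kx /= /interior_subset Vzx]].
  by exists x => //=; rewrite subrr.
by exists x => //; exists (z - x) => //; rewrite addrC subrK.
Qed.

(** The sums of n elements of K, -K and 0 form the exhaustion: their union is a
subgroup that contains the generators. *)
Lemma compact_exhaustion : compactly_generated G -> exists K_ : nat -> set G,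
  [/\ forall n, compact (K_ n), nondecreasing_seq K_ &
      forall x, exists n, K_ n x].
Proof.
move=> [K cK genK].
pose S := (K `|` [set z | K (- z)]) `|` [set 0].
have cS : compact S.
  apply: compactU; last exact: compact_set1.
  by apply: compactU => //; exact: compact_opp.
pose K_ := fix F n := if n is m.+1 then
  [set z : G | exists2 x, S x & exists2 y, F m y & z = x + y] else [set 0 : G].
have K_S n : K_ n `<=` K_ n.+1.
  by move=> x Kx; exists 0; [right|exists x; rewrite ?add0r].
have K_nd : nondecreasing_seq K_.
  by apply/nondecreasing_seqP => n; apply/subsetPset; exact: K_S.
have K_D m n x y : K_ m x -> K_ n y -> K_ (m + n)%N (x + y).
  elim: m x => [|m IH] x; first by move=> -> Ky; rewrite add0r.
  move=> [s Ss [x' Kx' ->]] Ky; rewrite addSn; exists s => //.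
  by exists (x' + y); [exact: IH|rewrite addrA].
have S_N x : S x -> S (- x).
  case=> [[Kx|Kx]|->]; last by right; rewrite oppr0.
    by left; right; rewrite /= opprK.
  by left; left.
have K_N n x : K_ n x -> K_ n (- x).
  elim: n x => [|n IH] x /=; first by move=> ->; rewrite oppr0.
  move=> [s Ss [y Ky ->]]; exists (- s); first exact: S_N.
  by exists (- y); [exact: IH|rewrite opprD].
exists K_; split => //.
- elim=> [|n IH]; first exact: compact_set1.
  exact: compact_add.
- pose H : {pred G} := mem [set x | exists n, K_ n x].
  suff HT : forall x, x \in H by move=> x; have := HT x; rewrite inE.
  apply: (genK H) => [|s Ks].
    split; first by rewrite inE; exists 0%N.
    move=> x y; rewrite !inE => -[m Kx] [n Ky]; exists (m + n)%N.
    by apply: K_D => //; exact: K_N.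
  rewrite inE; exists 1%N, s; first by left; left.
  by exists 0; rewrite ?addr0.
Qed.

End topological_group.

Section compactly_supported.
Context {R : realType} {G : topologicalZmodType}.
Implicit Types (f g : G -> R) (K L O : set G).

Definition Cc f := continuous f /\
  exists2 K, compact K & forall x, ~ K x -> f x = 0.

Lemma CcD f g : Cc f -> Cc g -> Cc (fun x => f x + g x).
Proof.
move=> [cf [K cK fK]] [cg [L cL gL]]; split.
  by move=> x; apply: cvgD; [exact: cf|exact: cg].
exists (K `|` L); first exact: compactU.
by move=> x /not_orP[? ?]; rewrite fK// gL// addr0.
Qed.

Lemma CcMl f g : continuous f -> Cc g -> Cc (fun x => f x * g x).
Proof.
move=> cf [cg [L cL gL]]; split.
  by move=> x; apply: cvgM; [exact: cf|exact: cg].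
by exists L => // x ?; rewrite gL// mulr0.
Qed.

Lemma CcZ (a : R) f : Cc f -> Cc (fun x => a * f x).
Proof. by move=> ?; apply: CcMl => // x; exact: cvg_cst. Qed.

Lemma Cc_translate f s : Cc f -> Cc (fun x => f (x + s)).
Proof.
move=> [cf [K cK fK]]; split.
  move=> x; apply: (@continuous_comp _ _ _ (fun x => x + s)); last exact: cf.
  exact: continuous_translate.
exists (set_add K [set - s]).
  by apply: compact_add => //; exact: compact_set1.
move=> x nKx; apply: fK => Kx; apply: nKx; exists (x + s) => //.
by exists (- s) => //; rewrite addrK.
Qed.

Lemma Cc_opp f : Cc f -> Cc (fun x => f (- x)).
Proof.
move=> [cf [K cK fK]]; split.
  move=> x; apply: (@continuous_comp _ _ _ -%R); last exact: cf.
  exact: opp_continuous.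
by exists [set z | K (- z)]; [exact: compact_opp|move=> x /fK].
Qed.

Hypothesis hG : hausdorff_space G.
Hypothesis lcG : locally_compact [set: G].

(** Urysohn's lemma is applied in the one-point compactification of G, which is
compact and Hausdorff, hence normal.  Intersecting O with a relatively compact
neighbourhood of K makes the support compact. *)
Lemma urysohn_compact K O : compact K -> open O -> K `<=` O ->
  exists f, [/\ Cc f, forall x, 0 <= f x <= 1, forall x, K x -> f x = 1 &
                forall x, ~ O x -> f x = 0].
Proof.
move=> cK oO KO.
have [L cL [M oM [KM ML]]] := compact_nbhs lcG cK.
pose X := one_point_compactification G.
have hX : hausdorff_space X by exact: one_point_compactification_hausdorff.
have nX : normal_space X.
  by apply: compact_normal => //; exact: one_point_compactification_compact.
pose U := @Some G @` (O `&` M).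
have oU : @open X U by apply: one_point_compactification_open_some; exact: openI.
have cSK : @compact X (@Some G @` K).
  apply: continuous_compact => //; apply: continuous_subspaceT.
  exact: one_point_compactification_some_continuous.
have /(@uniform_separatorP X R)[f [cf f01 f0 f1]] :
    uniform_separator (~` U : set X) (@Some G @` K : set X).
  move/(@normal_separatorP R) : nX; apply.
  - exact: open_closedC.
  - exact: compact_closed.
  - apply/seteqP; split => // y [nUy [x Kx xy]]; apply: nUy.
    by exists x => //; split; [exact: KO|exact: KM].
have fU x : ~ (O x /\ M x) -> f (Some x) = 0.
  move=> nOx; suff : [set (0 : R)] (f (Some x)) by [].
  by apply: f0; exists (Some x) => // -[y Oy [yx]]; rewrite yx in Oy.
exists (fun x => f (Some x)); split.
- split.
    move=> x; apply: (@continuous_comp _ X _ Some); last exact: cf.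
    exact: one_point_compactification_some_continuous.
  by exists L => // x nLx; apply: fU => -[_ /ML].
- by move=> x; have : range f (f (Some x)) by []; move/f01; rewrite /= in_itv.
- move=> x Kx; suff : [set (1 : R)] (f (Some x)) by [].
  by apply: f1; exists (Some x) => //; exists x.
- by move=> x nOx; apply: fU => -[].
Qed.

(** The tube lemma: what makes an integral over K continuous in a parameter. *)
Lemma near_compact_close (T : topologicalType) K (F : T * G -> R) t0 (e : R) :
  compact K -> continuous F -> 0 < e ->
  \forall t \near t0, forall x, K x -> `|F (t, x) - F (t0, x)| < e.
Proof.
move=> cK cF e0.
have := (compact_near_coveringP K).1 cK T (nbhs t0)
  (fun t x => `|F (t, x) - F (t0, x)| < e) _; apply => x Kx.
have e20 : 0 < e / 2 by rewrite divr_gt0.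
have cF1 : \forall z \near (t0, x), `|F (t0, x) - F z| < e / 2.
  by have /cvgrPdist_lt/(_ _ e20) := cF (t0, x).
have [[A B] /= [A0 Bx] AB] := cF1.
exists (B, A) => //= -[y t] /= [By At].
rewrite (le_lt_trans (ler_distD (F (t0, x)) _ _))// [e]splitr ltrD//.
  by rewrite distrC; exact: (AB (t, y)).
by apply: (AB (t0, y)); split => //; exact: nbhs_singleton.
Qed.

(** Translating by small s keeps the support in the compact set L; off K and L
both values are 0, so closeness is only at stake on a compact set. *)
Lemma Cc_uniform f (e : R) : Cc f -> 0 < e ->
  \forall s \near (0 : G), forall x, `|f (x + s) - f x| < e.
Proof.
move=> [cf [K cK fK]] e0.
have [V cV V0] := compact_nbhs0 lcG.
pose L := set_add K [set z | V (- z)].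
have cL : compact L by apply: compact_add => //; exact: compact_opp.
have cF : continuous (fun z : G * G => f (z.2 + z.1)).
  move=> z; apply: (@continuous_comp _ _ _ (fun z : G * G => z.2 + z.1)).
    by apply: continuous_add => y; [exact: cvg_snd|exact: cvg_fst].
  exact: cf.
have cKL : compact (K `|` L) by exact: compactU.
have := near_compact_close (0 : G) cKL cF e0; apply: filterS2 V0 => s Vs /= H x.
have [KLx|/not_orP[nK nL]] := pselect ((K `|` L) x).
  by have := H x KLx; rewrite addr0.
rewrite (fK x)// (fK (x + s)) ?subrr ?normr0// => Kxs; apply: nL.
by exists (x + s) => //; exists (- s); rewrite /= ?opprK ?addrK.
Qed.

End compactly_supported.

(** * Borel measurability and Fubini for Haar measure *)

Section measure_preserving.
Context d (T : measurableType d) (R : realType).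
Variables (mu : {measure set T -> \bar R}) (phi : T -> T).
Hypothesis mphi : measurable_fun [set: T] phi.
Hypothesis muphi : forall A, measurable A -> mu (phi @^-1` A) = mu A.

Lemma ge0_integral_preserving (f : T -> \bar R) :
  measurable_fun [set: T] f -> (forall x, 0 <= f x)%E ->
  (\int[mu]_x f (phi x) = \int[mu]_x f x)%E.
Proof.
move=> mf f0.
rewrite (_ : (\int[mu]_x f x)%E = (\int[pushforward mu phi]_x f x)%E).
  by rewrite (ge0_integral_pushforward mphi mu).
by apply: eq_measure_integral => A mA _; rewrite -muphi.
Qed.

Lemma integral_preserving (f : T -> \bar R) :
  measurable_fun [set: T] f -> (\int[mu]_x f (phi x) = \int[mu]_x f x)%E.
Proof.
move=> mf; rewrite integralE [RHS]integralE.
rewrite -(ge0_integral_preserving (measurable_funepos mf))//.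
rewrite -(ge0_integral_preserving (measurable_funeneg mf))//.
congr (_ - _)%E; apply: eq_integral => x _.
  by rewrite [in LHS](funepos_comp f phi).
by rewrite [in LHS](funeneg_comp f phi).
Qed.

Lemma ae_preserving (P : T -> Prop) :
  {ae mu, forall x, P x} -> {ae mu, forall x, P (phi x)}.
Proof.
move=> [N [mN N0 PN]]; exists (phi @^-1` N); split.
- by rewrite -[X in measurable X]setTI; exact: mphi.
- by rewrite muphi.
- by move=> x /= nP; exact: PN.
Qed.

End measure_preserving.

Section borel.
Context {R : realType} {G : topologicalZmodType}.
Local Notation B := (borel_type G).
Hypothesis hG : hausdorff_space G.
Implicit Types (K L O : set G) (f g k : G -> R).

Lemma borel_open O : open O -> measurable (O : set B).
Proof. by move=> oO; exact: sub_sigma_algebra. Qed.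

Lemma borel_closed O : closed O -> measurable (O : set B).
Proof.
move=> cO; rewrite -(setCK O); apply: measurableC.
by apply: borel_open; exact: closed_openC.
Qed.

Lemma borel_compact K : compact K -> measurable (K : set B).
Proof. by move=> cK; apply: borel_closed; exact: compact_closed. Qed.

Lemma continuous_borel f : continuous f ->
  measurable_fun [set: B] (f : B -> R).
Proof.
move=> cf.
apply: (measurability _ (measurable_realfun.RGenOInfty.measurableE R)).
move=> /= _ [_ [x ->] <-]; rewrite setTI; apply: borel_open.
by apply: open_comp; [move=> y _; exact: cf|exact: interval_open].
Qed.

Lemma continuous_borel_map (phi : G -> G) : continuous phi ->
  measurable_fun [set: B] (phi : B -> B).
Proof.
move=> cphi; apply: (@measurability _ _ B B setT phi (@open G)) => //.
move=> /= _ [U oU <-]; rewrite setTI; apply: borel_open.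
by apply: open_comp => // y _; exact: cphi.
Qed.

(** Without second countability an open subset of G * G may fail to be
measurable for the product of the Borel sigma-algebras.  A compact set is
however separated from the complement of an open neighbourhood by a finite
union of open rectangles, which is measurable. *)
Lemma compact_open_rectangles (K : set (G * G)) (O : set (G * G)) :
  compact K -> open O -> K `<=` O ->
  exists M : set (B * B), [/\ measurable M, K `<=` M & M `<=` O].
Proof.
move=> cK oO KO.
(* the measurable subsets of O, filtered by inclusion, eventually contain K *)
pose D := [set M : set (B * B) | measurable M /\ M `<=` O].
pose F := filter_from D (fun M => [set N : set (B * B) | M `<=` N]).
have FF : Filter F.
  apply: filter_from_filter; first by exists set0; split; [exact: measurable0|exact: sub0set].
  move=> M N [mM MO] [mN NO]; exists (M `|` N).
    by split; [exact: measurableU|rewrite subUset].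
  by move=> P; rewrite /= subUset.
have /(_ _ F (fun M z => M z) FF)[z Kz|M [mM MO] /= MK] :=
    (compact_near_coveringP K).1 cK; last first.
  by exists M; split => //; exact: MK.
have [[A C] /= [Az Cz] AC] : nbhs z O by apply: open_nbhs_nbhs; split => //; exact: KO.
exists (A^° `*` C^°, [set N | A^° `*` C^° `<=` N]) => /=; last first.
  by move=> [x N] /= [ACx]; apply.
split; first by exists (A^°, C^°) => //; split; exact: nbhs_interior.
exists (A^° `*` C^°) => //; split.
  by apply: measurableX; apply: borel_open; exact: open_interior.
by move=> y [/interior_subset Ay /interior_subset Cy]; exact: AC.
Qed.

Hypothesis cgG : compactly_generated G.

(** The group is sigma-compact, so [{F > c}] is a countable union of compact
sets [{F >= c + 1/(n+1)}] restricted to K_n * K_n; each of them is inserted in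
[{F > c}] together with a measurable set. *)
Lemma continuous_prod_borel (F : G * G -> R) : continuous F ->
  measurable_fun [set: B * B] (F : B * B -> R).
Proof.
move=> cF.
apply: (measurability _ (measurable_realfun.RGenOInfty.measurableE R)).
move=> /= _ [_ [c ->] <-]; rewrite setTI.
have [K_ [cK ndK KT]] := compact_exhaustion cgG.
have oc (a : R) : open (F @^-1` `]a, +oo[).
  by apply: open_comp; [move=> y _; exact: cF|exact: interval_open].
pose C n := (F @^-1` `[c + n.+1%:R^-1, +oo[) `&` (K_ n `*` K_ n).
have cC n : compact (C n).
  rewrite /C setIC; apply: compact_closedI; first exact: compact_setX.
  by apply: closed_comp; [move=> y _; exact: cF|exact: interval_closed].
have CO n : C n `<=` F @^-1` `]c, +oo[.
  move=> z [/=]; rewrite !in_itv /= !andbT => cz _.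
  by rewrite (lt_le_trans _ cz)// ltrDl invr_gt0.
have [M MP] := choice (fun n => compact_open_rectangles (cC n) (oc c) (@CO n)).
rewrite (_ : _ @^-1` _ = \bigcup_n M n).
  by apply: bigcupT_measurable => n; have [] := MP n.
apply/seteqP; split => [[x y] /= cxy|z [n _]]; last first.
  by have [_ _] := MP n; apply.
rewrite in_itv /= andbT in cxy.
have [nx Kx] := KT x; have [ny Ky] := KT y.
have Fc0 : 0 < F (x, y) - c by rewrite subr_gt0.
have [m Hm] : exists m : nat, (m.+1%:R^-1 : R) < F (x, y) - c.
  exists (Num.truncn (F (x, y) - c)^-1).
  rewrite invf_plt ?posrE//.
  exact: truncnS_gt.
pose n := maxn m (maxn nx ny).
exists n => //; have [_ CM _] := MP n; apply: CM; split => /=.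
  rewrite in_itv /= andbT -lerBrDl (le_trans _ (ltW Hm))//.
  by rewrite lef_pV2 ?posrE// ler_nat ltnS leq_maxl.
split => /=.
  have nxn : (nx <= n)%N by rewrite /n; lia.
  by have /subsetPset := ndK _ _ nxn; apply.
have nyn : (ny <= n)%N by rewrite /n; lia.
by have /subsetPset := ndK _ _ nyn; apply.
Qed.

End borel.

Section haar.
Context {R : realType} {G : topologicalZmodType}.
Local Notation B := (borel_type G).
Variable mu : {measure set B -> \bar R}.
Hypothesis hG : hausdorff_space G.
Hypothesis lcG : locally_compact [set: G].
Hypothesis cgG : compactly_generated G.
Hypothesis haar : haar_measure mu.
Implicit Types (K L O : set G) (f g k : G -> R).

Lemma haar_translate s (A : set B) : measurable A ->
  mu ((fun t : B => (t : G) + s : B) @^-1` A) = mu A.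
Proof.
move=> mA; rewrite -(haar_invariant haar (- s) mA); congr (mu _).
apply/seteqP; split => [x /= Ax|_ [x /= Ax <-]].
  by exists (x + s) => //; rewrite addrC addrK.
by rewrite /= addrC addrA subrr add0r.
Qed.

Lemma measurable_translate s :
  measurable_fun [set: B] (fun t : B => (t : G) + s : B).
Proof.
by apply: (@continuous_borel_map _ (fun t : G => t + s)); exact: continuous_translate.
Qed.

Lemma bounded_integrable (f : B -> R) K (M : R) : measurable_fun [set: B] f ->
  compact K -> (forall x, ~ K x -> f x = 0) -> (forall x, `|f x| <= M) ->
  mu.-integrable [set: B] (EFin \o f).
Proof.
move=> mf cK fK fM.
have mK : measurable (K : set B) by exact: borel_compact.
rewrite (_ : EFin \o f = (EFin \o f) \_ (K : set B)); last first.
  apply/funext => x; rewrite /patch; case: ifPn => // /negP xK /=.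
  by rewrite fK// => Kx; apply: xK; rewrite inE.
apply/(integrable_mkcond (EFin \o f) mK).
apply: measurable_bounded_integrable => //.
- exact: haar_compact.
- exact: measurable_funTS.
- by exists M; split; [exact: num_real|move=> N MN x _ /=; rewrite (le_trans (fM x))// ltW].
Qed.

Lemma Cc_bounded f : Cc f -> exists2 M : R, 0 <= M & forall x, `|f x| <= M.
Proof.
move=> [cf [K cK fK]].
have : compact (f @` K).
  by apply: continuous_compact => //; exact: continuous_subspaceT.
move=> /compact_bounded [M [_ HM]].
exists (`|M| + 1); first by rewrite addr_ge0.
move=> x; have [Kx|nKx] := pselect (K x); last by rewrite fK// normr0 addr_ge0.
apply: (HM (`|M| + 1)); last by exists x.
by rewrite (le_lt_trans (ler_norm _))// ltrDl.
Qed.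

Lemma Cc_integrable f : Cc f -> mu.-integrable [set: B] (EFin \o f).
Proof.
move=> Cf; have [M _ fM] := Cc_bounded Cf; have [cf [K cK fK]] := Cf.
by apply: (bounded_integrable _ cK fK fM); exact: continuous_borel.
Qed.

(** The function exceeds half of its value at x0 on a nonempty open set, which
has positive Haar measure. *)
Lemma Cc_int_gt0 f x0 : Cc f -> (forall x, 0 <= f x) -> 0 < f x0 ->
  0 < \int[mu]_x f x.
Proof.
move=> Cf f0 fx0; have [cf _] := Cf.
pose c := f x0 / 2; have c0 : 0 < c by rewrite divr_gt0.
pose O := f @^-1` `]c, +oo[.
have oO : open O.
  by apply: open_comp; [move=> y _; exact: cf|exact: interval_open].
have mO : measurable (O : set B) by exact: borel_open.
have Opos : (0 < mu O)%E.
  apply: (haar_open haar) => //; exists x0; rewrite /O /= in_itv /= andbT.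
  by rewrite /c gtr_pMr// invf_lt1// ltr1n.
have If := Cc_integrable Cf.
rewrite /Rintegral fine_gt0//; apply/andP; split; last first.
  have := integrable_fin_num measurableT If.
  by rewrite fin_numE => /andP[_]; rewrite ltey.
apply: (@lt_le_trans _ _ (c%:E * mu O)%E); first by rewrite mule_gt0// lte_fin.
rewrite -[X in (_ * mu X)%E]setIT -integral_indic// -ge0_integralZl//; last 2 first.
  exact/measurable_EFinP/measurable_indic.
  by rewrite lee_fin ltW.
apply: ge0_le_integral => //.
- by move=> x _; rewrite mule_ge0// lee_fin ltW.
- by apply: measurable_funeM; exact/measurable_EFinP/measurable_indic.
- by apply/measurable_EFinP; exact: continuous_borel.
move=> x _; rewrite -EFinM lee_fin indicE.
have [|_] := boolP (x \in O); last by rewrite mulr0.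
by rewrite inE /O /= in_itv /= andbT mulr1 => /ltW.
Qed.

Lemma haar_sigma_finite : sigma_finite [set: B] mu.
Proof.
have [K_ [cK ndK KT]] := compact_exhaustion cgG.
exists K_; first by apply/seteqP; split => // x _; have [n] := KT x; exists n.
move=> n; split; first exact: borel_compact.
exact: haar_compact.
Qed.

Let haar_sf : {sigma_finite_measure set B -> \bar R} :=
  HB.pack_for {sigma_finite_measure set B -> \bar R} (Measure.sort mu)
    (isSFinite.Build _ _ _ (Measure.sort mu)
      (sfinite_measure_sigma_finite haar_sigma_finite))
    (isSigmaFinite.Build _ _ _ (Measure.sort mu) haar_sigma_finite).

Section tonelli.
Variable F : B * B -> \bar R.
Hypothesis mF : measurable_fun [set: B * B] F.
Hypothesis F0 : forall z, (0 <= F z)%E.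

Lemma haar_tonelli : (\int[mu]_x \int[mu]_y F (x, y) =
                      \int[mu]_y \int[mu]_x F (x, y))%E.
Proof. exact: (@fubini_tonelli _ _ _ _ _ haar_sf haar_sf F mF F0). Qed.

Lemma haar_measurable_tonelli :
  measurable_fun [set: B] (fun x => \int[mu]_y F (x, y))%E.
Proof.
exact: (@measurable_fun_fubini_tonelli_F _ _ _ _ _ haar_sf F mF F0).
Qed.
End tonelli.

Section fubini.
Variable F : B * B -> R.
Hypothesis mF : measurable_fun [set: B * B] F.
Hypothesis F_int : (\int[mu]_x \int[mu]_y `|F (x, y)|%:E < +oo)%E.

Let F_prod_int : (haar_sf \x haar_sf)%E.-integrable [set: B * B] (EFin \o F).
Proof. by apply/integrable12ltyP => //; exact/measurable_EFinP. Qed.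

Lemma haar_fubini : (\int[mu]_x \int[mu]_y (F (x, y))%:E =
                     \int[mu]_y \int[mu]_x (F (x, y))%:E)%E.
Proof. exact: Fubini F_prod_int. Qed.

Lemma haar_integrable_fubini :
  mu.-integrable [set: B] (fun x => \int[mu]_y (F (x, y))%:E)%E.
Proof. exact: integrable_fubini_F F_prod_int. Qed.
End fubini.

(** Compact support bounds the integrand by a multiple of the indicator of a
rectangle of finite measure, which is the integrability that Fubini needs. *)
Lemma Cc_fubini (F : G * G -> R) K L : continuous F -> compact K -> compact L ->
  (forall x y, ~ (K x /\ L y) -> F (x, y) = 0) ->
  \int[mu]_x (\int[mu]_y F (x, y)) = \int[mu]_y (\int[mu]_x F (x, y)).
Proof.
move=> cF cK cL FKL.
have mK := borel_compact hG cK; have mL := borel_compact hG cL.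
have mF : measurable_fun [set: B * B] (F : B * B -> R).
  exact: continuous_prod_borel.
have mF1 x : measurable_fun [set: B] (fun y : B => F (x, y)).
  exact: (measurableT_comp mF (pair1_measurable (x : B))).
have mF2 y : measurable_fun [set: B] (fun x : B => F (x, y)).
  exact: (measurableT_comp mF (pair2_measurable (y : B))).
have mI (K' : set G) : compact K' ->
    measurable_fun [set: B] (fun x : B => (\1_K' x : R)%:E).
  by move=> cK'; apply/measurable_EFinP; apply: (@measurable_indic _ B); exact: borel_compact.
have mIK := mI _ cK; have mIL := mI _ cL.
have [M0 [M0r HM]] : bounded_set (F @` (K `*` L)).
  apply: compact_bounded; apply: continuous_compact; last exact: compact_setX.
  exact: continuous_subspaceT.
pose M := `|M0| + 1.
have M0' : 0 <= M by rewrite addr_ge0.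
have FM x y : `|F (x, y)| <= M * (\1_K x * \1_L y).
  have [[Kx Ly]|nKL] := pselect (K x /\ L y); last first.
    by rewrite FKL// normr0 !mulr_ge0.
  rewrite !indicE !mem_set// !mulr1; apply: (HM M); last by exists (x, y).
  by rewrite (le_lt_trans (ler_norm _))// ltrDl.
have F1 x : mu.-integrable [set: B] (fun y => (F (x, y))%:E).
  apply: (@bounded_integrable (fun y => F (x, y)) L M) => //.
  - by move=> y nLy; apply: FKL => -[].
  - by move=> y; rewrite (le_trans (FM x y))// ler_piMr// !indicE.
have F2 y : mu.-integrable [set: B] (fun x => (F (x, y))%:E).
  apply: (@bounded_integrable (fun x => F (x, y)) K M) => //.
  - by move=> x nKx; apply: FKL => -[].
  - by move=> x; rewrite (le_trans (FM x y))// ler_piMr// !indicE.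
have IF : (\int[mu]_x \int[mu]_y `|F (x, y)|%:E < +oo)%E.
  apply: (@le_lt_trans _ _ (\int[mu]_x ((M%:E * mu L) * (\1_K x)%:E))%E).
    apply: ge0_le_integral => //.
    - by move=> x _; apply: integral_ge0 => y _; rewrite lee_fin.
    - apply: (@haar_measurable_tonelli (fun z => `|F z|%:E)).
        by apply/measurable_EFinP; exact: measurableT_comp.
      by move=> z; rewrite lee_fin.
    - by apply: measurable_funeM; exact: mIK.
    move=> x _.
    rewrite -[in leRHS](setIT (L : set B)) -integral_indic//.
    rewrite -ge0_integralZl//.
    rewrite -ge0_integralZr//; last 2 first.
    - by apply: measurable_funeM; exact: mIL.
    - by move=> y _; rewrite mule_ge0// lee_fin.
    apply: ge0_le_integral => //.
    - by apply/measurable_EFinP; apply: (measurableT_comp _ (mF1 x)).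
    - apply: emeasurable_funM => //.
      by apply: emeasurable_funM.
    by move=> y _; rewrite -!EFinM lee_fin -mulrA [in leRHS](mulrC (\1_L _)) FM.
  rewrite ge0_integralZl//; last by rewrite mule_ge0.
  rewrite integral_indic// setIT.
  have KF := haar_compact haar cK; have LF := haar_compact haar cL.
  by rewrite !lte_mul_pinfty// ?mule_ge0// ?fin_numM// ?ge0_fin_numE//.
have IE (H : B -> R) (FH : mu.-integrable setT (EFin \o H)) :
    ((\int[mu]_y H y)%R%:E = \int[mu]_y (H y)%:E)%E.
  by rewrite /Rintegral fineK//; exact: integrable_fin_num.
rewrite /Rintegral; congr fine.
transitivity (\int[mu]_x \int[mu]_y (F (x, y))%:E)%E.
  by apply: eq_integral => x _; exact: (IE (fun y => F (x, y)) (F1 x)).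
rewrite haar_fubini//.
by apply: eq_integral => y _; apply/esym; exact: (IE (fun x => F (x, y)) (F2 y)).
Qed.

End haar.

(** * Inversion invariance and convolution *)

Section haar_convolution.
Context {R : realType} {G : topologicalZmodType}.
Local Notation B := (borel_type G).
Variable mu : {measure set B -> \bar R}.
Hypothesis hG : hausdorff_space G.
Hypothesis lcG : locally_compact [set: G].
Hypothesis cgG : compactly_generated G.
Hypothesis haar : haar_measure mu.
Implicit Types (K L O : set G) (f g k phi : G -> R).

Lemma int_translate f s : measurable_fun [set: B] (f : B -> R) ->
  \int[mu]_x f ((x : G) + s) = \int[mu]_x f x.
Proof.
move=> mf; rewrite /Rintegral; congr fine.
apply: (integral_preserving (measurable_translate s) (haar_translate haar s)
  (f := EFin \o f)).
exact/measurable_EFinP.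
Qed.

Lemma continuous_translater f s : continuous f -> continuous (fun x => f (x + s)).
Proof.
move=> cf x; apply: (@continuous_comp _ _ _ (fun x => x + s)); last exact: cf.
exact: continuous_translate.
Qed.

Lemma continuous_comp_sub (T : topologicalType) f (a b : T -> G) :
  continuous f -> continuous a -> continuous b ->
  continuous (fun x => f (a x - b x)).
Proof.
move=> cf ca cb x.
apply: (@continuous_comp _ _ _ (fun x => a x - b x)); last exact: cf.
by apply: continuous_add => //; exact: continuous_opp.
Qed.

Lemma continuous_comp_add (T : topologicalType) f (a b : T -> G) :
  continuous f -> continuous a -> continuous b ->
  continuous (fun x => f (a x + b x)).
Proof.
move=> cf ca cb x.
apply: (@continuous_comp _ _ _ (fun x => a x + b x)); last exact: cf.
exact: continuous_add.
Qed.

Lemma continuous_mul (T : topologicalType) (a b : T -> R) :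
  continuous a -> continuous b -> continuous (fun x => a x * b x).
Proof. by move=> ca cb x; apply: cvgM; [exact: ca|exact: cb]. Qed.

Lemma continuous_fst (S T : topologicalType) : continuous (@fst S T).
Proof. by move=> x; exact: cvg_fst. Qed.

Lemma continuous_snd (S T : topologicalType) : continuous (@snd S T).
Proof. by move=> x; exact: cvg_snd. Qed.

Lemma continuous_comp_fst (S T : topologicalType) (f : S -> R) :
  continuous f -> continuous (fun z : S * T => f z.1).
Proof. by move=> cf z; apply: (@continuous_comp _ _ _ fst f); [exact: cvg_fst|exact: cf]. Qed.

Lemma continuous_comp_snd (S T : topologicalType) (f : T -> R) :
  continuous f -> continuous (fun z : S * T => f z.2).
Proof. by move=> cf z; apply: (@continuous_comp _ _ _ snd f); [exact: cvg_snd|exact: cf]. Qed.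

Lemma CcMr f g : Cc f -> continuous g -> Cc (fun x => f x * g x).
Proof.
move=> Cf cg; rewrite (_ : (fun _ => _) = (fun x => g x * f x)); first exact: CcMl.
by apply/funext => x; rewrite mulrC.
Qed.

Lemma RintegralZl_Cc (a : R) f : Cc f ->
  \int[mu]_x (a * f x) = a * \int[mu]_x f x.
Proof. by move=> Cf; apply: RintegralZl => //; exact: Cc_integrable. Qed.

Lemma RintegralZr_Cc (a : R) f : Cc f ->
  \int[mu]_x (f x * a) = (\int[mu]_x f x) * a.
Proof. by move=> Cf; apply: RintegralZr => //; exact: Cc_integrable. Qed.

Lemma Cc_bump : exists2 f, Cc f & (forall x, 0 <= f x) /\ 0 < \int[mu]_x f x.
Proof.
have [f [Cf f01 f1 _]] := @urysohn_compact R G hG lcG [set 0] setT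
  (@compact_set1 _ _) openT (@subsetT _ _).
have f0 x : 0 <= f x by have /andP[] := f01 x.
exists f => //; split => //.
by apply: (@Cc_int_gt0 _ _ _ hG haar f 0) => //; rewrite f1.
Qed.

(** For f of nonzero integral, Fubini and translations turn the integral of
[f (t + s) * g (- s)] into the product of the integrals of f and [g \o -%R] in
one order, and of f and g in the other. *)
Lemma Cc_int_opp g : Cc g -> \int[mu]_x g (- (x : G)) = \int[mu]_x g x.
Proof.
move=> Cg; have [f Cf [f0 fpos]] := Cc_bump.
have [cf [K cK fK]] := Cf; have [cg [L cL gL]] := Cg.
have cNL := compact_opp cL.
apply: (@mulfI _ (\int[mu]_x f x)); first by rewrite gt_eqF.
have cg' : continuous (fun x : G => g (- x)) by have [] := Cc_opp Cg.
transitivity (\int[mu]_s (\int[mu]_t (f ((t : G) + (s : G)) * g (- (s : G))))).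
  rewrite -RintegralZl_Cc; last exact: Cc_opp.
  apply: eq_Rintegral => s _; rewrite RintegralZr_Cc; last exact: Cc_translate.
  by rewrite int_translate//; exact: continuous_borel.
rewrite (@Cc_fubini _ _ _ hG cgG haar (fun z => f (z.2 + z.1) * g (- z.1))
   [set z | L (- z)] (set_add K L))//; last 3 first.
- apply: continuous_mul.
    by apply: continuous_comp_add => //; [exact: continuous_snd|exact: continuous_fst].
  exact: (continuous_comp_fst (f := fun x : G => g (- x))).
- exact: compact_add.
- move=> s t /= nKL; have [Ls|nLs] := pselect (L (- s)); last by rewrite gL// mulr0.
  rewrite fK ?mul0r// => Kts; apply: nKL; split => //; exists (t + s) => //.
  by exists (- s) => //; rewrite addrK.
transitivity (\int[mu]_t (\int[mu]_s (f s * g ((t : G) - (s : G))))).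
  apply: eq_Rintegral => t _ /=.
  rewrite -(@int_translate _ (- (t : G))).
    by apply: eq_Rintegral => s _; rewrite addrCA subrr addr0 opprB.
  apply: continuous_borel; apply: continuous_mul => //.
  by apply: continuous_comp_add => // x; [exact: cvg_cst|exact: cvg_id].
rewrite (@Cc_fubini _ _ _ hG cgG haar (fun z => f z.2 * g (z.1 - z.2))
   (set_add K L) K)//; last 3 first.
- apply: continuous_mul.
    exact: continuous_comp_snd.
  by apply: continuous_comp_sub => //; [exact: continuous_fst|exact: continuous_snd].
- exact: compact_add.
- move=> t s /= nKL; have [Ks|nKs] := pselect (K s); last by rewrite fK// mul0r.
  rewrite gL ?mulr0// => Lts; apply: nKL; split => //; exists s => //.
  by exists (t - s) => //; rewrite addrC subrK.
rewrite -RintegralZr_Cc//; apply: eq_Rintegral => s _ /=.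
rewrite RintegralZl_Cc; last exact: Cc_translate.
by rewrite int_translate//; exact: continuous_borel.
Qed.

Lemma measurable_opp : measurable_fun [set: B] (fun t : B => - (t : G) : B).
Proof. by apply: (@continuous_borel_map _ (fun t : G => - t)) => x; exact: opp_continuous. Qed.

Lemma open_opp O : open O -> open [set x | O (- x)].
Proof.
by move=> oO; apply: (@open_comp _ _ (-%R : G -> G)) => // x _; exact: opp_continuous.
Qed.

(** Urysohn functions squeezed between a compact set and O transfer
[Cc_int_opp] to measures, by inner regularity. *)
Lemma haar_open_opp_le O : open O -> (mu O <= mu (((fun x : G => - x)%R : B -> B) @^-1` O))%E.
Proof.
move=> oO; rewrite (haar_inner_regular haar oO).
apply: ge_ereal_sup => _ [K [cK KO] <-].
have [g [Cg g01 g1 g0]] := urysohn_compact (R := R) hG lcG cK oO KO.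
have Cg' := Cc_opp Cg.
have g0' x : 0 <= g x by have /andP[] := g01 x.
have IE f : Cc f -> ((\int[mu]_x f x)%R%:E = \int[mu]_x (f x)%:E)%E.
  move=> Cf; rewrite /Rintegral fineK//; apply: integrable_fin_num => //.
  exact: Cc_integrable.
have mK : measurable (K : set B) by exact: borel_compact.
have mO' : measurable ([set x | O (- x)] : set B) by apply: borel_open; exact: open_opp.
apply: (@le_trans _ _ (\int[mu]_x (g x)%:E)%E).
  rewrite -[X in mu X]setIT -integral_indic//; apply: ge0_le_integral => //.
  - exact/measurable_EFinP/measurable_indic.
  - by apply/measurable_EFinP; have [cg _] := Cg; exact: continuous_borel.
  move=> x _; rewrite lee_fin indicE; have [|_] := boolP (x \in K).
    by rewrite inE => /g1 ->.
  exact: g0'.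
rewrite -IE// -Cc_int_opp// IE//.
rewrite -[X in (_ <= mu X)%E]setIT -integral_indic//; apply: ge0_le_integral => //.
- by move=> x _; rewrite lee_fin.
- by apply/measurable_EFinP; have [cg _] := Cg'; exact: continuous_borel.
- exact/measurable_EFinP/measurable_indic.
move=> x _; rewrite lee_fin indicE.
have [_|/negP nO] := boolP (x \in _); first by have /andP[] := g01 (- x).
by rewrite g0// => Ox; apply: nO; rewrite inE.
Qed.

(** Outer regularity passes from open sets to Borel sets. *)
Lemma haar_opp (A : set B) : measurable A ->
  mu ((fun t : B => - (t : G) : B) @^-1` A) = mu A.
Proof.
have HO O : open O -> mu ((fun x : G => - x) @^-1` O) = mu O.
  move=> oO; apply/le_anti/andP; split; last exact: haar_open_opp_le.
  have := haar_open_opp_le (open_opp oO).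
  rewrite (_ : _ @^-1` [set x | O (- x)] = O)//.
  by apply/funext => x /=; rewrite opprK.
move=> mA.
have mA' : measurable ((fun t : B => - (t : G) : B) @^-1` A).
  by rewrite -[X in measurable X]setTI; exact: measurable_opp.
rewrite (haar_outer_regular haar mA) (haar_outer_regular haar mA'); congr ereal_inf.
apply/seteqP; split => _ [U [oU AU] <-].
  exists [set x | U (- x)]; last exact: HO.
  split; first exact: open_opp.
  by move=> x Ax /=; apply: AU; rewrite /= opprK.
exists [set x | U (- x)]; last exact: HO.
split; first exact: open_opp.
by move=> x /= Ax; exact: AU.
Qed.

Lemma int_reflect f u : measurable_fun [set: B] (f : B -> R) ->
  \int[mu]_x f (u - (x : G)) = \int[mu]_x f x.
Proof.
move=> mf; rewrite -[RHS](@int_translate _ u)// /Rintegral; congr fine.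
rewrite -(integral_preserving measurable_opp haar_opp
   (f := (fun x : B => (f ((x : G) + u))%:E))).
  by apply: eq_integral => x _; rewrite addrC.
apply/measurable_EFinP; apply: (measurableT_comp mf).
exact: measurable_translate.
Qed.

Lemma Rint_bound (h : B -> R) K (e : R) : measurable_fun [set: B] h ->
  compact K -> (forall x, ~ K x -> h x = 0) -> (forall x, `|h x| <= e) ->
  `|\int[mu]_x h x| <= e * fine (mu K).
Proof.
move=> mh cK hK he.
have mK : measurable (K : set B) by exact: borel_compact.
have hI := bounded_integrable hG haar mh cK hK he.
have KF : mu K \is a fin_num by rewrite ge0_fin_numE//; exact: haar_compact.
have e0 : 0 <= e by rewrite (le_trans _ (he 0)).
apply: (le_trans (le_normr_Rintegral _ _)) => //.
rewrite -lee_fin EFinM (fineK KF) -[X in mu X]setIT -integral_indic//.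
rewrite /Rintegral fineK; last first.
  apply: integrable_fin_num => //.
  by have := integrable_abse hI; apply: eq_integrable => // x _.
rewrite -ge0_integralZl//; last exact/measurable_EFinP/measurable_indic.
apply: ge0_le_integral => //.
- by apply/measurable_EFinP; exact: measurableT_comp.
- by apply: measurable_funeM; exact/measurable_EFinP/measurable_indic.
move=> x _; rewrite -EFinM lee_fin indicE.
have [_|/negP nK] := boolP (x \in K); first by rewrite mulr1.
by rewrite hK ?normr0 ?mulr0// => Kx; apply: nK; rewrite inE.
Qed.

Lemma Cc_param_continuous (T : topologicalType) (F : T * G -> R) K :
  continuous F -> compact K -> (forall t x, ~ K x -> F (t, x) = 0) ->
  continuous (fun t => \int[mu]_x F (t, x)).
Proof.
move=> cF cK FK.
have cF1 t : continuous (fun x => F (t, x)).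
  move=> x; apply: (@continuous_comp _ _ _ (fun x => (t, x))); last exact: cF.
  by apply: cvg_pair; [exact: cvg_cst|exact: cvg_id].
have CF t : Cc (fun x => F (t, x)) by split => //; exists K => // x /FK.
move=> t0; apply/cvgrPdist_lt => e e0.
pose m := fine (mu K) + 1.
have m0 : 0 < m by rewrite ltr_wpDl// fine_ge0.
have em : 0 < e / m by rewrite divr_gt0.
near=> t.
rewrite -RintegralB//; [|exact: Cc_integrable|exact: Cc_integrable].
apply: (@le_lt_trans _ _ (e / m * fine (mu K))).
  apply: (@Rint_bound (fun x => F (t0, x) - F (t, x)) K) => //.
  - apply: continuous_borel => x; apply: cvgB; exact: cF1.
  - by move=> x nK; rewrite !FK// subrr.
  move=> x; have [Kx|nKx] := pselect (K x); last by rewrite !FK// subrr normr0 ltW.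
  rewrite distrC ltW//; move: x Kx; near: t.
  exact: near_compact_close.
rewrite mulrAC ltr_pdivrMr// ltr_pM2l//.
by rewrite /m ltrDl.
Unshelve. all: by end_near. Qed.

Definition convol f g (u : G) : R := \int[mu]_t (f t * g (u - (t : G))).

Lemma Cc_conv f g : Cc f -> Cc g -> Cc (convol f g).
Proof.
move=> [cf [K cK fK]] [cg [L cL gL]]; split.
  apply: (@Cc_param_continuous _ (fun z => f z.2 * g (z.1 - z.2)) K) => //.
    apply: continuous_mul.
      exact: continuous_comp_snd.
    by apply: continuous_comp_sub => //; [exact: continuous_fst|exact: continuous_snd].
  by move=> t x /= /fK ->; rewrite mul0r.
exists (set_add K L).
  exact: compact_add.
move=> u nKL; rewrite /convol (_ : (fun t => _) = cst 0) ?Rintegral_cst ?mul0r//.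
apply/funext => t /=; have [Kt|nKt] := pselect (K t); last by rewrite fK// mul0r.
rewrite gL ?mulr0// => Lut; apply: nKL; exists t => //; exists (u - t) => //.
by rewrite addrC subrK.
Qed.

Lemma Cc_conv_integrand f g u : Cc f -> Cc g -> Cc (fun t => f t * g (u - t)).
Proof.
move=> Cf [cg _]; apply: CcMr => //.
by apply: continuous_comp_sub => // x; [exact: cvg_cst|exact: cvg_id].
Qed.

Lemma convolC f g : Cc f -> Cc g -> convol f g = convol g f.
Proof.
move=> Cf Cg; apply/funext => u; rewrite /convol.
rewrite -(@int_reflect _ u).
  by apply: eq_Rintegral => t _; rewrite opprB addrCA subrr addr0 mulrC.
by have [? _] := Cc_conv_integrand u Cf Cg; exact: continuous_borel.
Qed.

Lemma conv_translatel f g s : Cc f -> Cc g ->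
  convol (fun x => f (x + s)) g = (fun x => convol f g (x + s)).
Proof.
move=> Cf Cg; apply/funext => u; rewrite /convol.
rewrite -(@int_translate (fun t => f t * g (u + s - t)) s).
  by apply: eq_Rintegral => t _; congr (_ * g _); rewrite opprD addrACA subrr addr0.
by have [? _] := Cc_conv_integrand (u + s) Cf Cg; exact: continuous_borel.
Qed.

Lemma conv_translater f g s : Cc f -> Cc g ->
  convol f (fun x => g (x + s)) = (fun x => convol f g (x + s)).
Proof.
by move=> Cf Cg; rewrite convolC ?conv_translatel// 1?convolC//; exact: Cc_translate.
Qed.

(** Fubini and the substitution of u + t for u.  The terms of the Leibniz rule
for [kform] are compared once written in this form. *)
Lemma conv_int f g phi : Cc f -> Cc g -> continuous phi ->
  \int[mu]_u (phi u * convol f g u) =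
  \int[mu]_t (f t * \int[mu]_u (g u * phi ((u : G) + (t : G)))).
Proof.
move=> Cf Cg cphi; have [cf [K cK fK]] := Cf; have [cg [L cL gL]] := Cg.
transitivity (\int[mu]_u (\int[mu]_t (phi u * (f t * g ((u : G) - (t : G)))))).
  apply: eq_Rintegral => u _; rewrite RintegralZl_Cc//.
  exact: Cc_conv_integrand.
rewrite (@Cc_fubini _ _ _ hG cgG haar (fun z => phi z.1 * (f z.2 * g (z.1 - z.2)))
   (set_add K L) K)//; last 3 first.
- apply: continuous_mul.
    exact: continuous_comp_fst.
  apply: continuous_mul.
    exact: continuous_comp_snd.
  by apply: continuous_comp_sub => //; [exact: continuous_fst|exact: continuous_snd].
- exact: compact_add.
- move=> t s /= nKL; have [Ks|nKs] := pselect (K s); last by rewrite fK// mul0r mulr0.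
  rewrite gL ?mulr0// => Lts; apply: nKL; split => //; exists s => //.
  by exists (t - s) => //; rewrite addrC subrK.
apply: eq_Rintegral => t _ /=.
rewrite -(@int_translate _ (t : G)); last first.
  apply: continuous_borel; apply: continuous_mul => //.
  apply: continuous_mul; first by move=> x; exact: cvg_cst.
  by apply: continuous_comp_sub => // x; [exact: cvg_id|exact: cvg_cst].
rewrite -RintegralZl_Cc; last by apply: CcMr => //; exact: continuous_translater.
by apply: eq_Rintegral => u _; rewrite addrK mulrCA [phi _ * _]mulrC.
Qed.

End haar_convolution.

(** * Weights are bounded on compact sets *)

Section weight_bounds.
Context {R : realType} {G : topologicalZmodType}.
Local Notation B := (borel_type G).
Variable mu : {measure set B -> \bar R}.
Hypothesis hG : hausdorff_space G.
Hypothesis lcG : locally_compact [set: G].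
Hypothesis cgG : compactly_generated G.
Hypothesis haar : haar_measure mu.
Variable w : weight mu.
Implicit Types (K L O : set G) (s t : G).

Let A n : set B := [set x | w x <= n%:R].

Lemma measurable_weight_le n : measurable (A n).
Proof.
rewrite (_ : A n = (w : B -> R) @^-1` [set y | y <= n%:R]); last by [].
rewrite -[X in measurable X]setTI.
apply: (weight_measurable w) => //.
by rewrite (_ : [set y | _] = `]-oo, n%:R]%classic)//; apply/funext => y; rewrite /= in_itv.
Qed.

(** A Steinhaus argument.  Once the part of V where [w > n] has measure less
than half that of W, every s in W is a sum of two points of [{w <= n}], for
otherwise W would be covered by that part and its image under [a |-> s - a],
which has the same measure. *)
Lemma weight_nbhs0_bounded : exists2 M : R, 0 < M &
  \forall s \near (0 : G), w s <= M.
Proof.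
have [V cV V0] := compact_nbhs0 lcG.
have [W [oW W0 WN WV]] := nbhs0_half V0.
have mV : measurable (V : set B) by exact: borel_compact.
have mW : measurable (W : set B) by exact: borel_open.
have muV : (mu V < +oo)%E by exact: haar_compact.
have muW : (0 < mu W)%E by apply: (haar_open haar) => //; exists 0.
pose D n : set B := V `\` A n.
have mD n : measurable (D n) by apply: measurableD => //; exact: measurable_weight_le.
have D0 : \bigcap_n D n = set0.
  rewrite -subset0 => x Dx; have [_] := Dx (Num.truncn (w x)).+1 I; apply.
  by rewrite /A /= ltW// truncnS_gt.
have : (mu \o D) n @[n --> \oo] --> mu (\bigcap_n D n).
  apply: nonincreasing_cvg_mu => //.
  - apply: le_lt_trans muV; apply: le_measure; rewrite ?inE//.
    exact: subDsetl.
  - by rewrite D0; exact: measurable0.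
  - apply/nonincreasing_seqP => n; apply/subsetPset => x [Vx nA]; split => //.
    by move=> Ax; apply: nA; rewrite /A /= (le_trans Ax)// ler_nat.
rewrite D0 measure0 => muD.
have WleV : W `<=` V.
  by move=> x Wx; rewrite -(addr0 x); exact: WV.
have muWfin : mu W \is a fin_num.
  rewrite ge0_fin_numE//; apply: le_lt_trans muV.
  by apply: le_measure; rewrite ?inE.
have muW2 : (0 < (fine (mu W) / 2)%:E)%E.
  by rewrite lte_fin divr_gt0// fine_gt0// muW -ge0_fin_numE.
have [n Dn] : exists n, (mu (D n) < (fine (mu W) / 2)%:E)%E.
  have : \forall n \near \oo, ((mu \o D) n < (fine (mu W) / 2)%:E)%E.
    exact: (muD _ (open_ereal_lt' muW2)).
  move=> [n _ /(_ n (leqnn n)) /= H].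
  by exists n.
have [C C0 Csub] := weight_submul w.
exists (C * n%:R * n%:R + 1); first by rewrite ltr_wpDl// !mulr_ge0// ltW.
have : nbhs 0 W by exact: open_nbhs_nbhs.
apply: filterS => s Ws.
apply: contrapT => /negP; rewrite -ltNge => ws.
pose phi (a : B) : B := - (a : G) + s.
have mphi : measurable_fun [set: B] phi.
  apply: (@measurableT_comp _ _ _ B B B (fun t : B => (t : G) + s : B)).
    exact: measurable_translate.
  exact: measurable_opp.
have mu_phi (X : set B) : measurable X -> mu (phi @^-1` X) = mu X.
  move=> mX; rewrite -[RHS](haar_translate haar s mX).
  rewrite -[RHS](haar_opp hG lcG cgG haar)//.
  by rewrite -[X in measurable X]setTI; exact: measurable_translate.
have : (mu W <= mu (D n `|` phi @^-1` D n))%E.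
  apply: le_measure; rewrite ?inE//.
    by apply: measurableU => //; rewrite -[X in measurable X]setTI; exact: mphi.
  move=> a Wa; apply: contrapT => /not_orP[nDa nDsa].
  have Aa : A n a by apply: contrapT => nA; apply: nDa; split => //; exact: WleV.
  have Asa : A n (phi a).
    apply: contrapT => nA; apply: nDsa; split => //.
    by rewrite /phi addrC; apply: WV => //; exact: WN.
  have := Csub a (- a + s); rewrite addrA subrr add0r => H.
  have := lt_le_trans ws H.
  rewrite ltNge => /negP; apply.
  rewrite (@le_trans _ _ (C * n%:R * n%:R))//; last by rewrite lerDl.
  by apply: ler_pM => //;
    [rewrite mulr_ge0// ltW// weight_gt0|rewrite ltW// weight_gt0|rewrite ler_pM2l].
apply/negP; rewrite -ltNge.
apply: (le_lt_trans (measureU2 _ _ _)) => //.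
  by rewrite -[X in measurable X]setTI; exact: mphi.
rewrite [X in (_ + X < _)%E]mu_phi//.
rewrite -[ltRHS](fineK muWfin) [fine (mu W)]splitr EFinD.
by apply: lteD.
Qed.

(** Submultiplicativity carries the bound near 0 to a neighbourhood of every
point. *)
Lemma weight_compact_bounded K : compact K ->
  exists2 M : R, 0 < M & forall s, K s -> w s <= M.
Proof.
move=> cK; have [M M0 HM] := weight_nbhs0_bounded.
have [C C0 Csub] := weight_submul w.
have /(_ _ +oo (fun N s => w s <= N) _)[x Kx|N [Nr HN]] :=
    (compact_near_coveringP K).1 cK; last first.
  exists (`|N| + 1); first by rewrite ltr_wpDl.
  by move=> s Ks; apply: (HN (`|N| + 1)) => //; rewrite (le_lt_trans (ler_norm _))// ltrDl.
exists ([set y | w (y - x) <= M], [set N | C * w x * M < N]) => /=.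
  split; first exact: (nbhs_translate x HM).
  by apply: nbhs_pinfty_gt; exact: num_real.
move=> [y N] /= [wyx /ltW NM]; apply: le_trans NM.
have := Csub x (y - x); rewrite addrC subrK => /le_trans; apply.
by rewrite ler_wpM2l// mulr_ge0// ltW// weight_gt0.
Qed.

End weight_bounds.

(** * Real functions in the weighted space *)

Local Open Scope complex_scope.
Local Notation normc := Normc.normc.

Section complex_norm.
Context {R : rcfType}.
Implicit Types (x : R) (z : R[i]).

Lemma normc_real x : normc x%:C = `|x|.
Proof. by rewrite normcE_sqrt /= expr0n addr0 sqrtr_sqr. Qed.

Lemma normc_Re z : `|complex.Re z| <= normc z.
Proof.
rewrite normcE_sqrt -sqrtr_sqr ler_wsqrtr// lerDl; exact: sqr_ge0.
Qed.

Lemma normc_Im z : `|complex.Im z| <= normc z.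
Proof.
rewrite normcE_sqrt -sqrtr_sqr ler_wsqrtr// lerDr; exact: sqr_ge0.
Qed.

Lemma normc_ReIm z : normc z <= `|complex.Re z| + `|complex.Im z|.
Proof.
have s0 : 0 <= `|complex.Re z| + `|complex.Im z| by rewrite addr_ge0.
rewrite normcE_sqrt -[leRHS](ger0_norm s0) -[leRHS]sqrtr_sqr ler_wsqrtr//.
rewrite sqrrD !real_normK ?num_real// -addrA lerD2l lerDr.
by rewrite mulrn_wge0// mulr_ge0.
Qed.

End complex_norm.

Section Lpw_real.
Context {R : realType} {G : topologicalZmodType}.
Local Notation B := (borel_type G).
Variable mu : {measure set B -> \bar R}.
Hypothesis hG : hausdorff_space G.
Hypothesis lcG : locally_compact [set: G].
Hypothesis cgG : compactly_generated G.
Hypothesis haar : haar_measure mu.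
Variables (w : weight mu) (p : R) (p1 : 1 <= p).
Implicit Types (K L O : set G) (s t : G) (u v : G -> R).
Local Notation A := (Lpw w p1).

Definition rfun u : G -> R[i] := fun s => (u s)%:C.

(** The norm of the algebra takes its values in [R[i]]; estimates are carried
out on this real number. *)
Definition nr (x : A) : R := fine (Lpw_norm w p (Lpw_repr x)).

Lemma nrE x : `|x| = (nr x)%:C. Proof. by []. Qed.

(** Real functions suffice to generate the space, and working with them avoids
splitting every integral in two.  The value 0 outside the space makes [rcl] a
total function. *)
Definition rcl u : A :=
  if pselect (rfun u \in Lpw_pred w p1) is left H then Lpw_class (LpwFun H) else 0.

Lemma rcl_class u (H : rfun u \in Lpw_pred w p1) : rcl u = Lpw_class (LpwFun H).
Proof. by rewrite /rcl; case: pselect => // H'; congr (Lpw_class _); exact: val_inj. Qed.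

Lemma nr_class (f : Lpw_fun w p1) : nr (Lpw_class f) = fine (Lpw_norm w p f).
Proof. by have := Lpw_normr_class f => -[]. Qed.

Lemma normc_weighted u s : normc (weighted w (rfun u) s) = `|u s| * w s.
Proof. by rewrite Normc.normcM !normc_real (gtr0_norm (weight_gt0 w s)). Qed.

Lemma cmeasurable_weighted_rfun u : measurable_fun [set: B] (u : B -> R) ->
  cmeasurable (weighted w (rfun u)).
Proof.
move=> mu_; split.
  rewrite (_ : (fun x => _) = (fun x : B => u x * w x)); last first.
    by apply/funext => x; rewrite /= mul0r subr0.
  by apply: measurable_funM => //; exact: weight_measurable.
rewrite (_ : (fun x => _) = cst 0); first exact: measurable_cst.
by apply/funext => x; rewrite /= mulr0 mul0r addr0.
Qed.

Lemma rfun_mem u : measurable_fun [set: B] (u : B -> R) ->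
  (Lpw_norm w p (rfun u) < +oo)%E -> rfun u \in Lpw_pred w p1.
Proof. by move=> mu_ fin; rewrite inE; split => //; exact: cmeasurable_weighted_rfun. Qed.

(** The weight is bounded on K, so the norm of [W * \1_K] serves for N. *)
Lemma Lpw_norm_bounded K : compact K -> exists2 N : R, 0 <= N &
  forall u M, measurable_fun [set: B] (u : B -> R) -> (forall x, `|u x| <= M) ->
  (forall x, ~ K x -> u x = 0) -> (Lpw_norm w p (rfun u) <= (M * N)%:E)%E.
Proof.
move=> cK; have [W W0 HW] := weight_compact_bounded hG lcG cgG haar w cK.
have mK : measurable (K : set B) by exact: borel_compact.
have p0 : 0 < p by rewrite (lt_le_trans _ p1).
pose k (x : B) : R := W * \1_K x.
have mk : measurable_fun [set: B] k.
  by apply: measurable_funM => //; exact: measurable_indic.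
have k0 x : 0 <= k x by rewrite mulr_ge0// ltW.
have Nk : ('N[mu]_(p%:E)[EFin \o k] < +oo)%E.
  rewrite unlock; apply: poweR_lty.
  rewrite (_ : (fun x => _) = (fun x : B => (W `^ p)%:E * (\1_K x)%:E))%E; last first.
    apply/funext => x /=; rewrite -EFinM /k indicE; congr (_%:E).
    case: (x \in K); rewrite /= ?mulr1 ?mulr0 ?normr0 ?powR0 ?gt_eqF//.
    by rewrite gtr0_norm.
  rewrite ge0_integralZl//; last 2 first.
    exact/measurable_EFinP/measurable_indic.
    by rewrite lee_fin powR_ge0.
  rewrite integral_indic// setIT lte_mul_pinfty// ?lee_fin ?powR_ge0//.
  exact: haar_compact.
have Nk0 : (0 <= 'N[mu]_(p%:E)[EFin \o k])%E by exact: Lnorm_ge0.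
exists (fine 'N[mu]_(p%:E)[EFin \o k]); first exact: fine_ge0.
move=> u M mu_ uM uK.
have M0 : 0 <= M by rewrite (le_trans _ (uM 0)).
rewrite EFinM fineK; last by rewrite ge0_fin_numE.
have := @cLnormZ _ B _ mu p M%:C (rfun k) p1.
rewrite (_ : (fun x => (normc (M%:C * rfun k x))%:E) = EFin \o (fun x => M * k x)); last first.
  by apply/funext => x; rewrite /rfun -rmorphM normc_real ger0_norm// mulr_ge0.
rewrite (_ : (fun x => (normc (rfun k x))%:E) = EFin \o k); last first.
  by apply/funext => x; rewrite normc_real ger0_norm.
rewrite normc_real (ger0_norm M0) => <-; last first.
  by split => //; exact: measurable_cst.
apply: le_cLnorm => //.
- by apply: cmeasurable_normc; exact: cmeasurable_weighted_rfun.
- exact: measurable_funM.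
move=> x; rewrite normc_weighted; apply/andP; split.
  by rewrite mulr_ge0// ltW// weight_gt0.
have [Kx|nKx] := pselect (K x); last by rewrite uK// normr0 mul0r mulr_ge0.
by rewrite /k indicE mem_set// mulr1 ler_pM// ?HW// ltW// weight_gt0.
Qed.

Lemma Cc_mem u : Cc u -> rfun u \in Lpw_pred w p1.
Proof.
move=> Cu; have [cu [K cK uK]] := Cu; have [M _ uM] := Cc_bounded Cu.
apply: rfun_mem; first exact: continuous_borel.
have [N _ HN] := Lpw_norm_bounded cK.
apply: le_lt_trans (HN u M _ uM uK) _; last by rewrite ltry.
exact: continuous_borel.
Qed.

Lemma rfunD u v : rfun (fun x => u x + v x) = rfun u + rfun v.
Proof. by apply/funext => x; rewrite /rfun rmorphD. Qed.

Lemma rfunZ (a : R) u : rfun (fun x => a * u x) = a%:C *: rfun u.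
Proof. by apply/funext => x; rewrite /rfun rmorphM. Qed.

Lemma rclD u v : rfun u \in Lpw_pred w p1 -> rfun v \in Lpw_pred w p1 ->
  rcl (fun x => u x + v x) = rcl u + rcl v.
Proof.
move=> Hu Hv; have H : rfun (fun x => u x + v x) \in Lpw_pred w p1.
  by rewrite rfunD; exact: rpredD.
rewrite !rcl_class -Lpw_classD; congr Lpw_class; apply: val_inj; exact: rfunD.
Qed.

Lemma rclZ (a : R) u : rfun u \in Lpw_pred w p1 ->
  rcl (fun x => a * u x) = a%:C *: rcl u.
Proof.
move=> Hu; have H : rfun (fun x => a * u x) \in Lpw_pred w p1.
  by rewrite rfunZ; exact: rpredZ.
rewrite !rcl_class -[RHS]Lpw_classZ; congr Lpw_class; apply: val_inj; exact: rfunZ.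
Qed.

Lemma rclB u v : rfun u \in Lpw_pred w p1 -> rfun v \in Lpw_pred w p1 ->
  rcl (fun s => u s - v s) = rcl u - rcl v.
Proof.
move=> Hu Hv; rewrite (_ : (fun s => _) = (fun s => u s + (-1) * v s)); last first.
  by apply/funext => s; rewrite mulN1r.
rewrite rclD//; first by rewrite rclZ// rmorphN scaleN1r.
by rewrite rfunZ; exact: rpredZ.
Qed.

Lemma nr_rcl u : rfun u \in Lpw_pred w p1 -> (nr (rcl u))%:E = Lpw_norm w p (rfun u).
Proof. by move=> Hu; rewrite rcl_class nr_class -(Lpw_norm_fin Hu). Qed.

Lemma nr_bounded K : compact K -> exists2 N : R, 0 <= N &
  forall u M, measurable_fun [set: B] (u : B -> R) -> (forall x, `|u x| <= M) ->
  (forall x, ~ K x -> u x = 0) ->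
  rfun u \in Lpw_pred w p1 /\ nr (rcl u) <= M * N.
Proof.
move=> cK; have [N N0 HN] := Lpw_norm_bounded cK; exists N => // u M mu_ uM uK.
have H := HN u M mu_ uM uK.
have Hu : rfun u \in Lpw_pred w p1 by apply: rfun_mem => //; apply: le_lt_trans H _; rewrite ltry.
by split => //; rewrite -lee_fin nr_rcl.
Qed.

(** By submultiplicativity [w x <= C * w (x + s) * w (- s)], and Haar measure
is invariant. *)
Lemma nr_translate (C : R) s u : 0 < C ->
  (forall r t, w (r + t) <= C * w r * w t) -> Cc u ->
  nr (rcl (fun x => u (x + s))) <= C * w (- s) * nr (rcl u).
Proof.
move=> C0 Csub Cu; have Cus := Cc_translate s Cu.
have p0 : 0 < p by rewrite (lt_le_trans _ p1).
have ws := weight_gt0 w (- s).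
rewrite -lee_fin EFinM !nr_rcl; [|exact: Cc_mem|exact: Cc_mem].
have mus : measurable_fun [set: B] ((fun x => u (x + s)) : B -> R).
  by apply: continuous_borel; have [] := Cus.
have mu_ : measurable_fun [set: B] (u : B -> R).
  by apply: continuous_borel; have [] := Cu.
pose g (x : B) := normc (weighted w (rfun u) x).
have mg : measurable_fun [set: B] g.
  by apply: cmeasurable_normc; exact: cmeasurable_weighted_rfun.
pose gs (x : B) := g ((x : G) + s : B).
have mgs : measurable_fun [set: B] gs.
  by apply: (measurableT_comp mg); exact: measurable_translate.
have -> : Lpw_norm w p (rfun u) = 'N[mu]_(p%:E)[EFin \o gs]%E.
  pose F (x : B) : \bar R := (`|(g x)%:E| `^ p)%E.
  have mF : measurable_fun [set: B] F.
    by apply/measurable_EFinP/(measurableT_comp (measurable_powR p))/measurableT_comp.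
  have F0 x : (0 <= F x)%E by exact: poweR_ge0.
  have E := ge0_integral_preserving (measurable_translate s)
    (haar_translate haar s) mF F0.
  rewrite /Lpw_norm unlock; apply: (congr1 (fun I => I `^ p^-1)%E).
  exact: esym E.
have := @cLnormZ _ B _ mu p (C * w (- s))%:C (rfun gs) p1.
have gs0 x : 0 <= gs x by rewrite /gs /g normcE_sqrt sqrtr_ge0.
have Cw0 : 0 <= C * w (- s) by rewrite mulr_ge0// ltW.
rewrite (_ : (fun x => (normc (_ * rfun gs x))%:E) =
    EFin \o (fun x => C * w (- s) * gs x)); last first.
  by apply/funext => x; rewrite /rfun -rmorphM normc_real ger0_norm// mulr_ge0.
rewrite (_ : (fun x => (normc (rfun gs x))%:E) = EFin \o gs); last first.
  by apply/funext => x; rewrite normc_real ger0_norm.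
rewrite normc_real (ger0_norm Cw0) => <-; last first.
  by split => //; exact: measurable_cst.
apply: le_cLnorm => //.
- by apply: cmeasurable_normc; exact: cmeasurable_weighted_rfun.
- by apply: measurable_funM.
move=> x; rewrite normc_weighted; apply/andP; split.
  by rewrite mulr_ge0// ltW// weight_gt0.
rewrite /gs /g normc_weighted mulrCA ler_wpM2l//.
have := Csub (x + s) (- s); rewrite addrK => /le_trans; apply.
by rewrite mulrAC.
Qed.

End Lpw_real.

(** * The product of the algebra *)

Section Lpw_algebra.
Context {R : realType} {G : topologicalZmodType}.
Local Notation B := (borel_type G).
Variable mu : {measure set B -> \bar R}.
Hypothesis hG : hausdorff_space G.
Hypothesis lcG : locally_compact [set: G].
Hypothesis cgG : compactly_generated G.
Hypothesis haar : haar_measure mu.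
Variables (w : weight mu) (p : R) (p1 : 1 <= p).
Local Notation A := (Lpw w p1).
Implicit Types (u v : G -> R).

Lemma eval_class (f : Lpw_fun w p1) :
  {ae mu, forall s : B, Lpw_eval (Lpw_class f) s = f s}.
Proof. exact: (Lpw_classP (Lpw_repr (Lpw_class f)) f).1 (Lpw_reprK _). Qed.

Lemma Lpw_eq (x y : A) : {ae mu, forall s : B, Lpw_eval x s = Lpw_eval y s} -> x = y.
Proof. by move=> H; rewrite -(Lpw_reprK x) -(Lpw_reprK y); apply/Lpw_classP. Qed.

Lemma measurable_reflect (s : G) : measurable_fun [set: B] (fun t : B => s - (t : G) : B).
Proof.
apply: (@continuous_borel_map _ (fun t : G => s - t)).
by apply: continuous_add; [move=> x; exact: cvg_cst|move=> x; exact: opp_continuous].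
Qed.

Lemma haar_reflect (s : G) (X : set B) : measurable X ->
  mu ((fun t : B => s - (t : G) : B) @^-1` X) = mu X.
Proof.
move=> mX; rewrite -[RHS](haar_translate haar s mX).
rewrite -[RHS](haar_opp hG lcG cgG haar); last first.
  by rewrite -[X in measurable X]setTI; exact: measurable_translate.
by congr (mu _); apply/funext => t; rewrite /preimage /= addrC.
Qed.

Variable mul : A -> A -> A.
Hypothesis mul_conv : is_convolution mul.

(** The reflection [t |-> s - t] preserves Haar measure and exchanges the
factors of the integrand at s. *)
Lemma mul_comm x y : mul x y = mul y x.
Proof.
apply: Lpw_eq; apply: filterS2 (mul_conv x y) (mul_conv y x) => s /= [[m1 m2] ->] [_ ->].
have E (h k : B -> R) : measurable_fun [set: B] h ->
    (forall t : B, k t = h (s - (t : G) : B)) -> \int[mu]_t h t = \int[mu]_t k t.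
  move=> mh hk; rewrite -(int_reflect hG lcG cgG haar (s : G) mh).
  by apply: eq_Rintegral => t _; rewrite hk.
congr (_ +i* _).
- apply: E.
    by move/measurable_int : m1 => /measurable_EFinP.
  by move=> t /=; rewrite opprB addrCA subrr addr0 mulrC.
- apply: E.
    by move/measurable_int : m2 => /measurable_EFinP.
  by move=> t /=; rewrite opprB addrCA subrr addr0 mulrC.
Qed.

Lemma eval_rcl u : rfun u \in Lpw_pred w p1 ->
  {ae mu, forall s : B, Lpw_eval (rcl w p1 u) s = (u s)%:C}.
Proof. by move=> Hu; rewrite rcl_class; exact: eval_class. Qed.

(** Representatives of the classes agree with u and v off null sets, and
[t |-> s - t] preserves null sets, so the integrands at s agree almost
everywhere. *)
Lemma mul_rcl u v : Cc u -> Cc v -> mul (rcl w p1 u) (rcl w p1 v) = rcl w p1 (convol mu u v).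
Proof.
move=> Cu Cv.
have Hu : rfun u \in Lpw_pred w p1 by exact: Cc_mem.
have Hv : rfun v \in Lpw_pred w p1 by exact: Cc_mem.
have Huv : rfun (convol mu u v) \in Lpw_pred w p1 by apply: Cc_mem => //; exact: Cc_conv.
apply: Lpw_eq.
apply: filterS2 (mul_conv (rcl w p1 u) (rcl w p1 v)) (eval_rcl Huv).
move=> s /= [[m1 m2] ->] ->.
have mh : measurable_fun [set: B] ((fun t => u t * v ((s : G) - t)) : B -> R).
  by apply: continuous_borel; have [] := Cc_conv_integrand (s : G) Cu Cv.
have Hae : {ae mu, forall t : B, Lpw_eval (rcl w p1 u) t *
    Lpw_eval (rcl w p1 v) ((s : G) - (t : G)) = (u t * v ((s : G) - t))%:C}.
  apply: filterS2 (eval_rcl Hu)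
    (ae_preserving (measurable_reflect s) (@haar_reflect s) (eval_rcl Hv)).
  by move=> t /= -> ->; rewrite rmorphM.
rewrite /cintegral; congr (_ +i* _).
- rewrite /convol /Rintegral; congr fine; apply: ae_eq_integral => //.
  + by move/measurable_int : m1.
  + exact/measurable_EFinP.
  + by move: Hae; apply: filterS => t Ht _; rewrite /= Ht.
- rewrite (_ : 0 = \int[mu]_(t in [set: B]) (cst 0 t)); last by rewrite Rintegral_cst// mul0r.
  rewrite /Rintegral; congr fine; apply: ae_eq_integral => //.
  + by move/measurable_int : m2.
  + exact/measurable_EFinP/measurable_cst.
  + by move: Hae; apply: filterS => t Ht _; rewrite /= Ht.
Qed.

End Lpw_algebra.

(** * Density of compactly supported functions *)

Section regularity.
Context {R : realType} {G : topologicalZmodType}.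
Local Notation B := (borel_type G).
Variable mu : {measure set B -> \bar R}.
Hypothesis hG : hausdorff_space G.
Hypothesis haar : haar_measure mu.

Lemma haar_open_approx (U : set G) (d : R) : open U -> (mu U < +oo)%E -> 0 < d ->
  exists K, [/\ compact K, K `<=` U & (mu (U `\` K) < d%:E)%E].
Proof.
move=> oU Ufin d0.
have mU : measurable (U : set B) by exact: borel_open.
have Uf : mu U \is a fin_num by rewrite ge0_fin_numE.
have [|_ [K [cK KU] <-] HK] := @ub_ereal_sup_adherent R
  [set mu K | K in [set K : set G | compact K /\ K `<=` U]] d d0.
  by rewrite -(haar_inner_regular haar oU).
have mK : measurable (K : set B) by exact: borel_compact.
have Kf : mu K \is a fin_num by rewrite ge0_fin_numE//; exact: haar_compact.
exists K; split => //; rewrite measureD//.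
rewrite (_ : U `&` K = K); last by rewrite setIC; apply/setIidl.
by move: HK; rewrite -(haar_inner_regular haar oU) lteBlDr// -lteBlDl.
Qed.

Lemma haar_borel_approx (A : set B) (d : R) : measurable A -> (mu A < +oo)%E -> 0 < d ->
  exists U : set G, [/\ open U, A `<=` U & (mu (U `\` A) < d%:E)%E].
Proof.
move=> mA Afin d0.
have Af : mu A \is a fin_num by rewrite ge0_fin_numE.
have [|_ [U [oU AU] <-] HU] := @lb_ereal_inf_adherent R
  [set mu O | O in [set O : set G | open O /\ A `<=` O]] d d0.
  by rewrite -(haar_outer_regular haar mA).
have mU : measurable (U : set B) by exact: borel_open.
rewrite -(haar_outer_regular haar mA) in HU.
have Ufin : (mu U < +oo)%E by rewrite (lt_trans HU)// -(fineK Af) -EFinD ltry.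
exists U; split => //; rewrite measureD//.
rewrite (_ : U `&` A = A); last by rewrite setIC; apply/setIidl.
by rewrite lteBlDr// addeC.
Qed.

End regularity.

Section density.
Context {R : realType} {G : topologicalZmodType}.
Local Notation B := (borel_type G).
Variable mu : {measure set B -> \bar R}.
Hypothesis hG : hausdorff_space G.
Hypothesis lcG : locally_compact [set: G].
Hypothesis cgG : compactly_generated G.
Hypothesis haar : haar_measure mu.
Variables (w : weight mu) (p : R) (p1 : 1 <= p).
Local Notation A := (Lpw w p1).
Local Notation rcl := (rcl w p1).
Implicit Types (u v : G -> R) (x y : A) (phi : A -> R[i]^o).

Let p0 : 0 < p. Proof. by rewrite (lt_le_trans _ p1). Qed.

Lemma nr_ge0 x : 0 <= nr x.
Proof. exact/fine_ge0/Lnorm_ge0. Qed.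

Lemma nrD x y : nr (x + y) <= nr x + nr y.
Proof. by have := ler_normD x y; rewrite !nrE -rmorphD lecR. Qed.

Lemma nrN x : nr (- x) = nr x.
Proof. by have := normrN x; rewrite !nrE => -[]. Qed.

Lemma nrB x y : nr (x - y) = nr (y - x).
Proof. by rewrite -nrN opprB. Qed.

Lemma dual_bound phi : dual_space phi ->
  exists2 M : R, 0 <= M & forall x, normc (phi x) <= M * nr x.
Proof.
move=> [_ [C HC]]; exists `|complex.Re C|; first exact: normr_ge0.
move=> x; have := HC x; rewrite nrE.
rewrite [`|phi x|](_ : _ = (normc (phi x))%:C)//.
case: C {HC} => a b; rewrite lecE /= => /andP[_].
rewrite mulr0 subr0 => /le_trans; apply.
by rewrite ler_wpM2r ?nr_ge0// ler_norm.
Qed.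

Lemma dual_sub phi x y : dual_space phi -> phi (x - y) = phi x - phi y.
Proof.
move=> [lphi _]; rewrite addrC -scaleN1r lphi.
by rewrite scaleN1r addrC.
Qed.

Lemma dual_add phi x y : dual_space phi -> phi (x + y) = phi x + phi y.
Proof. by move=> [lphi _]; have := lphi 1 x y; rewrite !scale1r. Qed.

Lemma dual0 phi : dual_space phi -> phi 0 = 0.
Proof. by move=> dphi; rewrite -(subrr 0) dual_sub// subrr. Qed.

Lemma dual_scale phi a x : dual_space phi -> phi (a *: x) = a * phi x.
Proof.
move=> dphi; have [lphi _] := dphi.
by rewrite -[a *: x]addr0 lphi dual0// addr0.
Qed.

Lemma dual_zero_closed phi x : dual_space phi ->
  (forall e : R, 0 < e -> exists2 y, phi y = 0 & nr (x - y) < e) -> phi x = 0.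
Proof.
move=> dphi H; have [M M0 HM] := dual_bound dphi.
apply/Normc.eq0_normc/eqP; apply: contrapT => /negP n0.
have npos : 0 < normc (phi x) by rewrite lt_def n0 normcE_sqrt sqrtr_ge0.
have M1 : 0 < M + 1 by rewrite ltr_wpDl.
have [y y0 xy] := H (normc (phi x) / (M + 1)) (divr_gt0 npos M1).
have := HM (x - y); rewrite dual_sub// y0 subr0 => /le_lt_trans.
move=> /(_ (normc (phi x))) HH; suff : normc (phi x) < normc (phi x) by rewrite ltxx.
apply: HH; apply: (@le_lt_trans _ _ (M * (normc (phi x) / (M + 1)))).
  by rewrite ler_wpM2l// ltW.
rewrite mulrCA gtr_pMr// ltr_pdivrMr// mul1r ltrDl//.
Qed.

Lemma nr_le u v : measurable_fun [set: B] (u : B -> R) ->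
  measurable_fun [set: B] (v : B -> R) ->
  (forall s : G, `|u s| <= v s) -> rfun v \in Lpw_pred w p1 ->
  rfun u \in Lpw_pred w p1 /\ nr (rcl u) <= nr (rcl v).
Proof.
move=> mu_ mv uv Hv.
have LE : (Lpw_norm w p (rfun u) <= Lpw_norm w p (rfun v))%E.
  apply: le_cLnorm => //.
  - by apply: cmeasurable_normc; exact: cmeasurable_weighted_rfun.
  - by apply: cmeasurable_normc; exact: cmeasurable_weighted_rfun.
  move=> x; rewrite !normc_weighted; apply/andP; split.
    by rewrite mulr_ge0// ltW// weight_gt0.
  rewrite ler_wpM2r//; first by rewrite ltW// weight_gt0.
  exact: le_trans (uv x) (ler_norm _).
have Hu : rfun u \in Lpw_pred w p1.
  apply: rfun_mem => //; apply: le_lt_trans LE _.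
  by move: Hv; rewrite inE => -[].
by split => //; rewrite -lee_fin !nr_rcl.
Qed.

Lemma nr_indic L : compact L -> exists2 M : R, 0 <= M &
  forall X : set B, measurable X -> X `<=` L ->
   rfun (\1_X : G -> R) \in Lpw_pred w p1 /\
   nr (rcl (\1_X : G -> R)) <= M * (fine (mu X)) `^ p^-1.
Proof.
move=> cL; have [W W0 HW] := weight_compact_bounded hG lcG cgG haar w cL.
have mL : measurable (L : set B) by exact: borel_compact.
exists W; first exact: ltW.
move=> X mX XL.
have mX1 : measurable_fun [set: B] ((\1_X : G -> R) : B -> R) by exact: measurable_indic.
have Xfin : (mu X < +oo)%E.
  apply: le_lt_trans (haar_compact haar cL); apply: le_measure; rewrite ?inE//.
have Xf : mu X \is a fin_num by rewrite ge0_fin_numE.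
have LE : (Lpw_norm w p (rfun (\1_X : G -> R)) <= (W * (fine (mu X)) `^ p^-1)%:E)%E.
  rewrite /Lpw_norm unlock.
  apply: (@le_trans _ _ (((W `^ p)%:E * mu X) `^ p^-1)%E).
    apply: gt0_ler_poweR; rewrite ?invr_ge0 ?(ltW p0)//.
    - by rewrite in_itv/= leey andbT integral_ge0// => x _; exact: poweR_ge0.
    - by rewrite in_itv/= leey andbT mule_ge0// lee_fin powR_ge0.
    rewrite -[X in (_ * mu X)%E]setIT -integral_indic// -ge0_integralZl//; last 2 first.
      exact/measurable_EFinP/measurable_indic.
      by rewrite lee_fin powR_ge0.
    apply: ge0_le_integral => //.
    - by move=> x _; exact: poweR_ge0.
    - apply/measurable_EFinP/(measurableT_comp (measurable_powR p))/measurableT_comp => //.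
      by apply: cmeasurable_normc; exact: cmeasurable_weighted_rfun.
    - by apply: measurable_funeM; exact/measurable_EFinP/measurable_indic.
    move=> x _; rewrite normc_weighted /= lee_fin indicE.
    have [|_] := boolP (x \in X); last first.
      by rewrite normr0 mul0r normr0 powR0 ?mulr0// gt_eqF.
    rewrite inE => /XL/HW wW.
    rewrite normr1 mul1r mulr1 gtr0_norm ?weight_gt0//.
    by apply: ge0_ler_powR; rewrite ?nnegrE ?(ltW p0) ?(ltW W0) ?(ltW (weight_gt0 w x)).
  rewrite poweRM ?lee_fin ?powR_ge0// -[X in (_ * X `^ _)%E](fineK Xf).
  rewrite /= -powRrM mulfV ?gt_eqF// powRr1 ?(ltW W0)//.
have HX : rfun (\1_X : G -> R) \in Lpw_pred w p1.
  by apply: rfun_mem => //; apply: le_lt_trans LE _; rewrite ltry.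
by split => //; rewrite -lee_fin nr_rcl.
Qed.

Lemma Lpw_measurable (f : Lpw_fun w p1) :
  measurable_fun [set: B] (fun s : B => complex.Re (f s)) /\
  measurable_fun [set: B] (fun s : B => complex.Im (f s)).
Proof.
have [mf _] : cLp mu p%:E (weighted w f) by have := Lpw_valP f; rewrite inE.
have mV : measurable_fun [set: B] (fun s : B => (w s)^-1).
  rewrite (_ : (fun s => _) = fun s : B => w s `^ (-1)); last first.
    by apply/funext => s; rewrite powR_inv1// ltW// weight_gt0.
  by apply: (measurableT_comp (measurable_powR (-1))); exact: weight_measurable.
have wK (s : B) (a : R) : a * w s * (w s)^-1 = a by rewrite mulfK// gt_eqF// weight_gt0.
split.
- rewrite (_ : (fun s => _) = fun s : B => complex.Re (weighted w f s) * (w s)^-1).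
    by apply: measurable_funM => //; case: mf.
  by apply/funext => s; rewrite -[LHS](wK s) /weighted; case: (f s) => a b /=; rewrite mulr0 subr0.
- rewrite (_ : (fun s => _) = fun s : B => complex.Im (weighted w f s) * (w s)^-1).
    by apply: measurable_funM => //; case: mf.
  by apply/funext => s; rewrite -[LHS](wK s) /weighted; case: (f s) => a b /=; rewrite mulr0 add0r.
Qed.

Lemma rfun_dominated (f : Lpw_fun w p1) u : measurable_fun [set: B] (u : B -> R) ->
  (forall s : G, `|u s| <= normc (f s)) ->
  rfun u \in Lpw_pred w p1 /\ (Lpw_norm w p (rfun u) <= Lpw_norm w p f)%E.
Proof.
move=> mu_ uf.
have [mf fin] : cLp mu p%:E (weighted w f) by have := Lpw_valP f; rewrite inE.
have LE : (Lpw_norm w p (rfun u) <= Lpw_norm w p f)%E.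
  apply: le_cLnorm => //.
  - by apply: cmeasurable_normc; exact: cmeasurable_weighted_rfun.
  - exact: cmeasurable_normc.
  move=> s; have ws := ltW (weight_gt0 w s).
  rewrite normc_weighted mulr_ge0//= [leRHS]Normc.normcM normc_real (ger0_norm ws).
  exact: ler_wpM2r.
by split => //; apply: rfun_mem => //; apply: le_lt_trans LE fin.
Qed.

Variable phi : A -> R[i]^o.
Hypothesis dphi : dual_space phi.
Hypothesis phi_Cc : forall u, Cc u -> phi (rcl u) = 0.

(** The functions on which phi vanishes; the lemmas below enlarge this class
step by step until it is everything. *)
Let mem_dual0 u := rfun u \in Lpw_pred w p1 /\ phi (rcl u) = 0.

Let mem_dual0_Cc u : Cc u -> mem_dual0 u.
Proof. by move=> Cu; split; [exact: Cc_mem|exact: phi_Cc]. Qed.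

Let mem_dual0D u v : mem_dual0 u -> mem_dual0 v -> mem_dual0 (fun s => u s + v s).
Proof.
move=> [Hu u0] [Hv v0]; split; last by rewrite rclD// dual_add// u0 v0 addr0.
by rewrite rfunD; exact: rpredD.
Qed.

Let mem_dual0Z (a : R) u : mem_dual0 u -> mem_dual0 (fun s => a * u s).
Proof.
move=> [Hu u0]; split; last by rewrite rclZ// dual_scale// u0 mulr0.
by rewrite rfunZ; exact: rpredZ.
Qed.

Let mem_dual0_closed u : rfun u \in Lpw_pred w p1 ->
  (forall e : R, 0 < e -> exists2 v, mem_dual0 v & nr (rcl (fun s => u s - v s)) < e) ->
  mem_dual0 u.
Proof.
move=> Hu H; split => //; apply: dual_zero_closed => // e /H[v [Hv v0] uv].
by exists (rcl v) => //; rewrite -rclB.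
Qed.

Let small_root (M e : R) : 0 <= M -> 0 < e -> exists2 d, 0 < d &
  forall m : \bar R, (0 <= m < d%:E)%E -> M * (fine m) `^ p^-1 < e.
Proof.
move=> M0 e0; have M1 : 0 < M + 1 by rewrite ltr_wpDl.
have eM : 0 < e / (M + 1) by rewrite divr_gt0.
exists ((e / (M + 1)) `^ p); first exact: powR_gt0.
case=> [m /andP[]|/andP[] //|/andP[] //].
rewrite lee_fin lte_fin => m0 md /=.
apply: (@le_lt_trans _ _ (M * (e / (M + 1)))).
  apply: ler_wpM2l => //.
  have -> : e / (M + 1) = ((e / (M + 1)) `^ p) `^ p^-1.
    by rewrite -powRrM mulfV ?gt_eqF// powRr1// ltW.
  by apply: ge0_ler_powR; rewrite ?invr_ge0 ?nnegrE ?powR_ge0 ?(ltW p0) ?(ltW md).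
rewrite mulrCA gtr_pMr// ltr_pdivrMr// mul1r ltrDl//.
Qed.

(** Inner regularity gives a compact K filling U up to a small measure; the
indicator of U differs from a Urysohn function of K in U only on [U `\` K]. *)
Let mem_dual0_open L (U : set G) : compact L -> open U -> U `<=` L ->
  mem_dual0 (\1_U : G -> R).
Proof.
move=> cL oU UL; have [M M0 HM] := nr_indic cL.
have mU : measurable (U : set B) by exact: borel_open.
have mL : measurable (L : set B) by exact: borel_compact.
have Ufin : (mu U < +oo)%E.
  by apply: le_lt_trans (haar_compact haar cL); apply: le_measure; rewrite ?inE.
have [HU _] := HM _ mU UL.
apply: mem_dual0_closed => // e e0.
have [d d0 Hd] := small_root M0 e0.
have [K [cK KU Kd]] := haar_open_approx hG haar oU Ufin d0.
have mK : measurable (K : set B) by exact: borel_compact.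
have [f [Cf f01 f1 f0]] := urysohn_compact (R := R) hG lcG cK oU KU.
exists f; first exact: mem_dual0_Cc.
have mUK : measurable (U `\` K : set B) by exact: measurableD.
have [HUK NUK] := HM _ mUK (subset_trans (@subDsetl _ _ _) UL).
have mf : measurable_fun [set: B] (f : B -> R) by apply: continuous_borel; have [] := Cf.
have [||s|_] := nr_le (u := fun s => \1_U s - f s) _ _ _ HUK.
- by apply: measurable_funB => //; exact: measurable_indic.
- exact: measurable_indic.
- rewrite !indicE; have [Us|nUs] := pselect (U s); last first.
    by rewrite f0// !memNset//= ?subrr ?normr0// => -[].
  have [Ks|nKs] := pselect (K s); first by rewrite f1// mem_set// subrr normr0.
  rewrite !mem_set//=; have /andP[? ?] := f01 s.
  by rewrite ger0_norm ?subr_ge0// lerBlDr lerDl.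
move=> /le_lt_trans; apply; apply: le_lt_trans NUK _.
by apply: Hd; rewrite Kd andbT.
Qed.

(** Outer regularity: a Borel set is an open set up to a small measure. *)
Let mem_dual0_borel K (X : set B) : compact K -> measurable X -> X `<=` K ->
  mem_dual0 (\1_X : G -> R).
Proof.
move=> cK mX XK; have [L cL [V oV [KV VL]]] := compact_nbhs lcG cK.
have [M M0 HM] := nr_indic cL.
have mL : measurable (L : set B) by exact: borel_compact.
have mK : measurable (K : set B) by exact: borel_compact.
have Xfin : (mu X < +oo)%E.
  by apply: le_lt_trans (haar_compact haar cK); apply: le_measure; rewrite ?inE.
have XL : X `<=` L by move=> s /XK/KV/VL.
have [HX _] := HM _ mX XL.
apply: mem_dual0_closed => // e e0.
have [d d0 Hd] := small_root M0 e0.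
have [U [oU XU Ud]] := haar_borel_approx haar mX Xfin d0.
pose W := U `&` V; have oW : open W by exact: openI.
have mU : measurable (U : set B) by exact: borel_open.
have mW : measurable (W : set B) by exact: borel_open.
have WL : W `<=` L by move=> s [_ /VL].
exists (\1_W : G -> R); first exact: mem_dual0_open cL oW WL.
have mWX : measurable (W `\` X : set B) by exact: measurableD.
have [HWX NWX] := HM _ mWX (subset_trans (@subDsetl _ _ _) WL).
have [||s|_] := nr_le (u := fun s => \1_X s - \1_W s) _ _ _ HWX.
- by apply: measurable_funB; exact: measurable_indic.
- exact: measurable_indic.
- rewrite !indicE; have [Ws|nWs] := pselect (W s); last first.
    have nXs : ~ X s by move=> Xs; apply: nWs; split; [exact: XU|apply: KV; exact: XK].
    by rewrite !memNset//= ?subrr ?normr0// => -[].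
  have [Xs|nXs] := pselect (X s).
    by rewrite (mem_set Xs) (mem_set Ws) subrr normr0.
  by rewrite (memNset nXs) !mem_set//= sub0r normrN1.
move=> /le_lt_trans; apply; apply: le_lt_trans NWX _.
apply: Hd; rewrite measure_ge0 /=; apply: le_lt_trans Ud.
apply: le_measure; rewrite ?inE//; first exact: measurableD.
by move=> s [[Us _] nXs].
Qed.

Import HBNNSimple.

Let mem_dual0_nnsfun K (h : {nnsfun B >-> R}) : compact K ->
  mem_dual0 (fun s => h s * \1_K s).
Proof.
move=> cK; have mK : measurable (K : set B) by exact: borel_compact.
rewrite (_ : (fun s => _) = fun s => \sum_(y <- finmap.enum_fset (fset_set (range h)))
    y * \1_((h @^-1` [set y] : set B) `&` K) s); last first.
  apply/funext => s; rewrite {1}(fimfunE h) fsbig_finite//= mulr_suml.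
  by apply: eq_bigr => y _; rewrite -mulrA indicI.
elim: (finmap.enum_fset _) => [|y l IH].
  rewrite (_ : (fun s => _) = (fun s => 0 * \1_K s)); last first.
    by apply/funext => s; rewrite big_nil mul0r.
  by apply: mem_dual0Z; exact: (mem_dual0_borel cK mK).
rewrite (_ : (fun s => _) = fun s => y * \1_((h @^-1` [set y] : set B) `&` K) s +
   \sum_(y <- l) y * \1_((h @^-1` [set y] : set B) `&` K) s); last first.
  by apply/funext => s; rewrite big_cons.
apply: mem_dual0D => //; apply: mem_dual0Z; apply: (mem_dual0_borel cK).
  exact: measurableI.
exact: subIsetr.
Qed.

Let powR_cvg0 (f : nat -> R) : (forall n, 0 <= f n) -> f n @[n --> \oo] --> (0 : R) ->
  (f n `^ p) @[n --> \oo] --> (0 : R).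
Proof.
move=> f0 /cvgrPdist_lt fc; apply/cvgrPdist_lt => e e0.
have ep : 0 < e `^ p^-1 by exact: powR_gt0.
have := fc _ ep; apply: filterS => n; rewrite !sub0r !normrN.
rewrite (ger0_norm (f0 n)) ger0_norm ?powR_ge0// => fe.
have -> : e = (e `^ p^-1) `^ p by rewrite -powRrM mulVf ?gt_eqF// powRr1// ltW.
by apply: gt0_ltr_powR; rewrite ?nnegrE ?powR_ge0.
Qed.

Let Np u (s : B) : \bar R := (`|(normc (weighted w (rfun u) s))%:E| `^ p)%E.

Let NpE u s : Np u s = ((`|u s| * w s) `^ p)%:E.
Proof.
rewrite /Np normc_weighted /= ger0_norm// mulr_ge0// ltW//.
exact: weight_gt0.
Qed.

Let measurable_Np u : measurable_fun [set: B] (u : B -> R) -> measurable_fun [set: B] (Np u).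
Proof.
move=> mu_; apply/measurable_EFinP/(measurableT_comp (measurable_powR p))/measurableT_comp => //.
by apply: cmeasurable_normc; exact: cmeasurable_weighted_rfun.
Qed.

Let Lpw_normE u : Lpw_norm w p (rfun u) = ((\int[mu]_s Np u s) `^ p^-1)%E.
Proof. by rewrite /Lpw_norm unlock. Qed.

Let integrable_Np u : measurable_fun [set: B] (u : B -> R) ->
  rfun u \in Lpw_pred w p1 -> mu.-integrable [set: B] (Np u).
Proof.
move=> mu_ Hu; apply/integrableP; split; first exact: measurable_Np.
rewrite (eq_integral (Np u)); last first.
  by move=> s _; rewrite gee0_abs// poweR_ge0.
have : (Lpw_norm w p (rfun u) < +oo)%E by move: Hu; rewrite inE => -[].
rewrite Lpw_normE !ltey; apply: contra_neq => ->.
by rewrite poweRyr// invr_eq0 gt_eqF.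
Qed.

(** Simple functions increasing to u, cut off along a compact exhaustion,
converge to u in norm by dominated convergence. *)
Let mem_dual0_ge0 u : measurable_fun [set: B] (u : B -> R) -> (forall s, 0 <= u s) ->
  rfun u \in Lpw_pred w p1 -> mem_dual0 u.
Proof.
move=> mu_ u0 Hu.
have [K_ [cK ndK KT]] := compact_exhaustion cgG.
have mu_E : measurable_fun [set: B] (EFin \o (u : B -> R)) by exact/measurable_EFinP.
pose g := nnsfun_approx measurableT mu_E.
have gcvg (s : B) : g n s @[n --> \oo] --> u s.
  have := @cvg_nnsfun_approx _ _ _ _ measurableT _ mu_E _ s I.
  by move=> /(_ (fun (x : B) _ => u0 x)) /fine_cvgP[].
have g0 n (s : B) : 0 <= g n s by exact: fun_ge0.
have gu n (s : B) : g n s <= u s.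
  have gnd : nondecreasing_seq (fun n => g n s).
    by move=> i j ij; apply/lefP/nd_nnsfun_approx.
  have := nondecreasing_cvgn_le gnd (cvgP _ (gcvg s)) n.
  by rewrite (cvg_lim (@Rhausdorff R) (gcvg s)).
pose v n (s : G) : R := g n s * \1_(K_ n) s.
have v0 n s : 0 <= v n s by rewrite mulr_ge0.
have vu n s : v n s <= u s.
  by rewrite /v (le_trans _ (gu n s))// ler_piMr// indicE lern1 leq_b1.
have mK n : measurable (K_ n : set B) by exact: borel_compact.
have mv n : measurable_fun [set: B] (v n : B -> R).
  by apply: measurable_funM => //; exact: measurable_indic.
have vcvg s : v n s @[n --> \oo] --> u s.
  have [N KNs] := KT s.
  apply: cvg_trans (gcvg s); apply: near_eq_cvg.
  exists N => // n /= Nn; rewrite /v indicE mem_set ?mulr1//.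
  by have /subsetPset := ndK _ _ Nn; apply.
pose F n := Np (fun s => u s - v n s).
have muv n : measurable_fun [set: B] ((fun s => u s - v n s) : B -> R).
  exact: measurable_funB.
have Fdom n (s : B) : (`|F n s| <= Np u s)%E.
  rewrite gee0_abs ?poweR_ge0// /F !NpE lee_fin.
  have ws := ltW (weight_gt0 w s).
  apply: ge0_ler_powR; rewrite ?nnegrE ?(ltW p0) ?mulr_ge0//.
  by rewrite ler_wpM2r// !ger0_norm ?subr_ge0// lerBlDr lerDl.
have Fpt (s : B) : F n s @[n --> \oo] --> 0%E.
  rewrite (_ : (fun n => F n s) = EFin \o (fun n => (`|u s - v n s| * w s) `^ p)); last first.
    by apply/funext => n; rewrite /F NpE.
  apply: cvg_EFin; first exact: nearW.
  apply: powR_cvg0 => [n|]; first by rewrite mulr_ge0// ltW// weight_gt0.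
  rewrite -(mul0r (w s)); apply: cvgMr_tmp.
  rewrite -(normr0 R) -(subrr (u s)); apply: cvg_norm.
  by apply: cvgB; [exact: cvg_cst|exact: vcvg].
have [_ Fcvg _] : [/\ mu.-integrable [set: B] (cst 0%E),
     [sequence \int[mu]_(x in [set: B]) `|F n x - cst 0 x|]_n%E @ \oo --> 0%E
   & [sequence \int[mu]_(x in [set: B]) F n x]_n%E @ \oo --> (\int[mu]_(x in [set: B]) cst 0 x)%E].
  apply: (@dominated_convergence _ B R mu setT measurableT F (cst 0%E) (Np u)).
  - by move=> n; exact: measurable_Np.
  - exact: measurable_cst.
  - by apply: aeW => s _; exact: Fpt.
  - exact: integrable_Np.
  - by apply: aeW => s n _; exact: Fdom.
apply: mem_dual0_closed => // e e0.
have e2 : 0 < (e / 2) `^ p by rewrite powR_gt0// divr_gt0.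
have [n Fn] : exists n, (\int[mu]_s F n s < ((e / 2) `^ p)%:E)%E.
  have e2' : (0%:E < ((e / 2) `^ p)%:E)%E by rewrite lte_fin.
  have [n _ Hn] := Fcvg _ (open_ereal_lt' e2').
  have H : (\int[mu]_s `|F n s - cst 0 s| < ((e / 2) `^ p)%:E)%E := Hn n (leqnn n).
  exists n; apply: le_lt_trans H; rewrite le_eqVlt; apply/orP; left; apply/eqP.
  by apply: eq_integral => s _; rewrite /cst sube0 gee0_abs// poweR_ge0.
exists (v n); first exact: mem_dual0_nnsfun.
have Huv : rfun (fun s => u s - v n s) \in Lpw_pred w p1.
  have [||s|//] := nr_le (u := fun s => u s - v n s) _ _ _ Hu => //.
  by rewrite ger0_norm ?subr_ge0// lerBlDr lerDl.
apply: (@le_lt_trans _ _ (e / 2)); last by rewrite ltr_pdivrMr// ltr_pMr// ltr1n.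
rewrite -lee_fin nr_rcl// Lpw_normE.
have -> : (e / 2)%:E = ((((e / 2) `^ p)%:E) `^ p^-1)%E.
  by rewrite /= -powRrM mulfV ?gt_eqF// powRr1// divr_ge0// ltW.
apply: gt0_ler_poweR; rewrite ?invr_ge0 ?(ltW p0)//.
- by rewrite in_itv/= leey andbT integral_ge0// => x _; exact: poweR_ge0.
- by rewrite in_itv/= leey andbT lee_fin powR_ge0.
exact: ltW.
Qed.

Let mem_dual0_real u : measurable_fun [set: B] (u : B -> R) ->
  rfun u \in Lpw_pred w p1 -> mem_dual0 u.
Proof.
move=> mu_ Hu.
have mabs : measurable_fun [set: B] ((fun s => `|u s|) : B -> R).
  exact: measurableT_comp.
have mneg : measurable_fun [set: B] ((fun s => `|u s| - u s) : B -> R).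
  exact: measurable_funB.
have Habs : rfun (fun s => `|u s|) \in Lpw_pred w p1.
  apply: rfun_mem => //; move: (Hu); rewrite inE => -[_]; apply: le_lt_trans.
  have E : Np (fun s => `|u s|) = Np u by apply/funext => s; rewrite !NpE normr_id.
  suff -> : Lpw_norm w p (rfun (fun s => `|u s|)) = Lpw_norm w p (rfun u) by exact: lexx.
  by rewrite !Lpw_normE E.
have [_ Hneg] : mem_dual0 (fun s => `|u s|) /\ mem_dual0 (fun s => `|u s| - u s).
  split; first exact: mem_dual0_ge0.
  apply: mem_dual0_ge0 => //; first by move=> s; rewrite subr_ge0 ler_norm.
  rewrite (_ : rfun _ = rfun (fun s => `|u s|) - rfun u); first exact: rpredB.
  by apply/funext => s; rewrite /rfun rmorphB.
rewrite (_ : u = fun s => `|u s| + (-1) * (`|u s| - u s)).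
  by apply: mem_dual0D; [exact: mem_dual0_ge0|exact: mem_dual0Z].
by apply/funext => s; rewrite mulN1r opprB addrC subrK.
Qed.

(** Density of C_c in the form used below: a bounded functional that vanishes
on C_c is 0. *)
Lemma dual_dense x : phi x = 0.
Proof.
set f := Lpw_repr x; have [mRe mIm] := Lpw_measurable f.
have [HRe _] := rfun_dominated (u := fun s => complex.Re (f s)) mRe (fun s => normc_Re (f s)).
have [HIm _] := rfun_dominated (u := fun s => complex.Im (f s)) mIm (fun s => normc_Im (f s)).
have -> : x = rcl (fun s => complex.Re (f s)) + (0 +i* 1) *: rcl (fun s => complex.Im (f s)).
  rewrite !rcl_class -[_ *: _]Lpw_classZ -Lpw_classD -[LHS]Lpw_reprK; congr Lpw_class.
  apply: val_inj; apply/funext => s; rewrite [LHS](_ : _ = f s)//.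
  rewrite [RHS](_ : _ = (complex.Re (f s))%:C + (0 +i* 1) * (complex.Im (f s))%:C)//.
  case: (f s) => a b; apply/eqP; rewrite eq_complex /=.
  by rewrite !(mul0r, mul1r, mulr0, subr0, add0r, addr0) !eqxx.
rewrite dual_add// dual_scale//.
have [_ ->] := mem_dual0_real mRe HRe; have [_ ->] := mem_dual0_real mIm HIm.
by rewrite mulr0 addr0.
Qed.

End density.

(** * Convolutions as limits of combinations of translates *)

Section approximation.
Context {R : realType} {G : topologicalZmodType}.
Local Notation B := (borel_type G).
Variable mu : {measure set B -> \bar R}.
Hypothesis hG : hausdorff_space G.
Hypothesis lcG : locally_compact [set: G].
Hypothesis cgG : compactly_generated G.
Hypothesis haar : haar_measure mu.
Implicit Types (u v f g e : G -> R) (s t y : G).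

(** One term of a Riemann sum: on E the translates of f by t and by s differ by
at most d. *)
Lemma conv_step f g (E : set B) s (d : R) : Cc f -> Cc g -> measurable E -> 0 <= d ->
  (forall t y, E t -> g t != 0 -> `|f (y - t) - f (y - s)| <= d) ->
  forall y, `|\int[mu]_(t in E) (g t * f (y - (t : G))) - (\int[mu]_(t in E) g t) * f (y - s)|
    <= d * \int[mu]_(t in E) `|g t|.
Proof.
move=> Cf Cg mE d0 H y.
have IE (h : G -> R) : Cc h -> mu.-integrable E (EFin \o h).
  move=> Ch; apply: (integrableS measurableT) => //.
  exact: Cc_integrable.
have Cgf := Cc_conv_integrand y Cg Cf.
have Cgs : Cc (fun t => g t * f (y - s)) by apply: CcMr => // t; exact: cvg_cst.
rewrite -RintegralZr//; last exact: IE.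
rewrite -RintegralB//; [|exact: IE|exact: IE].
have Cabs : Cc (fun t => `|g t|).
  have [cg [K cK gK]] := Cg; split; last by exists K => // t /gK ->; rewrite normr0.
  by move=> t; apply: cvg_norm; exact: cg.
rewrite -RintegralZl//; last exact: IE.
have Cdiff : Cc (fun t => g t * f (y - t) - g t * f (y - s)).
  rewrite (_ : (fun t => _) = (fun t => g t * f (y - t) + (-1) * (g t * f (y - s)))).
    by apply: CcD => //; exact: CcZ.
  by apply/funext => t; rewrite mulN1r.
apply: le_trans (le_normr_Rintegral mE (IE _ Cdiff)) _.
have CabsD : Cc (fun t => `|g t * f (y - t) - g t * f (y - s)|).
  have [cg [K cK gK]] := Cdiff; split; last by exists K => // t /gK ->; rewrite normr0.
  by move=> t; apply: cvg_norm; exact: cg.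
apply: le_Rintegral => //; [exact: IE|by apply: IE; exact: CcZ|].
move=> t Et; rewrite -mulrBr normrM mulrC.
have [->|gt] := eqVneq (g t) 0; first by rewrite normr0 !mulr0.
by rewrite ler_wpM2r//; exact: H.
Qed.

Lemma compact_translates K (W : set G) : compact K -> nbhs 0 W ->
  exists l : seq G, (forall s, s \in l -> K s) /\
    (forall t, K t -> exists2 s, s \in l & W (s - t)).
Proof.
move=> cK W0.
pose D := [set l : seq G | forall s, s \in l -> K s].
pose F := filter_from D (fun l => [set m : seq G | {subset l <= m}]).
have FF : Filter F.
  apply: filter_from_filter; first by exists [::].
  move=> l m Dl Dm; exists (l ++ m).
    by move=> s; rewrite mem_cat => /orP[/Dl|/Dm].
  by move=> n lmn; split => s sl; apply: lmn; rewrite mem_cat sl ?orbT.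
have /(_ _ F (fun l t => exists2 s, s \in l & W (s - t)) FF)[t Kt|l Dl Hl] :=
    (compact_near_coveringP K).1 cK; last first.
  by exists l; split => //; exact: Hl.
exists ([set r | W (t - r)], [set m : seq G | {subset [:: t] <= m}]) => /=.
  split.
    have : continuous (fun r => t - r).
      by apply: continuous_add => [x|x]; [exact: cvg_cst|exact: opp_continuous].
    by move=> /(_ t W); rewrite /= subrr; apply.
  by exists [:: t] => // s; rewrite inE => /eqP ->.
move=> [r m] /= [Wr tm]; exists t => //.
by apply: tm; rewrite inE.
Qed.

Definition combination (l : seq (R * G)) f (y : G) : R :=
  \sum_(cs <- l) cs.1 * f (y - cs.2).

Lemma Cc_combination l f : Cc f -> Cc (combination l f).
Proof.
move=> Cf; elim: l => [|cs l IH].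
  rewrite (_ : combination _ _ = (fun y => 0 * f y)); first exact: CcZ.
  by apply/funext => y; rewrite /combination big_nil mul0r.
rewrite (_ : combination _ _ = (fun y => cs.1 * f (y - cs.2) + combination l f y)).
  by apply: CcD => //; apply: CcZ; exact: Cc_translate.
by apply/funext => y; rewrite /combination big_cons.
Qed.

Lemma combination_supp l f K L : (forall cs, cs \in l -> K cs.2) ->
  (forall x, ~ L x -> f x = 0) ->
  forall x, ~ (set_add K L) x ->
    combination l f x = 0.
Proof.
move=> lK fL x nx; rewrite /combination big_seq big1// => cs csl.
rewrite fL ?mulr0// => Lx; apply: nx; exists cs.2; first exact: lK.
by exists (x - cs.2) => //; rewrite addrC subrK.
Qed.

(** The convolution is a Riemann sum up to a small error: the support of g is
cut into pieces close to points s, and the coefficient of the translate by s is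
the integral of g over its piece.  The combination l depends on g and W but not
on f; it will be used for two different functions at once. *)
Lemma conv_riemann g K (W : set G) : Cc g -> compact K -> (forall t, ~ K t -> g t = 0) ->
  open W -> W 0 ->
  exists l : seq (R * G), (forall cs, cs \in l -> K cs.2) /\
    forall f (d : R), Cc f -> 0 <= d ->
    (forall x z, W z -> `|f (x + z) - f x| <= d) ->
    forall y, `|convol mu g f y - combination l f y| <= d * \int[mu]_t `|g t|.
Proof.
move=> Cg cK gK oW W0.
have [l0 [l0K Kl0]] := compact_translates cK (open_nbhs_nbhs (conj oW W0)).
have mK : measurable (K : set B) by exact: borel_compact.
have IE (E : set B) (h : G -> R) : measurable E -> Cc h -> mu.-integrable E (EFin \o h).
  by move=> mE Ch; apply: (integrableS measurableT) => //; exact: Cc_integrable.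
have Cabs : Cc (fun t => `|g t|).
  have [cg _] := Cg; split; last by exists K => // t /gK ->; rewrite normr0.
  by move=> t; apply: cvg_norm; exact: cg.
suff H (l : seq G) (E : set B) : measurable E -> (forall s, s \in l -> K s) ->
    (forall t, E t -> exists2 s, s \in l & W (s - t)) ->
    exists m : seq (R * G), (forall cs, cs \in m -> K cs.2) /\
    forall f (d : R), Cc f -> 0 <= d ->
    (forall x z, W z -> `|f (x + z) - f x| <= d) ->
    forall y, `|\int[mu]_(t in E) (g t * f (y - (t : G))) - combination m f y| <=
       d * \int[mu]_(t in E) `|g t|.
  have [m [mK' Hm]] := H l0 K mK l0K Kl0.
  exists m; split => // f d Cf d0 fW y.
  have := Hm f d Cf d0 fW y.
  have restr (h : G -> R) : (forall t, ~ K t -> h t = 0) ->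
      \int[mu]_(t in K) h t = \int[mu]_t h t.
    move=> hK; rewrite Rintegral_mkcond; apply: eq_Rintegral => t _.
    rewrite /patch; case: ifPn => // /negP nK; rewrite hK// => Kt.
    by apply: nK; rewrite inE.
  rewrite !restr//; first by move=> t /gK ->; rewrite normr0.
  by move=> t /gK ->; rewrite mul0r.
elim: l E => [|s l IH] E mE lK El.
  have -> : E = set0 by rewrite -subset0 => t /El[].
  exists [::]; split => // f d Cf d0 _ y.
  by rewrite !Rintegral_set0 /combination big_nil subrr normr0 mulr0.
pose Es : set B := [set t : G | W (s - t)].
have mEs : measurable Es.
  apply: borel_open; apply: (@open_comp _ _ (fun t => s - t)) => // t _.
  by apply: continuous_add => x; [exact: cvg_cst|exact: opp_continuous].
have mE1 : measurable (E `&` Es) by exact: measurableI.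
have mE2 : measurable (E `\` Es) by exact: measurableD.
have [|t [Et nEs]|m [mK' Hm]] := IH _ mE2.
- by move=> t tl; apply: lK; rewrite inE tl orbT.
- have [t' + Wt] := El t Et; rewrite inE => /orP[/eqP tt'|tl]; last by exists t'.
  by exfalso; apply: nEs; rewrite /Es /= -tt'.
have EU : E = (E `&` Es) `|` (E `\` Es) by rewrite setUIDK.
have EI : [disjoint (E `&` Es) & (E `\` Es)]
  by apply/disj_set2P; rewrite -subset0 => t [[_ ?] [_ ?]].
have S (h : G -> R) : Cc h ->
    \int[mu]_(t in E) h t = \int[mu]_(t in E `&` Es) h t + \int[mu]_(t in E `\` Es) h t.
  by move=> Ch; rewrite -Rintegral_setU -?EU//; exact: IE.
exists ((\int[mu]_(t in E `&` Es) g t, s) :: m); split.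
  by move=> cs; rewrite inE => /orP[/eqP -> /=|/mK'//]; apply: lK; rewrite inE eqxx.
move=> f d Cf d0 fW y.
rewrite (S _ Cabs) (S _ (Cc_conv_integrand y Cg Cf)).
rewrite mulrDr /combination big_cons opprD addrACA.
apply: le_trans (ler_normD _ _) _; apply: lerD; last exact: Hm.
apply: conv_step => // t z [_ Est] _.
have := fW (z - s) (s - t) Est.
by rewrite addrA subrK.
Qed.

Lemma Cc_approx_unit (W : set G) : open W -> W 0 ->
  exists2 e, Cc e & [/\ forall x, 0 <= e x, forall x, ~ W x -> e x = 0 & \int[mu]_x e x = 1].
Proof.
move=> oW W0.
have W1 : [set (0 : G)] `<=` W by move=> x ->.
have [f [Cf f01 f1 f0]] := urysohn_compact (R := R) hG lcG (@compact_set1 G 0) oW W1.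
have fge0 x : 0 <= f x by have /andP[] := f01 x.
have Ipos : 0 < \int[mu]_x f x.
  by apply: (@Cc_int_gt0 _ _ _ hG haar f 0) => //; rewrite f1.
exists (fun x => (\int[mu]_x f x)^-1 * f x); first exact: CcZ.
split => [x|x /f0 ->|]; last 2 first.
- by rewrite mulr0.
- by rewrite RintegralZl_Cc// mulVf// gt_eqF.
by rewrite mulr_ge0// invr_ge0 ltW.
Qed.

Variables (w : weight mu) (p : R) (p1 : 1 <= p).
Local Notation A := (Lpw w p1).
Local Notation rcl := (rcl w p1).

Lemma CcB u v : Cc u -> Cc v -> Cc (fun x => u x - v x).
Proof.
move=> Cu Cv; rewrite (_ : (fun x => _) = (fun x => u x + (-1) * v x)).
  by apply: CcD => //; exact: CcZ.
by apply/funext => x; rewrite mulN1r.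
Qed.

(** Uniform closeness implies closeness in norm as long as the supports stay in
a fixed compact set. *)
Lemma nr_close L : compact L -> exists2 N : R, 0 <= N & forall u v (d : R), Cc u -> Cc v ->
  (forall x, ~ L x -> u x = 0) -> (forall x, ~ L x -> v x = 0) ->
  (forall x, `|u x - v x| <= d) -> nr (rcl u - rcl v) <= d * N.
Proof.
move=> cL; have [N N0 HN] := nr_bounded hG lcG cgG haar w p1 cL.
exists N => // u v d Cu Cv uL vL uvd.
rewrite -rclB; [|exact: Cc_mem|exact: Cc_mem].
have Cuv := CcB Cu Cv.
have [||//] := HN (fun x => u x - v x) d _ uvd.
- by apply: continuous_borel; have [] := Cuv.
- by move=> x nL; rewrite uL// vL// subrr.
Qed.

Lemma translate_close u (d : R) : Cc u -> 0 < d ->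
  \forall s \near (0 : G), nr (rcl (fun x => u (x + s)) - rcl u) < d.
Proof.
move=> Cu d0; have [cu [K cK uK]] := Cu.
have [V cV V0] := compact_nbhs0 lcG.
pose L := K `|` (set_add K [set z | V (- z)]).
have cL : compact L by apply: compactU => //; apply: compact_add => //; exact: compact_opp.
have [N N0 HN] := nr_close cL.
have N1 : 0 < N + 1 by rewrite ltr_wpDl.
have dN : 0 < d / (N + 1) by rewrite divr_gt0.
have := Cc_uniform lcG Cu dN; apply: filterS2 V0 => s Vs us.
apply: (@le_lt_trans _ _ (d / (N + 1) * N)).
  apply: HN => //; first exact: Cc_translate.
  - move=> x /not_orP[_ nx]; apply: uK => Kxs; apply: nx.
    by exists (x + s) => //; exists (- s); rewrite /= ?opprK ?addrK.
  - by move=> x /not_orP[/uK].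
  - by move=> x; exact: ltW.
by rewrite mulrAC ltr_pdivrMr// ltr_pM2l// ltrDl.
Qed.

Lemma approx_id u (d : R) : Cc u -> 0 < d ->
  exists2 e, Cc e & nr (rcl u - rcl (convol mu u e)) < d.
Proof.
move=> Cu d0; have [cu [K cK uK]] := Cu.
have [V cV V0] := compact_nbhs0 lcG.
pose L := K `|` (set_add K V).
have cL : compact L by apply: compactU => //; exact: compact_add.
have [N N0 HN] := nr_close cL.
have N1 : 0 < N + 1 by rewrite ltr_wpDl.
have dN : 0 < d / (N + 1) by rewrite divr_gt0.
have : nbhs (0 : G) (V `&` [set s | forall x, `|u (x + s) - u x| < d / (N + 1)]).
  by apply: filterI => //; exact: Cc_uniform.
rewrite nbhsE => -[U [oU U0] UV].
have oW : open (U `&` [set z | U (- z)]) by apply: openI => //; exact: open_opp.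
have W0 : (U `&` [set z | U (- z)]) (0 : G) by split => //=; rewrite oppr0.
have [e Ce [e0 eW e1]] := Cc_approx_unit oW W0.
exists e => //; apply: (@le_lt_trans _ _ (d / (N + 1) * N)); last first.
  by rewrite mulrAC ltr_pdivrMr// ltr_pM2l// ltrDl.
apply: HN => //; first exact: Cc_conv.
- by move=> x /not_orP[/uK].
- move=> x /not_orP[_ nx]; rewrite /convol (_ : (fun t => _) = cst 0) ?Rintegral_cst ?mul0r//.
  apply/funext => t /=; have [Kt|nKt] := pselect (K t); last by rewrite uK// mul0r.
  rewrite eW ?mulr0// => -[/UV[Vxt _] _]; apply: nx; exists t => //.
  by exists (x - t) => //; rewrite addrC subrK.
move=> y; rewrite distrC convolC//.
have := conv_step (s := 0) Cu Ce measurableT (ltW dN) _ y.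
have eabs : \int[mu]_x `|e x| = 1.
  by rewrite -e1; apply: eq_Rintegral => x _; rewrite ger0_norm.
rewrite eabs e1 mul1r subr0 mulr1; apply => t z _ et.
have [_ /UV[_ /= ut]] : (U `&` [set z | U (- z)]) t.
  by apply: contrapT => nW; rewrite eW// eqxx in et.
by rewrite subr0 ltW// ut.
Qed.

End approximation.

(** * From derivations to homomorphisms *)

(** The algebra behind the homomorphism attached to a derivation: X will be the
functions on G, [**] the convolution and beta the form f, g |-> D(f)(g). *)
Section translation_cocycle.
Context {G V : zmodType} {X : Type}.
Variables (C : X -> Prop) (mulX : X -> X -> X) (tr : G -> X -> X) (beta : X -> X -> V).
Local Notation "u ** v" := (mulX u v) (at level 40).
Hypothesis C_tr : forall s u, C u -> C (tr s u).
Hypothesis tr0 : forall u, tr 0 u = u.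
Hypothesis tr_tr : forall s t u, tr s (tr t u) = tr (s + t) u.
Hypothesis tr_l : forall s u v, C u -> C v -> tr s u ** v = tr s (u ** v).
Hypothesis tr_r : forall s u v, C u -> C v -> u ** tr s v = tr s (u ** v).
Hypothesis leibniz : forall u v c, C u -> C v -> C c ->
  beta (u ** v) c = beta v (c ** u) + beta u (v ** c).

(** Its vanishing makes translations self-adjoint for beta, see
[translation_cocycle_eq0]. *)
Definition translation_cocycle a b c s : V :=
  beta (tr s a) (tr (- s) (b ** c)) - beta a (b ** c).

Let ecocycle s a b c := beta (tr s a) (b ** c) - beta a (tr s (b ** c)).

(** Apply the Leibniz rule to [tr s a ** b = a ** tr s b] on both sides. *)
Let ecocycle_cyclic s a b c : C a -> C b -> C c -> ecocycle s a b c = ecocycle s b c a.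
Proof.
move=> Ca Cb Cc_; have Ct := @C_tr s.
have := leibniz (Ct _ Ca) Cb Cc_.
rewrite tr_l// -tr_r// leibniz//; last exact: Ct.
rewrite tr_r// tr_l// => H; rewrite /ecocycle.
have {H} -> : beta (tr s a) (b ** c) =
    beta (tr s b) (c ** a) + beta a (tr s (b ** c)) - beta b (tr s (c ** a)).
  by rewrite H addrC addKr.
by rewrite addrAC addrK.
Qed.

(** The increments from 0 to s and from t to s + t are both values of
[ecocycle s]; a cyclic permutation brings their first two arguments into one
product, where the translations by t and by - t cancel. *)
Lemma translation_cocycle_additive a b c : C a -> C b -> C c ->
  {morph translation_cocycle a b c : s t / s + t}.
Proof.
move=> Ca Cb Cc_ s t.
have xiE : translation_cocycle a b c s = ecocycle s a (tr (- s) b) c.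
  by rewrite /translation_cocycle /ecocycle tr_l// tr_tr subrr tr0.
have st : s - (s + t) = - t by rewrite opprD addrA subrr add0r.
have -> : translation_cocycle a b c (s + t) =
    ecocycle s (tr t a) (tr (- (s + t)) b) c + translation_cocycle a b c t.
  by rewrite /translation_cocycle /ecocycle tr_tr tr_l// tr_tr st addrA subrK.
congr (_ + _); rewrite xiE.
rewrite -ecocycle_cyclic//; [|exact: C_tr..].
rewrite -[RHS]ecocycle_cyclic//; [|exact: C_tr..].
rewrite /ecocycle tr_l ?tr_r//; [|exact: C_tr..].
by rewrite tr_tr opprD addrCA subrr addr0.
Qed.

Lemma translation_cocycle_eq0 a b c s : C a -> C b -> C c ->
  translation_cocycle a (tr s b) c s = 0 -> beta (tr s a) (b ** c) = beta a (tr s (b ** c)).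
Proof.
move=> Ca Cb Cc_; rewrite /translation_cocycle tr_l// tr_tr addNr tr0 => /eqP.
by rewrite subr_eq0 => /eqP.
Qed.

End translation_cocycle.

Section derivation.
Context {R : realType} {G : topologicalZmodType}.
Local Notation B := (borel_type G).
Variable mu : {measure set B -> \bar R}.
Hypothesis hG : hausdorff_space G.
Hypothesis lcG : locally_compact [set: G].
Hypothesis cgG : compactly_generated G.
Hypothesis haar : haar_measure mu.
Variables (w : weight mu) (p : R) (p1 : 1 <= p).
Local Notation A := (Lpw w p1).
Local Notation rcl := (rcl w p1).
Implicit Types (u v f g a b c : G -> R) (s t y : G).
Variable mul : A -> A -> A.
Hypothesis mul_conv : is_convolution mul.
Variable D : A -> (A -> R[i]^o).
Hypothesis derD : bounded_derivation mul D.

Let beta u v : R[i] := D (rcl u) (rcl v).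
Let tr s u : G -> R := fun x => u (x + s).

Let Cc_tr s u : Cc u -> Cc (tr s u).
Proof. exact: Cc_translate. Qed.

Let Ccc u v : Cc u -> Cc v -> Cc (convol mu u v).
Proof. exact: Cc_conv. Qed.

Local Notation "u ** v" := (convol mu u v) (at level 40).

Let tr_tr s t u : tr s (tr t u) = tr (s + t) u.
Proof. by apply/funext => x; rewrite /tr addrA. Qed.

Let tr0 u : tr 0 u = u.
Proof. by apply/funext => x; rewrite /tr addr0. Qed.

Let tr_l s u v : Cc u -> Cc v -> tr s u ** v = tr s (u ** v).
Proof. exact: conv_translatel. Qed.

Let tr_r s u v : Cc u -> Cc v -> u ** tr s v = tr s (u ** v).
Proof. exact: conv_translater. Qed.

Let cC u v : Cc u -> Cc v -> u ** v = v ** u.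
Proof. exact: convolC. Qed.

Let leibniz u v c : Cc u -> Cc v -> Cc c ->
  beta (u ** v) c = beta v (c ** u) + beta u (v ** c).
Proof.
move=> Cu Cv Ccc'; rewrite /beta -(mul_rcl hG lcG cgG haar mul_conv)//.
rewrite (derivation_leibniz derD).
by rewrite -!(mul_rcl hG lcG cgG haar mul_conv).
Qed.

Lemma derivation_dual1 x : dual_space (D x).
Proof. exact: (derivation_dual derD). Qed.

Lemma derivation_bound : exists2 M : R, 0 <= M &
  forall x (y : A), normc (D x y) <= M * nr x * nr y.
Proof.
have [C HC] := derivation_bounded derD.
exists `|complex.Re C|; first exact: normr_ge0.
move=> x y; have := HC x y; rewrite !nrE.
rewrite [`|D x y|](_ : _ = (normc (D x y))%:C)// -mulrA -rmorphM.
case: C {HC} => c d; rewrite lecE /= => /andP[_].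
rewrite mulr0 subr0 => /le_trans; apply.
by rewrite -mulrA ler_wpM2r ?mulr_ge0 ?nr_ge0// ler_norm.
Qed.

Lemma derivation_dual2 (y : A) : dual_space (fun x => D x y).
Proof.
split.
  by move=> k x x'; rewrite (derivation_linear derD).
have [M M0 HM] := derivation_bound; exists (M * nr y)%:C => x.
rewrite nrE [`|D x y|](_ : _ = (normc (D x y))%:C)// -rmorphM lecR.
by rewrite mulrAC.
Qed.

Definition xi : (G -> R) -> (G -> R) -> (G -> R) -> G -> R[i] :=
  translation_cocycle (convol mu) tr beta.

Lemma xi_additive a b c : Cc a -> Cc b -> Cc c -> {morph xi a b c : s t / s + t}.
Proof. exact: (translation_cocycle_additive Cc_tr tr0 tr_tr tr_l tr_r leibniz). Qed.

(** Both translations cost a factor of the weight, by [nr_translate]. *)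
Lemma xi_bounded a b c : Cc a -> Cc b -> Cc c -> exists2 M : R, 0 <= M &
  forall s, normc (xi a b c s) <= M * (w s * w (- s)).
Proof.
move=> Ca Cb Cc_; have [M M0 HM] := derivation_bound.
have [C C0 Csub] := weight_submul w.
have Cbc := Ccc Cb Cc_.
pose k := normc (beta a (b ** c)).
have k0 : 0 <= k by rewrite /k normcE_sqrt sqrtr_ge0.
have trn s u : Cc u -> nr (rcl (tr s u)) <= C * w (- s) * nr (rcl u).
  by move=> Cu; exact: nr_translate.
exists (M * (C * nr (rcl a)) * (C * nr (rcl (b ** c))) + k * C).
  by rewrite addr_ge0// ?mulr_ge0// ?nr_ge0// ltW.
move=> s; rewrite /xi /translation_cocycle.
have ws := weight_gt0 w s; have wsN := weight_gt0 w (- s).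
apply: le_trans (le_normcD _ _) _; rewrite mulrDl lerD//.
  apply: le_trans (HM _ _) _.
  apply: (@le_trans _ _ (M * (C * w (- s) * nr (rcl a)) * (C * w s * nr (rcl (b ** c))))).
    rewrite -mulrA -[leRHS]mulrA ler_wpM2l// ler_pM ?nr_ge0//; first exact: trn.
    by have := trn (- s) _ Cbc; rewrite opprK.
  by rewrite le_eqVlt; apply/orP; left; apply/eqP; ring.
rewrite normcN -/k -mulrA ler_peMr//.
have := Csub s (- s); rewrite subrr weight0 => /le_trans; apply.
by rewrite mulrA.
Qed.

Let near0 (d : R) u : Cc u -> 0 < d ->
  \forall s \near (0 : G), nr (rcl (tr s u) - rcl u) < d.
Proof. by move=> Cu d0; exact: translate_close. Qed.

Let near0N (d : R) u : Cc u -> 0 < d ->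
  \forall s \near (0 : G), nr (rcl (tr (- s) u) - rcl u) < d.
Proof.
move=> Cu d0; have := @opp_continuous G 0.
by rewrite /continuous_at oppr0 => /(_ _ (near0 Cu d0)).
Qed.

Lemma xi_near0 a b c (e : R) : Cc a -> Cc b -> Cc c -> 0 < e ->
  \forall s \near (0 : G), normc (xi a b c s) < e.
Proof.
move=> Ca Cb Cc_ e0; have [M M0 HM] := derivation_bound.
have Cx := Ccc Cb Cc_; set x := b ** c in Cx *.
pose k := M * (nr (rcl x) + 1 + nr (rcl a)).
have k0 : 0 <= k by rewrite mulr_ge0// !addr_ge0// nr_ge0.
have k1 : 0 < k + 1 by rewrite ltr_wpDl.
have ek : 0 < e / (k + 1) by rewrite divr_gt0.
pose d := Num.min 1 (e / (k + 1)).
have d0 : 0 < d by rewrite /d lt_min ltr01.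
apply: filterS2 (near0 Ca d0) (near0N Cx d0) => s sa sx.
rewrite /xi /translation_cocycle -/x.
have -> : beta (tr s a) (tr (- s) x) - beta a x =
    D (rcl (tr s a) - rcl a) (rcl (tr (- s) x)) +
    D (rcl a) (rcl (tr (- s) x) - rcl x).
  rewrite (dual_sub _ _ (derivation_dual2 _)) (dual_sub _ _ (derivation_dual1 _)).
  by rewrite addrA subrK.
have d1 : d <= 1 by rewrite /d ge_min lexx.
have nx : nr (rcl (tr (- s) x)) <= nr (rcl x) + 1.
  rewrite -[rcl (tr (- s) x)](subrK (rcl x)) addrC.
  by rewrite (le_trans (nrD _ _))// lerD2l (le_trans (ltW sx)).
apply: (le_lt_trans (le_normcD _ _)).
apply: (@le_lt_trans _ _ (d * k)).
  rewrite /k mulrCA mulrDr mulrDr lerD//.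
    apply: le_trans (HM _ _) _; rewrite -mulrA ler_wpM2l//.
    by rewrite ler_pM ?nr_ge0// ltW.
  apply: le_trans (HM _ _) _; rewrite -mulrA ler_wpM2l// mulrC.
  by rewrite ler_wpM2r ?nr_ge0// ltW.
apply: (@le_lt_trans _ _ (e / (k + 1) * k)).
  by rewrite ler_wpM2r// /d ge_min lexx orbT.
by rewrite mulrAC ltr_pdivrMr// ltr_pM2l// ltrDl.
Qed.

Lemma xi_continuous a b c : Cc a -> Cc b -> Cc c ->
  continuous (xi a b c : G -> R[i]^o).
Proof.
move=> Ca Cb Cc_ s0; apply/cvgrPdist_lt => e.
case: e => er ei; rewrite ltcE /= => /andP[/eqP -> er0].
have cs : continuous (fun s => s0 - s : G).
  by apply: continuous_add => [r|r]; [exact: cvg_cst|exact: opp_continuous].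
have cs0 := cs s0; rewrite /continuous_at subrr in cs0.
have [V oV VH] : exists2 V, nbhs (0 : G) V & forall r, V r -> normc (xi a b c r) < er.
  by eexists; first exact: (xi_near0 Ca Cb Cc_ er0).
have : \forall s \near s0, normc (xi a b c (s0 - s)) < er.
  have Vs : \forall s \near s0, V (s0 - s) by exact: cs0.
  by apply: filterS Vs => s; exact: VH.
apply: filterS => s.
have -> : xi a b c s0 - xi a b c s = xi a b c (s0 - s).
  by have := xi_additive Ca Cb Cc_ (s0 - s) s; rewrite subrK => ->; rewrite addrK.
by move=> H; rewrite [`|_|](_ : _ = (normc (xi a b c (s0 - s)))%:C)// ltcR.
Qed.

Section vanishing.
Hypothesis xi0 : forall a b c s, Cc a -> Cc b -> Cc c -> xi a b c s = 0.

Let beta_tr a b c s : Cc a -> Cc b -> Cc c ->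
  beta (tr s a) (b ** c) = beta a (tr s (b ** c)).
Proof.
move=> Ca Cb Cc_; apply: (translation_cocycle_eq0 tr0 tr_tr tr_l Ca Cb Cc_).
exact: (xi0 s Ca (Cc_tr s Cb) Cc_).
Qed.

Let beta_rcl2_combination l f (y : A) : Cc f -> dual_space (D y) ->
  D y (rcl (combination l f)) = \sum_(cs <- l) cs.1%:C * D y (rcl (tr (- cs.2) f)).
Proof.
move=> Cf dy; elim: l => [|cs l IH].
  rewrite big_nil (_ : combination _ _ = (fun z => 0 * f z)); last first.
    by apply/funext => z; rewrite /combination big_nil mul0r.
  by rewrite rclZ ?dual_scale// ?mul0r//; exact: Cc_mem.
rewrite big_cons -IH (_ : combination _ _ = (fun z => cs.1 * f (z - cs.2) + combination l f z)).
  rewrite rclD ?dual_add//; last 2 first.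
  - by apply: Cc_mem => //; apply: CcZ; exact: Cc_translate.
  - by apply: Cc_mem => //; exact: Cc_combination.
  by rewrite rclZ ?dual_scale//; apply: Cc_mem => //; exact: Cc_translate.
by apply/funext => z; rewrite /combination big_cons.
Qed.

Let beta_rcl1_combination l f (y : A) : Cc f ->
  D (rcl (combination l f)) y = \sum_(cs <- l) cs.1%:C * D (rcl (tr (- cs.2) f)) y.
Proof.
move=> Cf; have dy := derivation_dual2 y; elim: l => [|cs l IH].
  rewrite big_nil (_ : combination _ _ = (fun z => 0 * f z)); last first.
    by apply/funext => z; rewrite /combination big_nil mul0r.
  by rewrite rclZ ?(dual_scale _ _ dy)// ?mul0r//; exact: Cc_mem.
rewrite big_cons -IH (_ : combination _ _ = (fun z => cs.1 * f (z - cs.2) + combination l f z)).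
  rewrite rclD ?(dual_add _ _ dy)//; last 2 first.
  - by apply: Cc_mem => //; apply: CcZ; exact: Cc_translate.
  - by apply: Cc_mem => //; exact: Cc_combination.
  by rewrite rclZ ?(dual_scale _ _ dy)//; apply: Cc_mem => //; exact: Cc_translate.
by apply/funext => z; rewrite /combination big_cons.
Qed.

(** Translations are self-adjoint for beta on products, hence so are their linear
combinations, hence so are their limits: convolutions by g. *)
Let beta_conv f g b c : Cc f -> Cc g -> Cc b -> Cc c ->
  beta (g ** f) (b ** c) = beta f (g ** (b ** c)).
Proof.
move=> Cf Cg Cb Cc_; have Cx := Ccc Cb Cc_; set x := b ** c in Cx *.
have [M M0 HM] := derivation_bound.
have [cg [K cK gK]] := Cg; have [_ [Kf cKf fK]] := Cf; have [_ [Kx cKx xK]] := Cx.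
pose Lf := set_add K Kf.
pose Lx := set_add K Kx.
have [Nf Nf0 HNf] := nr_close hG lcG cgG haar w p1 (compact_add cK cKf).
have [Nx Nx0 HNx] := nr_close hG lcG cgG haar w p1 (compact_add cK cKx).
pose I := \int[mu]_t `|g t|.
have I0 : 0 <= I by apply: Rintegral_ge0 => t _.
pose k := M * (I * Nf * nr (rcl x) + nr (rcl f) * (I * Nx)).
have k0 : 0 <= k by rewrite mulr_ge0// addr_ge0// ?mulr_ge0// nr_ge0.
have supp_conv h Kh : (forall x, ~ Kh x -> h x = 0) -> forall y,
    ~ (set_add K Kh) y -> (g ** h) y = 0.
  move=> hK y nx; rewrite /convol (_ : (fun t => _) = cst 0) ?Rintegral_cst ?mul0r//.
  apply/funext => t /=; have [Kt|nKt] := pselect (K t); last by rewrite gK// mul0r.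
  rewrite hK ?mulr0// => Kyt; apply: nx; exists t => //.
  by exists (y - t) => //; rewrite addrC subrK.
apply/eqP; rewrite -subr_eq0; apply/eqP; apply: Normc.eq0_normc.
apply/le_anti/andP; split; last by rewrite normcE_sqrt sqrtr_ge0.
apply/ler_addgt0Pr => e e0; rewrite add0r.
have k1 : 0 < k + 1 by rewrite ltr_wpDl.
pose d := e / (k + 1); have d0 : 0 < d by rewrite divr_gt0.
have : nbhs (0 : G) ([set s | forall x, `|f (x + s) - f x| < d] `&`
    [set s | forall z, `|x (z + s) - x z| < d]).
  by apply: filterI; exact: Cc_uniform.
rewrite nbhsE => -[U [oU U0] UV].
have [l [lK Hl]] := conv_riemann hG haar Cg cK gK oU U0.
have Clf := Cc_combination l Cf; have Clx := Cc_combination l Cx.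
have lff : nr (rcl (g ** f) - rcl (combination l f)) <= d * I * Nf.
  apply: HNf => //; [exact: Ccc|exact: supp_conv|exact: combination_supp|].
  by apply: Hl => //; [exact: ltW|move=> z s /UV[/(_ z)/ltW]].
have lxx : nr (rcl (combination l x) - rcl (g ** x)) <= d * I * Nx.
  rewrite nrB; apply: HNx => //; [exact: Ccc|exact: supp_conv|exact: combination_supp|].
  by apply: Hl => //; [exact: ltW|move=> z s /UV[_ /(_ z)/ltW]].
have E : D (rcl (combination l f)) (rcl x) = D (rcl f) (rcl (combination l x)).
  rewrite (beta_rcl1_combination l (rcl x) Cf) (beta_rcl2_combination l Cx (derivation_dual1 _)).
  by apply: eq_bigr => cs _; congr (_ * _); exact: beta_tr.
have -> : beta (g ** f) x - beta f (g ** x) =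
   D (rcl (g ** f) - rcl (combination l f)) (rcl x) +
   D (rcl f) (rcl (combination l x) - rcl (g ** x)).
  rewrite (dual_sub _ _ (derivation_dual2 _)) (dual_sub _ _ (derivation_dual1 _)).
  by rewrite E addrA subrK.
apply: (le_trans (le_normcD _ _)).
apply: (@le_trans _ _ (d * k)).
  rewrite /k mulrCA mulrDr mulrDr lerD//.
    apply: le_trans (HM _ _) _; rewrite -mulrA ler_wpM2l//.
    by rewrite !mulrA ler_wpM2r ?nr_ge0.
  apply: le_trans (HM _ _) _; rewrite -mulrA ler_wpM2l//.
  by rewrite mulrCA ler_wpM2l ?nr_ge0// mulrA.
by rewrite /d mulrAC ler_pdivrMr// ler_pM2l// lerDl.
Qed.

(** With [beta_conv], two of the three terms of the Leibniz rule cancel; the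
remaining one is beta at products, which approximate everything. *)
Let beta0 g h : Cc g -> Cc h -> beta g h = 0.
Proof.
move=> Cg Ch.
have H3 b c f : Cc b -> Cc c -> Cc f -> beta g (b ** c ** f) = 0.
  move=> Cb Cc_ Cf; have Cx := Ccc Cb Cc_.
  have := leibniz Cf Cg Cx; rewrite cC// beta_conv//.
  by move=> /eqP; rewrite -subr_eq subrr eq_sym => /eqP.
have H2 b c : Cc b -> Cc c -> beta g (b ** c) = 0.
  move=> Cb Cc_; apply: (dual_zero_closed (derivation_dual1 _)) => e e0.
  have [f Cf Hf] := approx_id hG lcG cgG haar w p1 (Ccc Cb Cc_) e0.
  by exists (rcl (b ** c ** f)) => //; exact: H3.
apply: (dual_zero_closed (derivation_dual1 _)) => e e0.
have [f Cf Hf] := approx_id hG lcG cgG haar w p1 Ch e0.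
by exists (rcl (h ** f)) => //; exact: H2.
Qed.

Lemma derivation_vanish (x y : A) : D x y = 0.
Proof.
apply: (dual_dense hG lcG cgG haar (derivation_dual2 y)) => g Cg.
apply: (dual_dense hG lcG cgG haar (derivation_dual1 _)) => h Ch.
exact: beta0.
Qed.

End vanishing.

End derivation.

Section hom_tilde_bound.
Context {R : realType} {G : topologicalZmodType}.
Local Notation B := (borel_type G).
Variable mu : {measure set B -> \bar R}.
Hypothesis hG : hausdorff_space G.
Hypothesis lcG : locally_compact [set: G].
Hypothesis haar : haar_measure mu.
Variable w : weight mu.
Implicit Types (xi : G -> R[i]) (s t : G).

Lemma continuous_Re xi : continuous (xi : G -> R[i]^o) ->
  continuous (fun s => complex.Re (xi s)).
Proof.
move=> cxi s0; apply/cvgrPdist_lt => e e0.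
have /cvgrPdist_lt/(_ e%:C) := cxi s0; rewrite ltcR => /(_ e0).
apply: filterS => s; rewrite [X in X < _](_ : _ = (normc (xi s0 - xi s))%:C)// ltcR.
apply: le_lt_trans; apply: le_trans (normc_Re _).
by case: (xi s0) => ? ?; case: (xi s).
Qed.

Lemma continuous_Im xi : continuous (xi : G -> R[i]^o) ->
  continuous (fun s => complex.Im (xi s)).
Proof.
move=> cxi s0; apply/cvgrPdist_lt => e e0.
have /cvgrPdist_lt/(_ e%:C) := cxi s0; rewrite ltcR => /(_ e0).
apply: filterS => s; rewrite [X in X < _](_ : _ = (normc (xi s0 - xi s))%:C)// ltcR.
apply: le_lt_trans; apply: le_trans (normc_Im _).
by case: (xi s0) => ? ?; case: (xi s).
Qed.

Let ww s := w s * w (- s).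

Let ww_gt0 s : 0 < ww s.
Proof. by rewrite mulr_gt0// weight_gt0. Qed.

Let hom_tildeE xi s : hom_tilde w xi s = xi s * ((ww s)^-1)%:C.
Proof. by rewrite /hom_tilde fmorphV. Qed.

Lemma normc_hom_tilde xi s : normc (hom_tilde w xi s) = normc (xi s) / ww s.
Proof. by rewrite hom_tildeE Normc.normcM normc_real gtr0_norm ?invr_gt0. Qed.

Lemma hom_tilde_bounded xi (M : R) : continuous (xi : G -> R[i]^o) ->
  (forall s, normc (xi s) <= M * (w s * w (- s))) -> cLp mu +oo (hom_tilde w xi).
Proof.
move=> cxi xiM.
have mww : measurable_fun [set: B] (ww : B -> R).
  apply: measurable_funM; first exact: weight_measurable.
  by apply: (measurableT_comp (weight_measurable w)); exact: measurable_opp.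
have mV : measurable_fun [set: B] (fun s : B => (ww s)^-1).
  rewrite (_ : (fun s => _) = fun s : B => ww s `^ (-1)); last first.
    by apply/funext => s; rewrite powR_inv1// ltW.
  exact: (measurableT_comp (measurable_powR (-1))).
split.
  split.
    rewrite (_ : (fun s => _) = fun s : B => complex.Re (xi s) * (ww s)^-1).
      by apply: measurable_funM => //; apply: continuous_borel; exact: continuous_Re.
    by apply/funext => s; rewrite hom_tildeE; case: (xi s) => a b /=; rewrite mulr0 subr0.
  rewrite (_ : (fun s => _) = fun s : B => complex.Im (xi s) * (ww s)^-1).
    by apply: measurable_funM => //; apply: continuous_borel; exact: continuous_Im.
  by apply/funext => s; rewrite hom_tildeE; case: (xi s) => a b /=; rewrite mulr0 add0r.
rewrite /finite_norm unlock; case: ifPn => // _.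
apply: (@le_lt_trans _ _ M%:E); last by rewrite ltry.
apply/ess_supP/aeW => s /=.
rewrite lee_fin ger0_norm; last by rewrite normcE_sqrt sqrtr_ge0.
by rewrite normc_hom_tilde ler_pdivrMr.
Qed.

Lemma hom_tilde_ae_bound xi : cLp mu +oo (hom_tilde w xi) -> exists2 M : R, 0 <= M &
  {ae mu, forall s : B, normc (xi s) <= M * (w (s : G) * w (- (s : G)))}.
Proof.
move=> [_]; rewrite /finite_norm unlock.
have muT : (0 < mu [set: B])%E.
  by apply: (haar_open haar); [exact: openT|exists 0].
rewrite muT => Hfin.
set e := ess_sup mu _ in Hfin.
exists `|fine e|; first exact: normr_ge0.
have := ess_sup_ge mu (abse \o (EFin \o (fun x => normc (hom_tilde w xi x)))).
apply: filterS => s /=; rewrite -/e => He.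
have efin : e \is a fin_num.
  rewrite fin_numE; apply/andP; split; last by rewrite -ltey.
  by apply/eqP => eN; rewrite eN in He.
rewrite -(fineK efin) lee_fin normc_hom_tilde in He.
rewrite ger0_norm in He; last first.
  by rewrite mulr_ge0 ?invr_ge0 ?(ltW (ww_gt0 _))// normcE_sqrt sqrtr_ge0.
rewrite ler_pdivrMr// in He; apply: le_trans He _.
by rewrite ler_wpM2r ?(ltW (ww_gt0 _))// ler_norm.
Qed.

End hom_tilde_bound.

Section derivation_hom.
Context {R : realType} {G : topologicalZmodType}.
Local Notation B := (borel_type G).
Variable mu : {measure set B -> \bar R}.
Hypothesis hG : hausdorff_space G.
Hypothesis lcG : locally_compact [set: G].
Hypothesis cgG : compactly_generated G.
Hypothesis haar : haar_measure mu.
Variables (w : weight mu) (p : R) (p1 : 1 <= p).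
Local Notation A := (Lpw w p1).
Variable mul : A -> A -> A.
Hypothesis mul_conv : is_convolution mul.

Lemma derivation_hom (D : A -> (A -> R[i]^o)) x y :
  bounded_derivation mul D -> D x y <> 0 ->
  exists xi : G -> R[i], [/\ continuous_hom xi, xi <> (fun=> 0) &
    cLp mu +oo (hom_tilde w xi)].
Proof.
move=> derD; apply: contra_notP => Hno.
apply: (derivation_vanish hG lcG cgG haar mul_conv derD) => a b c s Ca Cb Cc_.
apply: contrapT => xis; apply: Hno; exists (xi D a b c); split.
- split; first exact: (xi_additive hG lcG cgG haar mul_conv derD).
  exact: (xi_continuous hG lcG cgG haar mul_conv derD).
- by move=> E; apply: xis; rewrite E.
have [M _ HM] := xi_bounded hG lcG cgG haar derD Ca Cb Cc_.
apply: (hom_tilde_bounded _ HM).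
exact: (xi_continuous hG lcG cgG haar mul_conv derD).
Qed.

(** Commutativity makes the left and right actions on the dual equal. *)
Lemma inner_derivation_eq0 (D : A -> (A -> R[i]^o)) x y :
  inner_derivation mul D -> D x y = 0.
Proof.
move=> [phi _ ->].
rewrite -[LHS]/(phi (mul y x) - phi (mul x y)).
by rewrite (mul_comm hG lcG cgG haar mul_conv) subrr.
Qed.

Lemma no_hom_weakly_amenable :
  ~ (exists xi : G -> R[i], [/\ continuous_hom xi, xi <> (fun=> 0) &
    cLp mu +oo (hom_tilde w xi)]) -> weakly_amenable mul.
Proof.
move=> noxi D derD; exists (fun=> 0).
  split; first by move=> k x y; rewrite scaler0 addr0.
  by exists 0 => x; rewrite normr0 mul0r.
move=> x; apply/funext => y.
rewrite [RHS](_ : _ = (0 : R[i]) - 0)// subr0.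
by apply: contrapT => /(derivation_hom derD).
Qed.

End derivation_hom.

(** * A bounded bilinear form attached to a homomorphism *)

Section kernel.
Context {R : realType} {G : topologicalZmodType}.
Local Notation B := (borel_type G).
Variable mu : {measure set B -> \bar R}.
Hypothesis hG : hausdorff_space G.
Hypothesis lcG : locally_compact [set: G].
Hypothesis cgG : compactly_generated G.
Hypothesis haar : haar_measure mu.
Variables (w : weight mu) (p : R) (p1 : 1 <= p).
Implicit Types (u v f g : G -> R) (s t : G).

Variables (k eta h : G -> R) (c0 : R).
Hypothesis Ck : Cc k.
Hypothesis k0 : forall x, 0 <= k x.
Hypothesis ceta : continuous eta.
Hypothesis mh : measurable_fun [set: B] (h : B -> R).
Hypothesis h0 : forall x, 0 <= h x.
Hypothesis ih : (\int[mu]_x (h x)%:E < +oo)%E.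
Hypothesis c00 : 0 <= c0.
Hypothesis Hbound : {ae mu, forall t : B, forall a b : R, 0 <= a -> 0 <= b ->
  `|eta t| / (w t * w (- (t : G))) * (a * b) <=
  c0 * (a `^ p + b `^ p + a `^ p * b `^ p + h t)}.

Let p0 : 0 < p. Proof. by rewrite (lt_le_trans _ p1). Qed.

Definition rLp u := measurable_fun [set: B] (u : B -> R) /\ rfun u \in Lpw_pred w p1.

(** The p-th power of the norm, the quantity that the pointwise inequality of
[Hbound] produces under the integral. *)
Definition mass u : R := fine (\int[mu]_s ((`|u s| * w s) `^ p)%:E)%E.

Let pw u (s : B) : R := (`|u s| * w s) `^ p.

Let pw_ge0 u s : 0 <= pw u s. Proof. exact: powR_ge0. Qed.

Let mpw u : measurable_fun [set: B] (u : B -> R) -> measurable_fun [set: B] (pw u).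
Proof.
move=> mu_; apply: (measurableT_comp (measurable_powR p)).
apply: measurable_funM; last exact: weight_measurable.
exact: measurableT_comp.
Qed.

Let LnormE u : Lpw_norm w p (rfun u) = ((\int[mu]_s (pw u s)%:E) `^ p^-1)%E.
Proof.
rewrite /Lpw_norm unlock.
apply: (congr1 (fun I => I `^ p^-1)%E).
apply: eq_integral => s _; rewrite normc_weighted /=.
by rewrite ger0_norm// mulr_ge0// ltW// weight_gt0.
Qed.

Let pw_fin u : rLp u -> (\int[mu]_s (pw u s)%:E < +oo)%E.
Proof.
move=> [mu_ Hu]; have : (Lpw_norm w p (rfun u) < +oo)%E by move: Hu; rewrite inE => -[].
rewrite LnormE !ltey; apply: contra_neq => ->.
by rewrite poweRyr// invr_eq0 gt_eqF.
Qed.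

Let int_ge0 (f : B -> R) : (forall s, 0 <= f s) -> (0 <= \int[mu]_s (f s)%:E)%E.
Proof. by move=> f0; apply: integral_ge0 => s _; rewrite lee_fin. Qed.

Let massE u : rLp u -> ((mass u)%:E = \int[mu]_s (pw u s)%:E)%E.
Proof.
move=> Hu; rewrite fineK// ge0_fin_numE; first exact: pw_fin.
by apply: int_ge0; exact: pw_ge0.
Qed.

Lemma mass_ge0 u : 0 <= mass u.
Proof. by apply/fine_ge0/int_ge0; exact: pw_ge0. Qed.

Lemma mass_le1 u : rLp u -> (Lpw_norm w p (rfun u) <= 1)%E -> mass u <= 1.
Proof.
move=> Hu; rewrite LnormE -massE// /= lee_fin => H.
have E : mass u = (mass u `^ p^-1) `^ p.
  by rewrite -powRrM mulVf ?gt_eqF// powRr1// mass_ge0.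
have -> : 1 = 1 `^ p :> R by rewrite powR1.
rewrite E.
by apply: ge0_ler_powR; rewrite ?nnegrE ?powR_ge0 ?(ltW p0).
Qed.

Let mk2 : measurable_fun [set: B * B] (fun z : B * B => k ((z.2 : G) + (z.1 : G))).
Proof.
have [ck _] := Ck.
suff : continuous (fun z : G * G => k (z.2 + z.1)).
  by move=> H; exact: (continuous_prod_borel cgG H).
by apply: continuous_comp_add => //; [exact: continuous_snd|exact: continuous_fst].
Qed.

Let m1 (f : B -> R) : measurable_fun [set: B] f ->
  measurable_fun [set: B * B] (fun z : B * B => f z.1).
Proof. by move=> mf; exact: (measurableT_comp mf measurable_fst). Qed.

Let m2 (f : B -> R) : measurable_fun [set: B] f ->
  measurable_fun [set: B * B] (fun z : B * B => f z.2).
Proof. by move=> mf; exact: (measurableT_comp mf measurable_snd). Qed.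

Let J : R := \int[mu]_s k s.

Let mk : measurable_fun [set: B] (k : B -> R).
Proof. by apply: continuous_borel; have [] := Ck. Qed.

Let J0 : 0 <= J. Proof. by apply: Rintegral_ge0 => s _. Qed.

Let JE t : (\int[mu]_s (k ((s : G) + t))%:E = J%:E)%E.
Proof.
have -> : (J%:E = \int[mu]_s (k s)%:E)%E.
  rewrite /J /Rintegral fineK//; apply: integrable_fin_num => //.
  exact: Cc_integrable.
apply: (ge0_integral_preserving (measurable_translate t) (haar_translate haar t)
   (f := fun s : B => (k s)%:E)); first exact/measurable_EFinP.
by move=> s; rewrite lee_fin.
Qed.

Let kM : exists2 M : R, 0 <= M & forall x, k x <= M.
Proof.
have [M M0 HM] := Cc_bounded Ck; exists M => // x.
exact: le_trans (ler_norm _) (HM x).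
Qed.

Let EFin_integralZl (a : R) (f : B -> R) : 0 <= a -> measurable_fun [set: B] f ->
  (forall s, 0 <= f s) -> (\int[mu]_s (a * f s)%:E = a%:E * \int[mu]_s (f s)%:E)%E.
Proof.
move=> a0 mf f0; under eq_integral do rewrite EFinM.
by rewrite ge0_integralZl//; [exact/measurable_EFinP|move=> s _; rewrite lee_fin].
Qed.

(** By invariance [k (s + t)] has integral J over s, whatever t is. *)
Let dbl1 (a : B -> R) : measurable_fun [set: B] a -> (forall s, 0 <= a s) ->
  (\int[mu]_t \int[mu]_s (a t * k ((s : G) + (t : G)))%:E = J%:E * \int[mu]_t (a t)%:E)%E.
Proof.
move=> ma a0; rewrite -EFin_integralZl//; apply: eq_integral => t _.
rewrite EFin_integralZl//; last exact: (measurableT_comp mk (measurable_translate t)).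
by rewrite JE -EFinM mulrC.
Qed.

(** The same in the other variable, after Tonelli. *)
Let dbl2 (b : B -> R) : measurable_fun [set: B] b -> (forall s, 0 <= b s) ->
  (\int[mu]_t \int[mu]_s (b s * k ((s : G) + (t : G)))%:E = J%:E * \int[mu]_t (b t)%:E)%E.
Proof.
move=> mb b0; rewrite -(dbl1 mb b0).
rewrite (haar_tonelli hG cgG haar
  (F := fun z : B * B => (b z.2 * k ((z.2 : G) + (z.1 : G)))%:E)); last 2 first.
- by apply/measurable_EFinP; apply: measurable_funM => //; exact: m2.
- by move=> z; rewrite lee_fin mulr_ge0.
by apply: eq_integral => s _; apply: eq_integral => t _; rewrite /= addrC.
Qed.

Let section (f : B * B -> R) (t : B) : measurable_fun [set: B * B] f ->
  measurable_fun [set: B] (fun s => f (t, s)).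
Proof. by move=> mf; exact: (measurableT_comp mf (pair1_measurable t)). Qed.

Let outer (f : B * B -> R) : measurable_fun [set: B * B] f -> (forall z, 0 <= f z) ->
  measurable_fun [set: B] (fun t => \int[mu]_s (f (t, s))%:E)%E.
Proof.
move=> mf f0; apply: (haar_measurable_tonelli hG cgG haar (F := EFin \o f)).
  exact/measurable_EFinP.
by move=> z; rewrite lee_fin.
Qed.

Let dblD (f g : B * B -> R) :
  measurable_fun [set: B * B] f -> (forall z, 0 <= f z) ->
  measurable_fun [set: B * B] g -> (forall z, 0 <= g z) ->
  (\int[mu]_t \int[mu]_s (f (t, s) + g (t, s))%:E =
   \int[mu]_t \int[mu]_s (f (t, s))%:E + \int[mu]_t \int[mu]_s (g (t, s))%:E)%E.
Proof.
move=> mf f0 mg g0.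
have E t : (\int[mu]_s (f (t, s) + g (t, s))%:E =
    \int[mu]_s (f (t, s))%:E + \int[mu]_s (g (t, s))%:E)%E.
  under eq_integral do rewrite EFinD.
  apply: ge0_integralD => //.
  - by move=> s _; rewrite lee_fin.
  - by apply/measurable_EFinP; exact: section.
  - by move=> s _; rewrite lee_fin.
  - by apply/measurable_EFinP; exact: section.
under eq_integral do rewrite E.
apply: ge0_integralD => //.
- by move=> t _; apply: int_ge0.
- exact: outer.
- by move=> t _; apply: int_ge0.
- exact: outer.
Qed.

Let dbl_le (f g : B * B -> R) :
  measurable_fun [set: B * B] f -> (forall z, 0 <= f z) ->
  measurable_fun [set: B * B] g ->
  {ae mu, forall t : B, forall s, f (t, s) <= g (t, s)} -> (forall z, 0 <= g z) ->
  (\int[mu]_t \int[mu]_s (f (t, s))%:E <= \int[mu]_t \int[mu]_s (g (t, s))%:E)%E.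
Proof.
move=> mf f0 mg fg g0; apply: ae_ge0_le_integral => //.
- by move=> t _; apply: int_ge0.
- exact: outer.
- by move=> t _; apply: int_ge0.
- exact: outer.
apply: filterS fg => t ft _; apply: ge0_le_integral => //.
- by move=> s _; rewrite lee_fin.
- by apply/measurable_EFinP; exact: section.
- by apply/measurable_EFinP; exact: section.
by move=> s _; rewrite lee_fin.
Qed.

Let dbl_bound (a b : B -> R) M : measurable_fun [set: B] a -> (forall s, 0 <= a s) ->
  measurable_fun [set: B] b -> (forall s, 0 <= b s) -> 0 <= M -> (forall x, k x <= M) ->
  (\int[mu]_t \int[mu]_s ((a t + b s + a t * b s) * k ((s : G) + (t : G)))%:E <=
   J%:E * \int[mu]_t (a t)%:E + J%:E * \int[mu]_t (b t)%:E +
   M%:E * \int[mu]_t (a t)%:E * \int[mu]_t (b t)%:E)%E.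
Proof.
move=> ma a0 mb b0 M0 HM.
pose f1 (z : B * B) := a z.1 * k ((z.2 : G) + (z.1 : G)).
pose f2 (z : B * B) := b z.2 * k ((z.2 : G) + (z.1 : G)).
pose f3 (z : B * B) := M * a z.1 * b z.2.
have mf1 : measurable_fun [set: B * B] f1 by apply: measurable_funM => //; exact: m1.
have mf2 : measurable_fun [set: B * B] f2 by apply: measurable_funM => //; exact: m2.
have mf3 : measurable_fun [set: B * B] f3.
  by apply: measurable_funM; [apply: measurable_funM => //; exact: m1|exact: m2].
have f10 z : 0 <= f1 z by rewrite mulr_ge0.
have f20 z : 0 <= f2 z by rewrite mulr_ge0.
have f30 z : 0 <= f3 z by rewrite !mulr_ge0.
pose f12 z := f1 z + f2 z.
have mf12 : measurable_fun [set: B * B] f12 by exact: measurable_funD.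
have f120 z : 0 <= f12 z by rewrite addr_ge0.
pose g (z : B * B) := (a z.1 + b z.2 + a z.1 * b z.2) * k ((z.2 : G) + (z.1 : G)).
have mg : measurable_fun [set: B * B] g.
  apply: measurable_funM => //; apply: measurable_funD.
    by apply: measurable_funD; [exact: m1|exact: m2].
  by apply: measurable_funM; [exact: m1|exact: m2].
have g0 z : 0 <= g z by rewrite mulr_ge0// !addr_ge0// mulr_ge0.
apply: (@le_trans _ _ (\int[mu]_t \int[mu]_s (f12 (t, s) + f3 (t, s))%:E)%E).
  apply: (dbl_le (f := g) (g := fun z => f12 z + f3 z)) => //.
  - exact: measurable_funD.
  - apply: aeW => t s; rewrite /g /f12 /f1 /f2 /f3 /= !mulrDl lerD2l mulrC mulrA.
    by rewrite -!mulrA ler_wpM2r// mulr_ge0.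
  - by move=> z; rewrite addr_ge0.
rewrite dblD// dblD// /f1 /f2 /f3 /= dbl1// dbl2// leeD2l//.
rewrite -EFin_integralZl//.
have Ma0 t : 0 <= M * a t by rewrite mulr_ge0.
have mMa : measurable_fun [set: B] (fun t => M * a t) by exact: measurable_funM.
rewrite (eq_integral (fun t : B => (M * a t)%:E * \int[mu]_s (b s)%:E)%E); last first.
  by move=> t _; rewrite -EFin_integralZl.
rewrite ge0_integralZr//.
- exact/measurable_EFinP.
- by move=> t _; rewrite lee_fin.
- exact: int_ge0.
Qed.

(** On the support of k the point [s + t] ranges over a compact set, and
[- t = s - (s + t)]: this converts the factor [w (- t)] of [Hbound] into the
factor [w s] that goes with v. *)
Let weight_kernel : exists2 W : R, 0 <= W & forall s t,
  k (s + t) * w (- t) <= W * w s * k (s + t).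
Proof.
have [_ [K cK kK]] := Ck; have [C C0 Csub] := weight_submul w.
have [M M0 HM] := weight_compact_bounded hG lcG cgG haar w (compact_opp cK).
exists (C * M); first by rewrite mulr_ge0// ltW.
move=> s t; have [Kst|nK] := pselect (K (s + t)); last by rewrite kK// mul0r mulr0.
rewrite [leRHS]mulrC ler_wpM2l//.
have := Csub s (- (s + t)); rewrite opprD addrA subrr add0r => /le_trans; apply.
rewrite mulrAC ler_wpM2r ?(ltW (weight_gt0 w _))// ler_wpM2l// ?(ltW C0)//.
by rewrite -opprD HM//= opprK.
Qed.

Let ler_1powR (x : R) : 0 <= x -> x <= 1 + x `^ p.
Proof.
move=> x0; have [x1|/ltW x1] := leP x 1; first by rewrite (le_trans x1)// lerDl powR_ge0.
by rewrite (le_trans (le1r_powR x1 p1))// lerDr.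
Qed.

Definition kf v t : R := \int[mu]_s (v s * k ((s : G) + t)).

(** The form [kform] is not symmetric: the factor eta goes with the first
argument only, and this is what makes it a derivation. *)
Definition kform u v : R := \int[mu]_t (u t * eta t * kf v t).

Let integrable_pw u : rLp u -> mu.-integrable [set: B] (fun s => (pw u s)%:E).
Proof.
move=> Hu; apply/integrableP; split; first by apply/measurable_EFinP; apply: mpw; case: Hu.
under eq_integral do rewrite gee0_abs ?lee_fin//.
exact: pw_fin.
Qed.

Lemma inner_integrable v t : rLp v ->
  mu.-integrable [set: B] (fun s : B => (v s * k ((s : G) + t))%:E).
Proof.
move=> Hv; have [mv _] := Hv; have [W W0 HW] := weight_kernel; have [M M0 HM] := kM.
have wt := weight_gt0 w (- t).
have I1 : mu.-integrable [set: B] (fun s : B => (k ((s : G) + t))%:E).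
  by apply: (Cc_integrable hG haar (f := fun s => k (s + t))); exact: Cc_translate.
have I2 : mu.-integrable [set: B]
    (fun s : B => (W / w (- t))%:E * ((k ((s : G) + t))%:E + M%:E * (pw v s)%:E))%E.
  apply: integrableZl => //; apply: integrableD => //.
  by apply: integrableZl => //; exact: integrable_pw.
apply: le_integrable I2 => //.
  apply/measurable_EFinP; apply: measurable_funM => //.
  exact: (measurableT_comp mk (measurable_translate t)).
move=> s _; rewrite [X in (_ <= `|X|)%E](_ : _ =
  (W / w (- t) * (k ((s : G) + t) + M * pw v s))%:E)// !abse_EFin lee_fin.
rewrite [leRHS]ger0_norm; last first.
  by rewrite mulr_ge0 ?divr_ge0 ?(ltW wt)// addr_ge0 ?k0// mulr_ge0.
rewrite normrM (ger0_norm (k0 _)) mulrAC ler_pdivlMr//.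
pose V := `|v s| * w s.
have V0 : 0 <= V by rewrite mulr_ge0// ltW// weight_gt0.
apply: (@le_trans _ _ (W * (V * k (s + t)))).
  rewrite -mulrA.
  apply: (@le_trans _ _ (`|v s| * (W * w s * k (s + t)))); first by rewrite ler_wpM2l.
  by rewrite le_eqVlt; apply/orP; left; apply/eqP; rewrite /V; ring.
rewrite ler_wpM2l//.
apply: (@le_trans _ _ ((1 + V `^ p) * k (s + t))).
  by rewrite ler_wpM2r// ler_1powR.
by rewrite mulrDl mul1r lerD2l mulrC ler_wpM2r// powR_ge0.
Qed.

Let F u v (z : B * B) : R := u z.1 * eta z.1 * (v z.2 * k ((z.2 : G) + (z.1 : G))).

Let meta : measurable_fun [set: B] (eta : B -> R).
Proof. exact: continuous_borel. Qed.

Let mF u v : rLp u -> rLp v -> measurable_fun [set: B * B] (F u v).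
Proof.
move=> [mu_ _] [mv _]; apply: measurable_funM.
  by apply: measurable_funM; [exact: m1|exact: m1].
by apply: measurable_funM => //; exact: m2.
Qed.

Let H : R := fine (\int[mu]_x (h x)%:E)%E.

Let HE : (H%:E = \int[mu]_x (h x)%:E)%E.
Proof. by rewrite fineK// ge0_fin_numE// int_ge0. Qed.

Let bound_arith (j m c x y : R) : 0 <= j -> 0 <= m -> 0 <= c -> 0 <= x -> 0 <= y ->
  j * (x + c) + j * y + m * (x + c) * y <=
  (j * (1 + c) + j + m * (1 + c)) * ((1 + x) * (1 + y)).
Proof.
move=> j0 m0 c0' x0 y0; rewrite -subr_ge0.
rewrite (_ : _ - _ = j * (2 + x + y + 2 * (x * y)) + j * c * (x + y + x * y) +
  m * (1 + x + y) + m * c * (1 + x + x * y)); last by ring.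
by rewrite !addr_ge0// !mulr_ge0// !addr_ge0// !mulr_ge0.
Qed.

(** Multiplying [Hbound] by [k (s + t)] and integrating: the terms that depend
on one variable are controlled by the integral of k, the product term by a
bound of k. *)
Lemma kernel_bound : exists2 C : R, 0 <= C & forall u v, rLp u -> rLp v ->
  (\int[mu]_t \int[mu]_s `|u t * eta t * (v s * k ((s : G) + (t : G)))|%:E <=
   (C * ((1 + mass u) * (1 + mass v)))%:E)%E.
Proof.
have [W W0 HW] := weight_kernel; have [M M0 HM] := kM.
have H0 : 0 <= H by apply/fine_ge0/int_ge0.
have c0W : 0 <= c0 * W by rewrite mulr_ge0.
exists (c0 * W * (J * (1 + H) + J + M * (1 + H))).
  by rewrite mulr_ge0// !addr_ge0// mulr_ge0// addr_ge0.
move=> u v Hu Hv; have [mu_ _] := Hu; have [mv _] := Hv.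
pose a (t : B) := pw u t + h t.
have ma : measurable_fun [set: B] a by apply: measurable_funD => //; exact: mpw.
have a0 t : 0 <= a t by rewrite addr_ge0.
pose g (z : B * B) := (a z.1 + pw v z.2 + a z.1 * pw v z.2) * k ((z.2 : G) + (z.1 : G)).
have mg : measurable_fun [set: B * B] g.
  apply: measurable_funM => //; apply: measurable_funD.
    by apply: measurable_funD; [exact: m1|apply: m2; exact: mpw].
  by apply: measurable_funM; [exact: m1|apply: m2; exact: mpw].
have g0 z : 0 <= g z by rewrite mulr_ge0// !addr_ge0// mulr_ge0.
apply: (@le_trans _ _ (\int[mu]_t \int[mu]_s (c0 * W * g (t, s))%:E)%E).
  apply: (dbl_le (f := fun z => `|F u v z|) (g := fun z => c0 * W * g z)) => //.
  - by apply: measurableT_comp => //; exact: mF.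
  - exact: measurable_funM.
  - apply: filterS Hbound => t Ht s; rewrite /F /g /=.
    have wt := weight_gt0 w t; have wNt := weight_gt0 w (- (t : G)).
    have ws := weight_gt0 w s.
    pose U := `|u t| * w t; pose V := `|v s| * w s.
    have U0 : 0 <= U by rewrite mulr_ge0// ltW.
    have V0 : 0 <= V by rewrite mulr_ge0// ltW.
    set kst := k _.
    have kst0 : 0 <= kst by exact: k0.
    have Hab := Ht U V U0 V0.
    rewrite !normrM (ger0_norm kst0).
    have -> : `|u t| * `|eta t| * (`|v s| * kst) =
       (`|eta t| / (w t * w (- (t : G))) * (U * V)) * ((kst * w (- (t : G))) / w s).
      rewrite /U /V; field.
      by rewrite !gt_eqF.
    have kW : kst * w (- (t : G)) / w s <= W * kst.
      by rewrite ler_pdivrMr// mulrAC; exact: HW.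
    apply: (@le_trans _ _ (c0 * (U `^ p + V `^ p + U `^ p * V `^ p + h t) * (W * kst))).
      apply: ler_pM => //.
        apply: mulr_ge0; last exact: mulr_ge0.
        by apply: divr_ge0 => //; rewrite mulr_ge0// ltW.
      by apply: divr_ge0; rewrite ?mulr_ge0// ltW.
    have -> : c0 * (U `^ p + V `^ p + U `^ p * V `^ p + h t) * (W * kst) =
      c0 * W * ((U `^ p + V `^ p + U `^ p * V `^ p + h t) * kst) by ring.
    rewrite ler_wpM2l// ler_wpM2r// /a -/(pw u t) -/(pw v s) mulrDl.
    rewrite -subr_ge0 (_ : _ - _ = h t * pw v s); last by ring.
    by rewrite mulr_ge0.
  - by move=> z; rewrite mulr_ge0.
have E t : (\int[mu]_s (c0 * W * g (t, s))%:E = (c0 * W)%:E * \int[mu]_s (g (t, s))%:E)%E.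
  by apply: EFin_integralZl => //; exact: section.
under eq_integral do rewrite E.
rewrite ge0_integralZl//; last 2 first.
- exact: (outer mg g0).
- by move=> t _; apply: int_ge0.
have aE : (\int[mu]_t (a t)%:E = (mass u + H)%:E)%E.
  rewrite EFinD massE// HE.
  under eq_integral do rewrite EFinD.
  rewrite ge0_integralD//.
  - by move=> t _; rewrite lee_fin.
  - by apply/measurable_EFinP; exact: mpw.
  - by move=> t _; rewrite lee_fin.
  - exact/measurable_EFinP.
rewrite -[in leRHS]mulrA [in leRHS]EFinM; apply: lee_wpmul2l; first by rewrite lee_fin.
apply: le_trans (dbl_bound ma a0 (mpw mv) (pw_ge0 v) M0 HM) _.
rewrite aE -massE// -!EFinM -!EFinD lee_fin.
exact: (bound_arith J0 M0 H0 (mass_ge0 u) (mass_ge0 v)).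
Qed.

Let section_F u v t : rLp u -> rLp v ->
  (\int[mu]_s (F u v (t, s))%:E = (u t * eta t * kf v t)%:E)%E.
Proof.
move=> Hu Hv; rewrite /kf.
have Iv := inner_integrable t Hv.
rewrite -RintegralZl// /Rintegral fineK//.
by apply: integrable_fin_num => //; exact: (integrableZl measurableT (u t * eta t) Iv).
Qed.

Let F_fin u v : rLp u -> rLp v -> (\int[mu]_t \int[mu]_s `|F u v (t, s)|%:E < +oo)%E.
Proof.
move=> Hu Hv; have [C C0 HC] := kernel_bound.
by apply: le_lt_trans (HC u v Hu Hv) _; rewrite ltry.
Qed.

Lemma kform_integrable u v : rLp u -> rLp v ->
  mu.-integrable [set: B] (fun t : B => (u t * eta t * kf v t)%:E).
Proof.
move=> Hu Hv.
have := haar_integrable_fubini hG cgG haar (mF Hu Hv) (F_fin Hu Hv).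
by apply: eq_integrable => // t _; exact: section_F.
Qed.

Lemma kform_bound : exists2 C : R, 0 <= C & forall u v, rLp u -> rLp v ->
  `|kform u v| <= C * ((1 + mass u) * (1 + mass v)).
Proof.
have [C C0 HC] := kernel_bound; exists C => // u v Hu Hv.
have Hi := kform_integrable Hu Hv.
apply: le_trans (le_normr_Rintegral measurableT Hi) _.
have Habs := integrable_abse Hi.
rewrite -lee_fin /Rintegral fineK; last first.
  apply: integrable_fin_num => //.
apply: le_trans (HC u v Hu Hv); apply: ge0_le_integral => //.
- by case/integrableP : Habs.
- apply: (outer (f := fun z => `|F u v z|)) => //.
  by apply: measurableT_comp => //; exact: mF.
move=> t _; rewrite -abse_EFin -section_F//.
apply: le_trans (le_abse_integral _ _ _) _ => //.
by apply/measurable_EFinP; apply: section; exact: mF.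
Qed.

Lemma kformDl u u' v : rLp u -> rLp u' -> rLp v ->
  kform (fun s => u s + u' s) v = kform u v + kform u' v.
Proof.
move=> Hu Hu' Hv; rewrite -RintegralD//; [|exact: kform_integrable|exact: kform_integrable].
by apply: eq_Rintegral => t _; rewrite !mulrDl.
Qed.

Lemma kformZl (a : R) u v : rLp u -> rLp v ->
  kform (fun s => a * u s) v = a * kform u v.
Proof.
move=> Hu Hv; rewrite -RintegralZl//; last exact: kform_integrable.
by apply: eq_Rintegral => t _; rewrite !mulrA.
Qed.

Lemma kfD v v' t : rLp v -> rLp v' -> kf (fun s => v s + v' s) t = kf v t + kf v' t.
Proof.
move=> Hv Hv'; rewrite -RintegralD//; [|exact: inner_integrable|exact: inner_integrable].
by apply: eq_Rintegral => s _; rewrite mulrDl.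
Qed.

Lemma kfZ (a : R) v t : rLp v -> kf (fun s => a * v s) t = a * kf v t.
Proof.
move=> Hv; rewrite -RintegralZl//; last exact: inner_integrable.
by apply: eq_Rintegral => s _; rewrite mulrA.
Qed.

Lemma kformDr u v v' : rLp u -> rLp v -> rLp v' ->
  kform u (fun s => v s + v' s) = kform u v + kform u v'.
Proof.
move=> Hu Hv Hv'; rewrite -RintegralD//; [|exact: kform_integrable|exact: kform_integrable].
by apply: eq_Rintegral => t _; rewrite kfD// mulrDr.
Qed.

Lemma kformZr (a : R) u v : rLp u -> rLp v ->
  kform u (fun s => a * v s) = a * kform u v.
Proof.
move=> Hu Hv; rewrite -RintegralZl//; last exact: kform_integrable.
by apply: eq_Rintegral => t _; rewrite kfZ// mulrCA.
Qed.

Lemma kform_ae u u' v v' : rLp u -> rLp u' -> rLp v -> rLp v' ->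
  {ae mu, forall s : B, u s = u' s} -> {ae mu, forall s : B, v s = v' s} ->
  kform u v = kform u' v'.
Proof.
move=> Hu Hu' Hv Hv' uu vv.
have kvv t : kf v t = kf v' t.
  rewrite /kf /Rintegral; congr fine; apply: ae_eq_integral => //.
  - by case/integrableP : (inner_integrable t Hv).
  - by case/integrableP : (inner_integrable t Hv').
  - by move: vv; apply: filterS => s vs _; rewrite vs.
rewrite /kform /Rintegral; apply: (congr1 fine); apply: ae_eq_integral => //.
- by case/integrableP : (kform_integrable Hu Hv).
- by case/integrableP : (kform_integrable Hu' Hv').
- by move: uu; apply: filterS => s us _; rewrite us kvv.
Qed.

Local Notation A := (Lpw w p1).
Local Notation rcl := (rcl w p1).
Implicit Types x y z : A.
Hypothesis etaD : {morph eta : s t / s + t}.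

(** * The derivation attached to a homomorphism *)

Let re x : G -> R := fun s => complex.Re (Lpw_repr x s).
Let im x : G -> R := fun s => complex.Im (Lpw_repr x s).

Let rLp_re x : rLp (re x).
Proof.
have [mRe _] := Lpw_measurable (Lpw_repr x); split => //.
by have [] := rfun_dominated (f := Lpw_repr x) (u := re x) mRe (fun s => normc_Re _).
Qed.

Let rLp_im x : rLp (im x).
Proof.
have [_ mIm] := Lpw_measurable (Lpw_repr x); split => //.
by have [] := rfun_dominated (f := Lpw_repr x) (u := im x) mIm (fun s => normc_Im _).
Qed.

Let rLpD u v : rLp u -> rLp v -> rLp (fun s => u s + v s).
Proof.
move=> [mu_ Hu] [mv Hv]; split; first exact: measurable_funD.
by rewrite rfunD; exact: rpredD.
Qed.

Let rLpZ (a : R) u : rLp u -> rLp (fun s => a * u s).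
Proof.
move=> [mu_ Hu]; split; first exact: measurable_funM.
by rewrite rfunZ; exact: rpredZ.
Qed.

Let rLp_Cc u : Cc u -> rLp u.
Proof.
by move=> Cu; split; [apply: continuous_borel; case: Cu|exact: Cc_mem].
Qed.

(** The complexification of [kform]. *)
Definition kder x (y : A) : R[i]^o :=
  (kform (re x) (re y) - kform (im x) (im y)) +i*
  (kform (re x) (im y) + kform (im x) (re y)).

Let evalD x y : {ae mu, forall s : B, Lpw_repr (x + y) s = Lpw_repr x s + Lpw_repr y s}.
Proof.
have := eval_class (Lpw_repr x + Lpw_repr y).
by rewrite Lpw_classD !Lpw_reprK.
Qed.

Let evalZ a x : {ae mu, forall s : B, Lpw_repr (a *: x) s = a * Lpw_repr x s}.
Proof.
have := eval_class (a *: Lpw_repr x).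
by rewrite Lpw_classZ Lpw_reprK.
Qed.

Let aeT (u : G -> R) : {ae mu, forall s : B, u s = u s}.
Proof. exact: aeW. Qed.

Let reD x y : {ae mu, forall s : B, re (x + y) s = re x s + re y s}.
Proof.
apply: filterS (evalD x y) => s; rewrite /re => ->.
by case: (Lpw_repr x s) => ? ?; case: (Lpw_repr y s).
Qed.

Let imD x y : {ae mu, forall s : B, im (x + y) s = im x s + im y s}.
Proof.
apply: filterS (evalD x y) => s; rewrite /im => ->.
by case: (Lpw_repr x s) => ? ?; case: (Lpw_repr y s).
Qed.

Let reZ a x : {ae mu, forall s : B, re (a *: x) s =
  complex.Re a * re x s + (- complex.Im a) * im x s}.
Proof.
apply: filterS (evalZ a x) => s; rewrite /re /im => ->.
by case: a => ? ?; case: (Lpw_repr x s) => ? ? /=; rewrite mulNr.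
Qed.

Let imZ a x : {ae mu, forall s : B, im (a *: x) s =
  complex.Re a * im x s + complex.Im a * re x s}.
Proof.
apply: filterS (evalZ a x) => s; rewrite /re /im => ->.
by case: a => ? ?; case: (Lpw_repr x s).
Qed.

Let cplxD (a b c d a' b' c' d' : R) :
  (a + a' - (d + d')) +i* (c + c' + (b + b')) = ((a - d) +i* (c + b)) + ((a' - d') +i* (c' + b')).
Proof. by apply/eqP; rewrite eq_complex /=; apply/andP; split; apply/eqP; ring. Qed.

Let cplxZl (z : R[i]) (a b c d : R) :
  (complex.Re z * a + - complex.Im z * b - (complex.Re z * d + complex.Im z * c)) +i*
  (complex.Re z * c + - complex.Im z * d + (complex.Re z * b + complex.Im z * a)) =
  z * ((a - d) +i* (c + b)).
Proof.
case: z => zr zi /=; apply/eqP; rewrite eq_complex /=.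
by apply/andP; split; apply/eqP; ring.
Qed.

Let cplxZr (z : R[i]) (a b c d : R) :
  (complex.Re z * a + - complex.Im z * c - (complex.Re z * d + complex.Im z * b)) +i*
  (complex.Re z * c + complex.Im z * a + (complex.Re z * b + - complex.Im z * d)) =
  z * ((a - d) +i* (c + b)).
Proof.
case: z => zr zi /=; apply/eqP; rewrite eq_complex /=.
by apply/andP; split; apply/eqP; ring.
Qed.

Lemma kderDl x y z : kder (x + y) z = kder x z + kder y z.
Proof.
rewrite /kder.
have E v : rLp v -> kform (re (x + y)) v = kform (re x) v + kform (re y) v.
  by move=> Hv; rewrite (kform_ae _ _ Hv Hv (reD x y) (aeT v)) ?kformDl//; exact: rLpD.
have E' v : rLp v -> kform (im (x + y)) v = kform (im x) v + kform (im y) v.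
  by move=> Hv; rewrite (kform_ae _ _ Hv Hv (imD x y) (aeT v)) ?kformDl//; exact: rLpD.
rewrite (E _ (rLp_re z)) (E _ (rLp_im z)) (E' _ (rLp_re z)) (E' _ (rLp_im z));
exact: cplxD.
Qed.

Lemma kderDr x y z : kder x (y + z) = kder x y + kder x z.
Proof.
rewrite /kder.
have E v : rLp v -> kform v (re (y + z)) = kform v (re y) + kform v (re z).
  by move=> Hv; rewrite (kform_ae Hv Hv _ _ (aeT v) (reD y z)) ?kformDr//; exact: rLpD.
have E' v : rLp v -> kform v (im (y + z)) = kform v (im y) + kform v (im z).
  by move=> Hv; rewrite (kform_ae Hv Hv _ _ (aeT v) (imD y z)) ?kformDr//; exact: rLpD.
rewrite (E _ (rLp_re x)) (E _ (rLp_im x)) (E' _ (rLp_re x)) (E' _ (rLp_im x));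
exact: cplxD.
Qed.

Lemma kderZl a x y : kder (a *: x) y = a * kder x y.
Proof.
rewrite /kder.
have E v : rLp v -> kform (re (a *: x)) v =
    complex.Re a * kform (re x) v + (- complex.Im a) * kform (im x) v.
  move=> Hv; rewrite (kform_ae _ _ Hv Hv (reZ a x) (aeT v)); last 2 first.
  - exact: rLp_re.
  - by apply: rLpD; exact: rLpZ.
  by rewrite kformDl ?kformZl//; exact: rLpZ.
have E' v : rLp v -> kform (im (a *: x)) v =
    complex.Re a * kform (im x) v + complex.Im a * kform (re x) v.
  move=> Hv; rewrite (kform_ae _ _ Hv Hv (imZ a x) (aeT v)); last 2 first.
  - exact: rLp_im.
  - by apply: rLpD; exact: rLpZ.
  by rewrite kformDl ?kformZl//; exact: rLpZ.
rewrite (E _ (rLp_re y)) (E _ (rLp_im y)) (E' _ (rLp_re y)) (E' _ (rLp_im y));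
exact: cplxZl.
Qed.

Lemma kderZr a x y : kder x (a *: y) = a * kder x y.
Proof.
rewrite /kder.
have E v : rLp v -> kform v (re (a *: y)) =
    complex.Re a * kform v (re y) + (- complex.Im a) * kform v (im y).
  move=> Hv; rewrite (kform_ae Hv Hv _ _ (aeT v) (reZ a y)); last 2 first.
  - exact: rLp_re.
  - by apply: rLpD; exact: rLpZ.
  by rewrite kformDr ?kformZr//; exact: rLpZ.
have E' v : rLp v -> kform v (im (a *: y)) =
    complex.Re a * kform v (im y) + complex.Im a * kform v (re y).
  move=> Hv; rewrite (kform_ae Hv Hv _ _ (aeT v) (imZ a y)); last 2 first.
  - exact: rLp_im.
  - by apply: rLpD; exact: rLpZ.
  by rewrite kformDr ?kformZr//; exact: rLpZ.
rewrite (E _ (rLp_re x)) (E _ (rLp_im x)) (E' _ (rLp_re x)) (E' _ (rLp_im x));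
exact: cplxZr.
Qed.

Let nr_class_le1 x u : nr x <= 1 -> rLp u ->
  (Lpw_norm w p (rfun u) <= Lpw_norm w p (Lpw_repr x))%E -> mass u <= 1.
Proof.
move=> x1 Hu ux; apply: (mass_le1 Hu); apply: le_trans ux _.
by rewrite -(Lpw_norm_fin (Lpw_valP (Lpw_repr x))) lee_fin.
Qed.

(** The estimate [kform_bound] is not homogeneous; it is used on the unit ball
and extended by scaling. *)
Lemma kder_bounded : exists2 Q : R, 0 <= Q & forall x y, normc (kder x y) <= Q * nr x * nr y.
Proof.
have [C C0 HC] := kform_bound.
have unit_bound x y : nr x <= 1 -> nr y <= 1 -> normc (kder x y) <= 16 * C.
  move=> x1 y1.
  have mre z : nr z <= 1 -> mass (re z) <= 1.
    move=> z1; apply: (nr_class_le1 z1) => //.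
    have [mRe _] := Lpw_measurable (Lpw_repr z).
    by have [] := rfun_dominated (f := Lpw_repr z) (u := re z) mRe (fun s => normc_Re _).
  have mim z : nr z <= 1 -> mass (im z) <= 1.
    move=> z1; apply: (nr_class_le1 z1) => //.
    have [_ mIm] := Lpw_measurable (Lpw_repr z).
    by have [] := rfun_dominated (f := Lpw_repr z) (u := im z) mIm (fun s => normc_Im _).
  have bnd u v : rLp u -> rLp v -> mass u <= 1 -> mass v <= 1 ->
      `|kform u v| <= 4 * C.
    move=> Hu Hv u1 v1; apply: le_trans (HC u v Hu Hv) _; rewrite mulrC ler_wpM2r//.
    have -> : 4 = (1 + 1) * (1 + 1) :> R by ring.
    have mu1 : 0 <= 1 + mass u by rewrite addr_ge0 ?mass_ge0.
    have mv1 : 0 <= 1 + mass v by rewrite addr_ge0 ?mass_ge0.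
    have mu2 : 1 + mass u <= 1 + 1 by exact: (lerD (lexx 1) u1).
    have mv2 : 1 + mass v <= 1 + 1 by exact: (lerD (lexx 1) v1).
    exact: ler_pM mu1 mv1 mu2 mv2.
  apply: le_trans (normc_ReIm _) _ => /=.
  have -> : 16 * C = (4 * C + 4 * C) + (4 * C + 4 * C) by ring.
  have Frr := bnd _ _ (rLp_re x) (rLp_re y) (mre x x1) (mre y y1).
  have Fri := bnd _ _ (rLp_re x) (rLp_im y) (mre x x1) (mim y y1).
  have Fir := bnd _ _ (rLp_im x) (rLp_re y) (mim x x1) (mre y y1).
  have Fii := bnd _ _ (rLp_im x) (rLp_im y) (mim x x1) (mim y y1).
  apply: lerD.
    exact: (le_trans (ler_normB _ _) (lerD Frr Fii)).
  exact: (le_trans (ler_normD _ _) (lerD Fri Fir)).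
(* on the unit ball each of the four values of [kform] is at most 4 * C *)
exists (16 * C); first by rewrite mulr_ge0.
move=> x y.
have nr0 z : nr z = 0 -> z = 0.
  by move=> z0; apply/eqP; rewrite -normr_eq0 nrE z0.
have kder0l z : kder 0 z = 0.
  by rewrite -[X in kder X z](scale0r (0 : A)) kderZl mul0r.
have kder0r z : kder z 0 = 0.
  by rewrite -[X in kder z X](scale0r (0 : A)) kderZr mul0r.
have [/nr0 ->|nx] := eqVneq (nr x) 0.
  by rewrite kder0l Normc.normc0 !mulr_ge0// nr_ge0.
have [/nr0 ->|ny] := eqVneq (nr y) 0.
  by rewrite kder0r Normc.normc0 !mulr_ge0// nr_ge0.
have unit z : nr z != 0 -> nr ((nr z)^-1%:C *: z) <= 1.
  move=> nz; have := normrZ (nr z)^-1%:C z.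
  rewrite !nrE [`|_%:C|](_ : _ = (normc (nr z)^-1%:C)%:C)// normc_real -rmorphM => -[->].
  by rewrite ger0_norm ?invr_ge0 ?nr_ge0// mulVf.
have := unit_bound _ _ (unit x nx) (unit y ny).
rewrite kderZl kderZr !Normc.normcM !normc_real.
rewrite !ger0_norm ?invr_ge0 ?nr_ge0// mulrA -invfM mulrC ler_pdivrMr; last first.
  by rewrite mulr_gt0// lt_def ?nx ?ny nr_ge0.
by rewrite mulrA.
Qed.

Let rcl_re u : Cc u -> {ae mu, forall s : B, re (rcl u) s = u s}.
Proof.
move=> Cu; apply: filterS (eval_rcl (Cc_mem hG lcG cgG haar w p1 Cu)) => s.
by rewrite /re /Lpw_eval => ->.
Qed.

Let rcl_im u : Cc u -> {ae mu, forall s : B, im (rcl u) s = 0 * u s}.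
Proof.
move=> Cu; apply: filterS (eval_rcl (Cc_mem hG lcG cgG haar w p1 Cu)) => s.
by rewrite /im /Lpw_eval => ->; rewrite mul0r.
Qed.

Lemma kder_rcl u v : Cc u -> Cc v -> kder (rcl u) (rcl v) = (kform u v)%:C.
Proof.
move=> Cu Cv; have Hu := rLp_Cc Cu; have Hv := rLp_Cc Cv.
have Hu0 := rLpZ 0 Hu; have Hv0 := rLpZ 0 Hv.
rewrite /kder (kform_ae _ Hu _ Hv (rcl_re Cu) (rcl_re Cv))//.
rewrite (kform_ae _ Hu0 _ Hv0 (rcl_im Cu) (rcl_im Cv))//.
rewrite (kform_ae _ Hu _ Hv0 (rcl_re Cu) (rcl_im Cv))//.
rewrite (kform_ae _ Hu0 _ Hv (rcl_im Cu) (rcl_re Cv))//.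
by rewrite !kformZl// !kformZr// !mul0r subr0 addr0.
Qed.

Let ck : continuous k. Proof. by have [] := Ck. Qed.

Let correlation_continuous g (K : G -> R) : Cc g -> continuous K ->
  continuous (fun t => \int[mu]_r (g r * K ((r : G) + t))).
Proof.
move=> [cg [L cL gL]] cK.
apply: (@Cc_param_continuous _ _ _ hG haar _ (fun z : G * G => g z.2 * K (z.2 + z.1)) L) => //.
  apply: continuous_mul.
    exact: continuous_comp_snd.
  by apply: continuous_comp_add => //; [exact: continuous_snd|exact: continuous_fst].
by move=> t s /gL ->; rewrite mul0r.
Qed.

(** Additivity of e splits the left-hand side. *)
Let leibniz_core f g (e K : G -> R) : Cc f -> Cc g -> continuous e -> {morph e : s t / s + t} ->
  continuous K ->
  \int[mu]_t (f t * \int[mu]_r (g r * (e ((r : G) + (t : G)) * K ((r : G) + (t : G))))) =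
  \int[mu]_t (f t * \int[mu]_r (g r * e r * K ((r : G) + (t : G)))) +
  \int[mu]_t (f t * (e t * \int[mu]_r (g r * K ((r : G) + (t : G))))).
Proof.
move=> Cf Cg ce eD cK.
have Cge : Cc (fun r => g r * e r) by exact: CcMr.
have cKt t : continuous (fun r => K (r + t)) by exact: continuous_translater.
have C1 t : Cc (fun r => g r * e r * K (r + t)) by exact: CcMr.
have C2 t : Cc (fun r => g r * K (r + t)) by exact: CcMr.
have c1 := correlation_continuous Cge cK; have c2 := correlation_continuous Cg cK.
rewrite -RintegralD//; last 2 first.
- by apply: (Cc_integrable hG haar); exact: CcMr.
- by apply: (Cc_integrable hG haar); apply: CcMr => //; exact: continuous_mul.
apply: eq_Rintegral => t _; rewrite -mulrDr; congr (_ * _).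
rewrite -(RintegralZl_Cc hG haar)// -RintegralD//; last 2 first.
- exact: (Cc_integrable hG haar).
- by apply: (Cc_integrable hG haar); exact: CcZ.
apply: eq_Rintegral => r _.
by rewrite eD mulrDl mulrDr mulrA; congr (_ + _); rewrite mulrCA.
Qed.

Let kf_cont g : Cc g -> continuous (kf g).
Proof. by move=> Cg; exact: correlation_continuous. Qed.

Local Notation "u ** v" := (convol mu u v) (at level 40).

Let kf_conv f g t : Cc f -> Cc g ->
  kf (f ** g) t = \int[mu]_u (f u * kf g ((u : G) + t)).
Proof.
move=> Cf Cg.
transitivity (\int[mu]_s (k ((s : G) + t) * convol mu f g s)).
  by apply: eq_Rintegral => s _; rewrite mulrC.
have -> : \int[mu]_s (k ((s : G) + t) * convol mu f g s) =
    \int[mu]_r (f r * \int[mu]_s (g s * k ((s : G) + (r : G) + t))).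
  have C : continuous (fun s => k (s + t)) by apply: continuous_translater.
  exact (conv_int (phi := fun s => k (s + t)) hG cgG haar Cf Cg C).
apply: eq_Rintegral => r _; congr (_ * _); apply: eq_Rintegral => s _.
by rewrite addrA.
Qed.

(** All three terms are rewritten by [conv_int] as integrals against
[f t * g r] of [eta (r + t)], [eta r] and [eta t] times the same function of
r and t. *)
Lemma kform_leibniz f g c : Cc f -> Cc g -> Cc c ->
  kform (f ** g) c = kform g (c ** f) + kform f (g ** c).
Proof.
move=> Cf Cg Cc_.
have ck' := kf_cont Cc_.
have cphi : continuous (fun r => eta r * kf c r) by exact: continuous_mul.
have Cge : Cc (fun r => g r * eta r) by exact: CcMr.
(* each side is an integral against f of integrals against g *)
have L : kform (f ** g) c = \int[mu]_t (f t *
    \int[mu]_r (g r * (eta ((r : G) + (t : G)) * kf c ((r : G) + (t : G))))).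
  rewrite -[RHS](conv_int hG cgG haar Cf Cg cphi).
  by apply: eq_Rintegral => r _; rewrite [RHS]mulrC mulrA.
have R1 : kform g (c ** f) = \int[mu]_t (f t *
    \int[mu]_r (g r * eta r * kf c ((r : G) + (t : G)))).
  rewrite -[RHS](conv_int hG cgG haar Cf Cge ck') (convolC hG lcG cgG haar Cf Cge).
  rewrite [RHS](conv_int hG cgG haar Cge Cf ck').
  rewrite (convolC hG lcG cgG haar Cc_ Cf).
  by apply: eq_Rintegral => t _; rewrite kf_conv.
have R2 : kform f (g ** c) = \int[mu]_t (f t *
    (eta t * \int[mu]_r (g r * kf c ((r : G) + (t : G))))).
  by apply: eq_Rintegral => t _; rewrite (kf_conv t Cg Cc_) mulrA.
rewrite L R1 R2; exact: leibniz_core.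
Qed.

Lemma dual_intro (phi : A -> R[i]^o) (M : R) : linear phi ->
  (forall x, normc (phi x) <= M * nr x) -> dual_space phi.
Proof.
move=> lphi HM; split => //; exists M%:C => x.
by rewrite nrE [`|phi x|](_ : _ = (normc (phi x))%:C)// -rmorphM lecR.
Qed.

Variable mul : A -> A -> A.
Hypothesis mul_conv : is_convolution mul.
Hypothesis mul_ba : banach_algebra mul.

Let mul_bound : exists2 M : R, 0 <= M & forall x y, nr (mul x y) <= M * nr x * nr y.
Proof.
have [C HC] := ba_bounded mul_ba.
exists `|complex.Re C|; first exact: normr_ge0.
move=> x y; have := HC x y; rewrite !nrE -mulrA -rmorphM.
case: C {HC} => c d; rewrite lecE /= => /andP[_].
rewrite mulr0 subr0 => /le_trans; apply.
by rewrite -mulrA ler_wpM2r ?mulr_ge0 ?nr_ge0// ler_norm.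
Qed.

Let kder_linl z : linear (kder ^~ z).
Proof. by move=> a x y; rewrite kderDl kderZl. Qed.

Let kder_linr x : linear (kder x).
Proof. by move=> a y z; rewrite kderDr kderZr. Qed.

(** The failure of the Leibniz rule is a bounded trilinear form that vanishes
on C_c, hence everywhere by density in each variable. *)
Let defect x y z : R[i]^o := kder (mul x y) z - kder y (mul z x) - kder x (mul y z).

Let normcB3 (a b c : R[i]) : normc (a - b - c) <= normc a + normc b + normc c.
Proof.
apply: le_trans (le_normcD _ _) _; rewrite normcN lerD2r.
by apply: le_trans (le_normcD _ _) _; rewrite normcN.
Qed.

Let defect_bound : exists2 M : R, 0 <= M & forall x y z,
  normc (defect x y z) <= M * (nr x * nr y * nr z).
Proof.
have [Q Q0 HQ] := kder_bounded; have [M M0 HM] := mul_bound.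
exists (3 * (Q * M)); first by rewrite !mulr_ge0.
move=> x y z; apply: le_trans (normcB3 _ _ _) _.
have nx := nr_ge0 x; have ny := nr_ge0 y; have nz := nr_ge0 z.
have H1 : normc (kder (mul x y) z) <= Q * (M * nr x * nr y) * nr z.
  by apply: le_trans (HQ _ _) _; rewrite ler_wpM2r// ler_wpM2l.
have H2 : normc (kder y (mul z x)) <= Q * nr y * (M * nr z * nr x).
  by apply: le_trans (HQ _ _) _; rewrite ler_wpM2l// mulr_ge0.
have H3 : normc (kder x (mul y z)) <= Q * nr x * (M * nr y * nr z).
  by apply: le_trans (HQ _ _) _; rewrite ler_wpM2l// mulr_ge0.
have alg (a b c : R) : 3 * (Q * M) * (a * b * c) = Q * (M * a * b) * c +
  Q * b * (M * c * a) + Q * a * (M * b * c) by ring.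
by rewrite alg; exact: (lerD (lerD H1 H2) H3).
Qed.

Let alg3 (a b c d b' c' d' : R[i]) :
  (a * b + b') - (a * c + c') - (a * d + d') = a * (b - c - d) + (b' - c' - d').
Proof. by ring. Qed.

Let defect_dual1 y z : dual_space (fun x => defect x y z).
Proof.
have [M M0 HM] := defect_bound.
apply: (dual_intro (M := M * (nr y * nr z))) => [a x x'|x].
  rewrite /defect (ba_linearl mul_ba) (ba_linearr mul_ba) !kder_linl kder_linr.
  exact: alg3.
by apply: le_trans (HM _ _ _) _; rewrite -!mulrA [nr x * _]mulrC !mulrA.
Qed.

Let defect_dual2 x z : dual_space (fun y => defect x y z).
Proof.
have [M M0 HM] := defect_bound.
apply: (dual_intro (M := M * (nr x * nr z))) => [a y y'|y].
  rewrite /defect (ba_linearl mul_ba) (ba_linearr mul_ba) !kder_linl kder_linr.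
  exact: alg3.
by apply: le_trans (HM _ _ _) _; rewrite -!mulrA [nr z * _]mulrC.
Qed.

Let defect_dual3 x y : dual_space (defect x y).
Proof.
have [M M0 HM] := defect_bound.
apply: (dual_intro (M := M * (nr x * nr y))) => [a z z'|z].
  rewrite /defect (ba_linearl mul_ba) (ba_linearr mul_ba) !kder_linr.
  exact: alg3.
by apply: le_trans (HM _ _ _) _; rewrite mulrA.
Qed.

Let defect0 x y z : defect x y z = 0.
Proof.
apply: (dual_dense hG lcG cgG haar (defect_dual1 y z)) => f Cf.
apply: (dual_dense hG lcG cgG haar (defect_dual2 _ z)) => g Cg.
apply: (dual_dense hG lcG cgG haar (defect_dual3 _ _)) => c Cc_.
have Ccc u v : Cc u -> Cc v -> Cc (u ** v) by move=> Cu Cv; exact: Cc_conv.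
rewrite /defect !(mul_rcl hG lcG cgG haar mul_conv)// !kder_rcl//; try exact: Ccc.
by rewrite kform_leibniz// rmorphD /= addrAC addrK subrr.
Qed.

Lemma kder_derivation : bounded_derivation mul kder.
Proof.
have [Q Q0 HQ] := kder_bounded; split.
- move=> x; apply: (dual_intro (M := Q * nr x)) => [|y]; first exact: kder_linr.
  exact: HQ.
- by move=> a x y; apply/funext => z; exact: kder_linl.
- exists Q%:C => x y; rewrite !nrE [`|kder x y|](_ : _ = (normc (kder x y))%:C)//.
  by rewrite -!rmorphM lecR.
- move=> x y; apply/funext => z.
  rewrite [RHS](_ : _ = kder y (mul z x) + kder x (mul y z))//.
  by have /eqP := defect0 x y z; rewrite /defect -addrA -opprD subr_eq0 => /eqP.
Qed.

(** An inner derivation would be 0. *)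
Lemma kform_not_weakly_amenable f g : Cc f -> Cc g -> kform f g != 0 ->
  ~ weakly_amenable mul.
Proof.
move=> Cf Cg fg /(_ _ kder_derivation) inn.
have := inner_derivation_eq0 hG lcG cgG haar mul_conv (rcl f) (rcl g) inn.
rewrite kder_rcl// => -[] /eqP.
by rewrite (negbTE fg).
Qed.

End kernel.

(** * A criterion, and exponents at most two *)

Section criterion.
Context {R : realType} {G : topologicalZmodType}.
Local Notation B := (borel_type G).
Variable mu : {measure set B -> \bar R}.
Hypothesis hG : hausdorff_space G.
Hypothesis lcG : locally_compact [set: G].
Hypothesis cgG : compactly_generated G.
Hypothesis haar : haar_measure mu.
Variables (w : weight mu) (p : R) (p1 : 1 <= p).
Local Notation A := (Lpw w p1).
Variable mul : A -> A -> A.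
Hypothesis mul_conv : is_convolution mul.
Hypothesis mul_ba : banach_algebra mul.
Implicit Types (eta h : G -> R) (s t : G).

Lemma hom_opp eta t : {morph eta : s t / s + t} -> eta (- t) = - eta t.
Proof.
move=> etaD; have eta0 : eta 0 = 0.
  by apply/(addIr (eta 0)); rewrite -etaD addr0 add0r.
by apply/(addrI (eta t)); rewrite -etaD !subrr eta0.
Qed.

(** The test functions make [kform] explicit: f is a bump where eta is positive
and k is 1 on the sum of the supports, so the form is the product of the
integrals of [f * eta] and g. *)
Lemma hom_not_weakly_amenable eta h c0 : continuous eta -> {morph eta : s t / s + t} ->
  (exists t, eta t <> 0) -> measurable_fun [set: B] (h : B -> R) ->
  (forall s, 0 <= h s) -> (\int[mu]_x (h x)%:E < +oo)%E -> 0 <= c0 ->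
  {ae mu, forall t : B, forall a b : R, 0 <= a -> 0 <= b ->
    `|eta t| / (w t * w (- (t : G))) * (a * b) <=
    c0 * (a `^ p + b `^ p + a `^ p * b `^ p + h t)} ->
  ~ weakly_amenable mul.
Proof.
move=> ceta etaD [t1 /eqP t10] mh h0 ih c00 Hbound.
have [t0 t00] : exists t0, 0 < eta t0.
  have [t1p|] := ltP 0 (eta t1); first by exists t1.
  rewrite le_eqVlt (negbTE t10) /= => t1n.
  by exists (- t1); rewrite hom_opp// oppr_gt0.
have oU : open [set t | 0 < eta t].
  rewrite (_ : [set t | _] = eta @^-1` `]0, +oo[).
    by apply: open_comp; [move=> y _; exact: ceta|exact: interval_open].
  by apply/seteqP; split => t /=; rewrite in_itv/= andbT.
have [f [Cf f01 f1 fU]] := urysohn_compact (R := R) hG lcG (@compact_set1 _ t0) oU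
  (ltac:(by move=> _ ->)).
have [g Cg [g0 Ig]] := Cc_bump hG lcG haar.
have [_ [K cK fK]] := Cf; have [_ [L cL gL]] := Cg.
have [k [Ck k01 k1 _]] := urysohn_compact (R := R) hG lcG (compact_add cL cK) openT
  (@subsetT _ _).
have k0 s : 0 <= k s by have /andP[] := k01 s.
have Cfe : Cc (fun t => f t * eta t) by exact: CcMr.
have Ife : 0 < \int[mu]_t (f t * eta t).
  apply: (Cc_int_gt0 hG haar (x0 := t0)) => // [t|]; last by rewrite f1// mul1r.
  have f0 : 0 <= f t by have /andP[] := f01 t.
  have [etat|etat] := ltP 0 (eta t); first by rewrite mulr_ge0// ltW.
  by rewrite fU ?mul0r//= => /(le_lt_trans etat); rewrite ltxx.
apply: (kform_not_weakly_amenable hG lcG cgG haar Ck k0 ceta mh h0 ih c00 Hbound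
  etaD mul_conv mul_ba Cf Cg).
rewrite (_ : kform _ _ _ _ _ = (\int[mu]_t (f t * eta t)) * \int[mu]_s g s).
  by rewrite mulf_neq0 ?gt_eqF.
rewrite -(RintegralZr_Cc hG haar _ Cfe); apply: eq_Rintegral => t _.
have [Kt|nKt] := pselect (K t); last by rewrite fK// !mul0r.
congr (_ * _); apply: eq_Rintegral => s _.
have [Ls|nLs] := pselect (L s); last by rewrite gL// mul0r.
by rewrite k1 ?mulr1//; exists s => //; exists t.
Qed.

(** If both numbers are at most 1, then [a * b <= b ^ 2 <= b `^ p] for the
larger one, which is where [p <= 2] enters; otherwise raising a number at least
1 to the power p increases it. *)
Lemma mulr_le_powR (a b : R) : p <= 2 -> 0 <= a -> 0 <= b ->
  a * b <= a `^ p + b `^ p + a `^ p * b `^ p.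
Proof.
move=> p2; wlog ab : a b / a <= b => [H|] a0 b0.
  have [/H|/ltW/H] := leP a b; first exact.
  by rewrite mulrC [b `^ p + _]addrC [b `^ p * _]mulrC; exact.
have P := powR_ge0 a p; have Q := powR_ge0 b p; have PQ := mulr_ge0 P Q.
have [b1|/ltW b1] := leP b 1.
  apply: (@le_trans _ _ (b `^ p)); last by rewrite -addrA addrCA lerDl addr_ge0.
  apply: (@le_trans _ _ (b `^ 2)); first by rewrite powR_mulrn// expr2 ler_wpM2r.
  have [->|bn0] := eqVneq b 0; first by rewrite powR0// powR0// gt_eqF// (lt_le_trans _ p1).
  by apply: ger_powR => //; rewrite lt_neqAle eq_sym bn0 b0 b1.
have bp : b <= b `^ p by exact: le1r_powR.
have [a1|/ltW a1] := leP a 1.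
  apply: (@le_trans _ _ b); first by rewrite ler_piMl.
  by apply: le_trans bp _; rewrite -addrA addrCA lerDl addr_ge0.
apply: (@le_trans _ _ (a `^ p * b `^ p)); last by rewrite lerDr addr_ge0.
by apply: ler_pM => //; exact: le1r_powR.
Qed.

Lemma hom_tilde_not_weakly_amenable (xi : G -> R[i]) : p <= 2 -> continuous_hom xi ->
  xi <> (fun=> 0) -> cLp mu +oo (hom_tilde w xi) -> ~ weakly_amenable mul.
Proof.
move=> p2 [xiD cxi] xi0 /(hom_tilde_ae_bound haar)[M M0 HM].
have real_case (eta : G -> R) : continuous eta -> {morph eta : s t / s + t} ->
    (exists t, eta t <> 0) -> (forall t, `|eta t| <= normc (xi t)) -> ~ weakly_amenable mul.
  move=> ceta etaD eta0 etaxi.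
  apply: (hom_not_weakly_amenable ceta etaD eta0
    (h := fun=> 0) (c0 := M)) => //.
    by rewrite integral0_eq.
  apply: filterS HM => t HMt a b a0 b0; rewrite addr0.
  apply: ler_pM; rewrite ?mulr_ge0//; last exact: mulr_le_powR.
    by rewrite invr_ge0 mulr_ge0// ltW// weight_gt0.
  by rewrite ler_pdivrMr ?mulr_gt0 ?weight_gt0//; exact: le_trans (etaxi t) HMt.
have [[t Ret]|Re0] := pselect (exists t, complex.Re (xi t) <> 0).
  apply: (real_case (fun t => complex.Re (xi t))) => [|s s'||s].
  - exact: continuous_Re.
  - by rewrite xiD; case: (xi s); case: (xi s').
  - by exists t.
  - exact: normc_Re.
apply: (real_case (fun t => complex.Im (xi t))) => [|s s'||s].
- exact: continuous_Im.
- by rewrite xiD; case: (xi s) => ? ?; case: (xi s').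
- apply: contra_notP xi0 => Im0; apply/funext => t.
  have {}Re0 : complex.Re (xi t) = 0 by apply: contrapT => H; apply: Re0; exists t.
  have {}Im0 : complex.Im (xi t) = 0 by apply: contrapT => H; apply: Im0; exists t.
  by move: Re0 Im0; case: (xi t) => a b /= -> ->.
- exact: normc_Im.
Qed.

End criterion.

(** * The length function *)

Section length.
Context {R : realType} {G T : topologicalZmodType} {k m : nat}.
Variable phi : structure_iso R G T k m.
Local Notation U := (generating_set phi).
Implicit Types s t : G.

Let inf_natP (A : set nat) n : A n -> A (inf_nat A) /\ (inf_nat A <= n)%N.
Proof.
move=> An; have [j [Aj jmin]] : exists j, A j /\ forall i, A i -> (j <= i)%N.
  have ex : exists n, `[< A n >] by exists n; apply/asboolP.
  exists (ex_minn ex); case: ex_minnP => j /asboolP Aj H; split=> // i Ai.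
  by apply: H; exact/asboolP.
have [] := @xgetPex _ 0%N [set n | A n /\ forall j, A j -> (n <= j)%N]
  (ex_intro _ j (conj Aj jmin)).
by move=> H1 H2; split => //; exact: H2.
Qed.

Lemma group_length_le n s : sumset U n s -> (group_length phi s <= n)%N.
Proof.
rewrite /group_length; case: eqP => // s0 Us; apply: (proj2 (inf_natP _)).
split => //; rewrite lt0n; apply: contra_notN s0 => /eqP n0.
by case: Us => f _ ->; rewrite n0 in f *; rewrite big_ord0.
Qed.

Let phi_sum n (f : 'I_n -> G) : phi (\sum_(i < n) f i) = \sum_(i < n) phi (f i).
Proof.
have phi0 : phi 0 = 0 by apply/(addIr (phi 0)); rewrite -iso_morph !add0r.
exact: (big_morph phi (iso_morph phi) phi0).
Qed.

(** Divide the real coordinates by a large n, spread the integer coordinates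
over n steps of size at most 1, and put the compact component in one step. *)
Lemma sumset_exists s : exists2 n, (0 < n)%N & sumset U n s.
Proof.
case E : (phi s) => [[x z] c].
pose n := maxn (\max_(i < k) Num.bound `|x 0%R i|%R) (\max_(j < m) `|z 0%R j|%N).
have n0 : 0 < n.+1%:R :> R by [].
pose a (i : 'I_n.+1) : 'rV[R]_k := \row_j (x 0 j / n.+1%:R).
pose b (i : 'I_n.+1) : 'rV[int]_m := \row_j (if (i < `|z 0%R j|)%N then sgz (z 0 j) else 0).
pose d (i : 'I_n.+1) : T := if i == ord0 then c else 0.
pose y i := (a i, b i, d i).
exists n.+1 => //; exists (fun i => iso_of phi (y i)).
  move=> i; rewrite /generating_set /= iso_ofK /=; split => j; rewrite mxE.
    rewrite -ltr_norml normrM normfV (gtr0_norm n0) ltr_pdivrMr// mul1r.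
    apply: lt_le_trans (archi_boundP (normr_ge0 _)) _; rewrite ler_nat ltnW// ltnS.
    by rewrite leq_max; apply/orP; left; exact: (leq_bigmax (F := fun i => Num.bound `|x 0 i|)).
  by case: ifP => // _; case: sgzP; rewrite !inE eqxx ?orbT.
apply: (can_inj (iso_toK phi)); rewrite phi_sum E.
under eq_bigr do rewrite iso_ofK.
rewrite [RHS]surjective_pairing [in RHS](surjective_pairing (\sum_i y i).1).
have P1 : (\sum_i y i).1.1 = \sum_i a i.
  by rewrite (big_morph (fun y : 'rV[R]_k * 'rV[int]_m * T => y.1.1) (id1 := 0) (op1 := +%R)).
have P2 : (\sum_i y i).1.2 = \sum_i b i.
  by rewrite (big_morph (fun y : 'rV[R]_k * 'rV[int]_m * T => y.1.2) (id1 := 0) (op1 := +%R)).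
have P3 : (\sum_i y i).2 = \sum_i d i.
  by rewrite (big_morph (fun y : 'rV[R]_k * 'rV[int]_m * T => y.2) (id1 := 0) (op1 := +%R)).
rewrite P1 P2 P3; congr (_, _, _).
- apply/rowP => j; rewrite summxE; under eq_bigr do rewrite mxE.
  by rewrite sumr_const card_ord -[RHS]mulr_natr divfK// gt_eqF.
- apply/rowP => j; rewrite summxE; under eq_bigr do rewrite mxE.
  rewrite -big_mkcond -(big_ord_widen n.+1 (fun=> sgz (z 0 j))); last first.
    rewrite ltnW// ltnS leq_max; apply/orP; right.
    exact: (leq_bigmax (F := fun j => `|z 0%R j|%N)).
  by rewrite sumr_const card_ord -[RHS]mulr_natr natz -intEsg.
- by rewrite big_ord_recl /d eqxx big1 ?addr0.
Qed.

Lemma group_length_sum s : sumset U (group_length phi s) s.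
Proof.
rewrite /group_length; case: eqP => [->|_].
  by exists (fun=> 0) => [[]//|]; rewrite big_ord0.
have [n n0 Us] := sumset_exists s.
by have [[]] := @inf_natP [set n | (0 < n)%N /\ sumset U n s] n (conj n0 Us).
Qed.

Lemma hom_le_length (eta : G -> R) s : {morph eta : s t / s + t} ->
  (forall s, U s -> `|eta s| <= 1) -> `|eta s| <= (group_length phi s)%:R.
Proof.
move=> etaD etaU; have eta0 : eta 0 = 0 by apply/(addIr (eta 0)); rewrite -etaD !add0r.
have [f Uf E] := group_length_sum s; rewrite {1}E (big_morph eta etaD eta0).
apply: le_trans (ler_norm_sum _ _ _) _.
apply: (@le_trans _ _ (\sum_(i < group_length phi s) 1)).
  by apply: ler_sum => i _; exact: etaU.
by rewrite sumr_const card_ord.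
Qed.

Local Notation RZ := ('rV[R]_k * discrete_topology 'rV[int]_m)%type.

Let phi1_continuous : continuous (fun s => (phi s).1 : RZ).
Proof.
move=> s; apply: (@continuous_comp G (RZ * T)%type RZ phi fst).
  exact: iso_to_continuous.
exact: continuous_fst.
Qed.

Let coordR_continuous i : continuous (fun s => (phi s).1.1 0 i).
Proof.
move=> s; apply: (@continuous_comp G _ _ (fun s => (phi s).1.1) (fun x : 'rV[R]_k => x 0 i)).
  apply: (@continuous_comp G RZ _ (fun s => (phi s).1) fst); first exact: phi1_continuous.
  exact: continuous_fst.
exact: coord_continuous.
Qed.

Let coordZ_continuous : continuous (fun s => (phi s).1.2 : discrete_topology 'rV[int]_m).
Proof.
move=> s; apply: (@continuous_comp G RZ _ (fun s => (phi s).1) snd).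
  exact: phi1_continuous.
exact: continuous_snd.
Qed.

Let phi0 : phi 0 = 0.
Proof. by apply/(addIr (phi 0)); rewrite -iso_morph !add0r. Qed.

Let coordZ_near s : \forall t \near s, (phi t).1.2 = (phi s).1.2.
Proof.
exact: (coordZ_continuous (x := s)
  (discrete_set1 ((phi s).1.2 : discrete_topology 'rV[int]_m))).
Qed.

Lemma nbhs_generating_set : nbhs (0 : G) U.
Proof.
have HR : \forall s \near (0 : G), forall i, -1 < (phi s).1.1 0 i < 1.
  apply: filter_forall => i.
  have H : \forall y \near (phi 0).1.1 0 i, -1 < (y : R) < 1.
    rewrite phi0 mxE; have := nbhsx_ballx (0 : R) 1 ltr01.
    by apply: filterS => y; rewrite /ball /= sub0r normrN ltr_norml.
  exact: (coordR_continuous (x := 0) H).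
have HZ : \forall s \near (0 : G), (phi s).1.2 = 0.
  by apply: filterS (coordZ_near 0) => s ->; rewrite phi0.
apply: filterS2 HR HZ => s sR sZ; split => // j.
by rewrite sZ mxE.
Qed.

(** A coordinate of G; there is one since otherwise G would be isomorphic to
the compact group T. *)
Lemma length_hom_exists : compact [set: T] -> ~ compact [set: G] ->
  exists eta : G -> R, [/\ continuous eta, {morph eta : s t / s + t},
    forall s, U s -> `|eta s| <= 1 & exists2 g, U g & 2^-1 <= eta g].
Proof.
move=> cT ncG.
have [k0|k0] := posnP k; last first.
  pose i0 := Ordinal k0; exists (fun s => (phi s).1.1 0 i0); split.
  - exact: coordR_continuous.
  - by move=> s t; rewrite iso_morph /= mxE.
  - by move=> s [H _]; rewrite ler_norml; have /andP[/ltW -> /ltW ->] := H i0.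
  exists (iso_of phi (\row__ 2^-1, 0, 0)); last by rewrite iso_ofK mxE.
  rewrite /generating_set /= iso_ofK; split => j; rewrite mxE//=.
  by apply/andP; split; lra.
have [m0|m0] := posnP m; last first.
  pose j0 := Ordinal m0; exists (fun s => ((phi s).1.2 0 j0)%:~R); split.
  - move=> s; apply/cvgrPdist_lt => e e0; apply: filterS (coordZ_near s) => t ->.
    by rewrite subrr normr0.
  - by move=> s t; rewrite iso_morph /= mxE intrD.
  - by move=> s [_ /(_ j0)]; rewrite !inE => /or3P[]/eqP ->; rewrite ?normrN ?normr0 ?normr1.
  exists (iso_of phi (0, \row__ 1, 0)); last first.
    by rewrite iso_ofK mxE invf_le1// ler1n.
  by rewrite /generating_set /= iso_ofK; split => j; rewrite mxE//= ltrN10 ltr01.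
exfalso; apply: ncG.
rewrite (_ : [set: G] = iso_of phi @` (([set 0] `*` [set 0]) `*` [set: T])); last first.
  apply/seteqP; split => s // _; exists (phi s); last exact: iso_toK.
  split => //; split => /=.
    by apply/rowP => i; have := ltn_ord i; rewrite [X in (_ < X)%N]k0.
  by apply/rowP => i; have := ltn_ord i; rewrite [X in (_ < X)%N]m0.
apply: (@continuous_compact ('rV[R]_k * discrete_topology 'rV[int]_m * T)%type).
  exact: continuous_subspaceT (@iso_of_continuous _ _ _ _ _ phi).
apply: compact_setX => //; apply: compact_setX; exact: compact_set1.
Qed.

End length.

(** * Exponents above two *)

Section pointwise.
Context {R : realType}.
Implicit Types a b c m M e C p q : R.

(** All three factors are at most the maximum M, so the product is at most
[M `^ p]. *)
Lemma powR_mul_le_sum p a b c : 2 <= p -> 0 <= a -> 0 <= b -> 0 <= c ->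
  c `^ (p - 2) * (a * b) <= a `^ p + b `^ p + c `^ p.
Proof.
move=> p2 a0 b0 c0; have p0 : 0 <= p by lra.
pose M := Num.max a (Num.max b c).
have aM : a <= M by rewrite le_max lexx.
have bM : b <= M by rewrite !le_max lexx orbT.
have cM : c <= M by rewrite !le_max lexx !orbT.
have M0 : 0 <= M by exact: le_trans aM.
apply: (@le_trans _ _ (M `^ p)).
  have [M00|Mn0] := eqVneq M 0.
    have -> : a = 0 by apply/le_anti; rewrite a0 -M00 aM.
    by rewrite mul0r mulr0 powR_ge0.
  have -> : M `^ p = M `^ (p - 2) * (M * M).
    by rewrite -expr2 -powR_mulrn// -powRD ?subrK// Mn0 implybT.
  apply: ler_pM; rewrite ?powR_ge0 ?mulr_ge0 ?ler_pM//.
  by apply: ge0_ler_powR; rewrite ?nnegrE ?subr_ge0.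
have [A B D] : [/\ 0 <= a `^ p, 0 <= b `^ p & 0 <= c `^ p] by rewrite !powR_ge0.
have [->|[]->] : M = a \/ M = b \/ M = c.
- by rewrite /M; case: (leP b c) => _; case: leP => _; tauto.
- by rewrite -addrA lerDl addr_ge0.
- by rewrite addrAC lerDr addr_ge0.
- by rewrite lerDr addr_ge0.
Qed.

(** Apply [powR_mul_le_sum] to [c = m `^ (- (p - 1)^-1)], chosen so that
[c `^ p = m `^ (- q)] and [c `^ (p - 2) = m `^ (q - 2)]. *)
Lemma conjugate_weight_bound p q a b m M e C : 2 < p -> p^-1 + q^-1 = 1 ->
  0 <= a -> 0 <= b -> 0 < m -> m <= M -> 0 <= e -> e <= C * m `^ q ->
  e / (m * M) * (a * b) <= C * (a `^ p + b `^ p + m `^ (- q)).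
Proof.
move=> p2 pq a0 b0 m0 mM e0 eC.
have mq0 := powR_gt0 q m0.
have C0 : 0 <= C by rewrite -(pmulr_lge0 _ mq0); exact: le_trans eC.
have pm1 : p - 1 != 0 by rewrite gt_eqF//; lra.
have pn0 : p != 0 by rewrite gt_eqF//; lra.
have qE : q = p / (p - 1).
  have qn0 : q != 0.
    apply/eqP => q0; move: pq; rewrite q0 invr0 addr0 => p1.
    by move: p2; rewrite -(invrK p) p1 invr1; lra.
  have : q * (p - 1) = p.
    have := congr1 (fun x => p * q * x) pq; rewrite mulr1 mulrDr mulfK// mulrAC mulfV// mul1r.
    by move=> E; rewrite mulrBr mulr1 [q * p]mulrC -E addrAC subrr add0r.
  by move=> E; rewrite -[X in _ = X / _]E mulfK.
pose c := m `^ (- (p - 1)^-1).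
have cp : c `^ p = m `^ (- q).
  by rewrite -powRrM mulNr qE mulrC.
have cp2 : c `^ (p - 2) = m `^ q / (m * m).
  rewrite -powRrM -expr2 -powR_mulrn ?(ltW m0)// -powRB; last by rewrite (gt_eqF m0) implybT.
  by congr (_ `^ _); rewrite qE; field.
rewrite -cp; apply: (@le_trans _ _ (C * (c `^ (p - 2) * (a * b)))); last first.
  by rewrite ler_wpM2l// powR_mul_le_sum ?powR_ge0// ltW.
rewrite [leRHS]mulrA ler_wpM2r ?mulr_ge0// cp2 mulrA.
have M0 : 0 < M by exact: lt_le_trans mM.
rewrite ler_pdivrMr ?mulr_gt0//; apply: le_trans eC _.
rewrite -[leRHS]mulrA ler_peMr ?mulr_ge0 ?(ltW mq0)// mulrC ler_pdivlMr ?mulr_gt0//.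
by rewrite mul1r ler_wpM2l// ltW.
Qed.

End pointwise.

Section length_weight.
Context {R : realType} {G T : topologicalZmodType} {k m : nat}.
Local Notation B := (borel_type G).
Variable mu : {measure set B -> \bar R}.
Hypothesis hG : hausdorff_space G.
Hypothesis lcG : locally_compact [set: G].
Hypothesis cgG : compactly_generated G.
Hypothesis haar : haar_measure mu.
Variables (w : weight mu) (phi : structure_iso R G T k m) (nu : nat -> R).
Hypothesis nu_mono : nondecreasing_seq nu.
Hypothesis wE : forall t, w t = expR (nu (group_length phi t)).
Local Notation U := (generating_set phi).
Implicit Types s t : G.

Section growth.
Variables (q : R) (eta : G -> R) (g : G).
Hypothesis q0 : 0 < q.
Hypothesis ceta : continuous eta.
Hypothesis etaD : {morph eta : s t / s + t}.
Hypothesis etaU : forall s, U s -> `|eta s| <= 1.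
Hypothesis Ug : U g.
Hypothesis etag : 2^-1 <= eta g.
Hypothesis wq : (\int[mu]_s (w s `^ (- q))%:E < +oo)%E.

Let eta0 : eta 0 = 0. Proof. by apply/(addIr (eta 0)); rewrite -etaD !add0r. Qed.

(** On V the values of eta stay within 1/4 of 0, while [eta g >= 1/2]: the
translates of V by multiples of g are disjoint. *)
Let V := (U `&` [set s | `|eta s| < 4^-1])^°.

Let oV : open V. Proof. exact: open_interior. Qed.

Let V0 : V 0.
Proof.
apply: filterI; first exact: nbhs_generating_set.
have : \forall y \near eta 0, `|y| < 4^-1.
  have q4 : 0 < 4^-1 :> R by rewrite invr_gt0.
  rewrite eta0; have := nbhsx_ballx (0 : R) _ q4.
  by apply: filterS => y; rewrite /ball /= sub0r normrN.
exact: (ceta (x := 0)).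
Qed.

Let F j : set B := (fun t : B => (t : G) + - (g *+ j) : B) @^-1` (V : set B).

Let mF j : measurable (F j).
Proof.
by rewrite -[F j]setTI; apply: (measurable_translate (- (g *+ j))) => //; exact: borel_open.
Qed.

Let muF j : mu (F j) = mu V.
Proof. by apply: (haar_translate haar); exact: borel_open. Qed.

Let eta_nat j : eta (g *+ j) = eta g *+ j.
Proof. by elim: j => [|j IH]; rewrite ?mulr0n// !mulrS etaD IH. Qed.

Let etaF j s : F j s -> `|eta s - eta g *+ j| < 4^-1.
Proof.
move=> Fs; have [_] := interior_subset Fs; rewrite /= etaD.
by rewrite hom_opp// eta_nat.
Qed.

Let disjointF : trivIset setT F.
Proof.
apply/trivIsetP => i j _ _ ij; apply/seteqP; split => // s [/= /etaF Fi /etaF Fj].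
wlog lij : i j ij Fi Fj / (i < j)%N => [H|].
  by move: (ij); rewrite neq_ltn => /orP[] l; [exact: (H i j)|apply: (H j i) => //; rewrite eq_sym].
have : 2^-1 <= eta g *+ (j - i).
  apply: le_trans etag _; rewrite -mulr_natr ler_peMr//.
    by apply: le_trans etag; rewrite invr_ge0.
  by rewrite ler1n subn_gt0.
rewrite mulrnBr ?(ltnW lij)// leNgt => /negP; apply.
rewrite (_ : _ - _ = (eta s - eta g *+ i) - (eta s - eta g *+ j)); last by ring.
apply: le_lt_trans (ler_norm _) _; apply: le_lt_trans (ler_normB _ _) _.
by apply: lt_le_trans (ltrD Fi Fj) _; lra.
Qed.

Let length_F j s : F j s -> (group_length phi s <= j.+1)%N.
Proof.
move=> Fs; apply: group_length_le; have [Us _] := interior_subset Fs.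
exists (fun i => if i == ord0 then s - g *+ j else g) => [i|]; first by case: ifP.
by rewrite big_ord_recl eqxx /= sumr_const card_ord subrK.
Qed.

(** With N the length of t, the N translates [F j] of V lie in the ball of
radius N, where [w <= w t]; their total measure is N times that of V. *)
Lemma hom_le_weight : exists2 C : R, 0 <= C & forall t, `|eta t| <= C * w t `^ q.
Proof.
have muV : (0 < mu V)%E by apply: (haar_open haar oV); exists 0.
have [c c0 cV] : exists2 c : R, 0 < c & (c%:E <= mu V)%E.
  case: (mu V) muV => [r| |]// r0; first by exists r; rewrite -?lte_fin.
  by exists 1 => //; rewrite leey.
have := wq; set I := (\int[mu]_s _)%E => Ifin.
have I0 : (0 <= I)%E by apply: integral_ge0 => s _; rewrite lee_fin powR_ge0.
have IE : (fine I)%:E = I by rewrite fineK// ge0_fin_numE.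
exists (fine I / c) => [|t]; first by rewrite divr_ge0 ?fine_ge0// ltW.
apply: le_trans (hom_le_length t etaD etaU) _.
set N := group_length phi t.
have wt : 0 < w t by exact: weight_gt0.
rewrite mulrAC ler_pdivlMr// -ler_pdivrMr ?powR_gt0// -lee_fin IE -powRN.
pose D := \big[setU/set0]_(j < N) F j.
have mD : measurable D by apply: bigsetU_measurable => j _; exact: mF.
have muD : ((N%:R * c)%:E <= mu D)%E.
  rewrite (measure_bigsetU _ mF disjointF) mulr_natl -{1}(card_ord N) -sumr_const -sumEFin.
  by apply: lee_sum => j _; have := cV; rewrite -(muF j); exact.
have mwq : measurable_fun [set: B] (fun s : B => (w s `^ (- q))%:E).
  apply/measurable_EFinP; apply: (measurableT_comp (measurable_powR (- q))).
  exact: weight_measurable.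
apply: (@le_trans _ _ (\int[mu]_(s in D) (w t `^ (- q))%:E)%E).
  rewrite integral_cst// [leLHS]EFinM [leLHS]muleC lee_wpmul2l//.
  by rewrite lee_fin powR_ge0.
apply: (@le_trans _ _ (\int[mu]_(s in D) (w s `^ (- q))%:E)%E); last first.
  by apply: ge0_subset_integral => // s _; rewrite lee_fin powR_ge0.
apply: ge0_le_integral => //.
- by move=> s _; rewrite lee_fin powR_ge0.
- by apply: measurable_funS mwq.
move=> s; rewrite /D -bigcup_mkord => -[j /= jN Fs]; rewrite lee_fin !powRN.
rewrite lef_pV2 ?posrE ?powR_gt0 ?weight_gt0//.
apply: ge0_ler_powR; rewrite ?nnegrE ?(ltW q0) ?(ltW (weight_gt0 w _))//.
rewrite !wE ler_expR; apply: nu_mono; exact: leq_trans (length_F Fs) jN.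
Qed.

End growth.
Variables (p q : R) (p1 : 1 <= p).
Local Notation A := (Lpw w p1).
Variable mul : A -> A -> A.
Hypothesis mul_conv : is_convolution mul.
Hypothesis mul_ba : banach_algebra mul.

Let mwq : measurable_fun [set: B] (fun s : B => w s `^ (- q)).
Proof.
apply: (measurableT_comp (measurable_powR (- q))); exact: weight_measurable.
Qed.

Let invw_fin : 0 < q -> (fun t => (w t)^-1) \in Lfun mu q%:E ->
  (\int[mu]_s (w s `^ (- q))%:E < +oo)%E.
Proof.
move=> q0 /sub_Lfun_finLfun; rewrite inE /= /finite_norm unlock.
rewrite (eq_integral (fun s : B => (w s `^ (- q))%:E)); last first.
  move=> s _ /=; have ws := weight_gt0 w s.
  by rewrite ger0_norm ?invr_ge0 ?(ltW ws)// -powR_inv1 ?(ltW ws)// -powRrM mulN1r.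
rewrite !ltey; apply: contra_neq => ->.
by rewrite poweRyr// invr_eq0 gt_eqF.
Qed.

(** [conjugate_weight_bound] is applied with m the smaller of [w t] and
[w (- t)], which is legitimate because |eta| is even. *)
Lemma length_weight_not_weakly_amenable : 2 < p -> p^-1 + q^-1 = 1 ->
  compact [set: T] -> ~ compact [set: G] -> 0 < q ->
  (fun t => (w t)^-1) \in Lfun mu q%:E -> ~ weakly_amenable mul.
Proof.
move=> p2 pq cT ncG q0 /(invw_fin q0) wq.
have [eta [ceta etaD etaU [g Ug etag]]] := length_hom_exists phi cT ncG.
have [C C0 HC] := hom_le_weight q0 ceta etaD etaU Ug etag wq.
pose h (t : G) := w t `^ (- q) + w (- t) `^ (- q).
have pw0 t : 0 <= w t `^ (- q) by exact: powR_ge0.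
have mwq' : measurable_fun [set: B] (fun s : B => w (- (s : G)) `^ (- q)).
  exact: (measurableT_comp mwq measurable_opp).
apply: (hom_not_weakly_amenable hG lcG cgG haar mul_conv mul_ba ceta etaD
  (h := h) (c0 := C)) => //.
- exists g => gE; move: etag; rewrite gE; lra.
- exact: measurable_funD.
- by move=> s; rewrite addr_ge0.
- rewrite /h; under eq_integral do rewrite EFinD.
  rewrite ge0_integralD//; last 4 first.
  + by move=> s _; rewrite lee_fin.
  + exact/measurable_EFinP.
  + by move=> s _; rewrite lee_fin.
  + exact/measurable_EFinP.
  rewrite (ge0_integral_preserving measurable_opp (haar_opp hG lcG cgG haar)
    (f := fun s : B => (w s `^ (- q))%:E)).
  + exact: lte_add_pinfty.
  + exact/measurable_EFinP.
  + by move=> s; rewrite lee_fin.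
- apply: aeW => t a b a0 b0.
  have C1 (x y z v : R) : 0 <= y -> 0 <= z -> x <= C * (a `^ p + b `^ p + y) ->
      x <= C * (a `^ p + b `^ p + a `^ p * b `^ p + (y + z)).
    move=> y0 z0 /le_trans; apply; rewrite ler_wpM2l// -!addrA !lerD2l addrCA lerDl.
    by rewrite addr_ge0// mulr_ge0 ?powR_ge0.
  have [ww|/ltW ww] := leP (w t) (w (- (t : G))).
    apply: C1 => //; apply: (conjugate_weight_bound p2 pq) => //.
    exact: weight_gt0.
  rewrite /h [w t `^ _ + _]addrC [w t * _]mulrC.
  apply: C1 => //; apply: (conjugate_weight_bound p2 pq) => //.
    exact: weight_gt0.
  by have := HC (- t); rewrite hom_opp// normrN.
Qed.

End length_weight.

(** * Conclusion *)

Theorem corollary3p7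
  (R : realType) (G : topologicalZmodType)
  (G_hausdorff : hausdorff_space G)
  (G_locally_compact : locally_compact [set: G])
  (G_noncompact : ~ compact [set: G])
  (G_compactly_generated : compactly_generated G)
  (mu : {measure set (borel_type G) -> \bar R}) (mu_haar : haar_measure mu)
  (w : weight mu) (p q : R) (p_gt1 : 1 < p) (q_gt1 : 1 < q)
  (pq : p^-1 + q^-1 = 1)
  (mul : Lpw w (ltW p_gt1) -> Lpw w (ltW p_gt1) -> Lpw w (ltW p_gt1))
  (mul_conv : is_convolution mul) (mul_ba : banach_algebra mul) :
  (p <= 2 ->
    (weakly_amenable mul <->
     ~ exists xi : G -> R[i],
         [/\ continuous_hom xi, xi <> (fun=> 0) &
             cLp mu +oo (hom_tilde w xi)])) /\
  (2 < p ->
    forall (k m : nat) (T : topologicalZmodType)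
      (T_compact : compact [set: T]) (T_hausdorff : hausdorff_space T)
      (phi : structure_iso R G T k m) (nu : nat -> R),
      (forall n, 0 <= nu n) ->
      nu 0%N = 0 ->
      nondecreasing_seq nu ->
      (forall i j, nu (i + j)%N <= nu i + nu j) ->
      nu n @[n --> \oo] --> +oo ->
      (forall t, w t = expR (nu (group_length phi t))) ->
      (fun t => (w t)^-1) \in Lfun mu q%:E ->
      ~ weakly_amenable mul).
Proof.
split=> [p2|p2 k m T cT _ phi nu _ _ nu_mono _ _ wE wq].
  split=> [wa [xi [xihom xi0 xib]]|].
    exact: (hom_tilde_not_weakly_amenable G_hausdorff G_locally_compact
      G_compactly_generated mu_haar mul_conv mul_ba p2 xihom xi0 xib).
  exact: (no_hom_weakly_amenable G_hausdorff G_locally_compact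
    G_compactly_generated mu_haar mul_conv).
apply: (length_weight_not_weakly_amenable G_hausdorff G_locally_compact
  G_compactly_generated mu_haar nu_mono wE mul_conv mul_ba p2 pq) => //.
exact: lt_trans ltr01 q_gt1.
Qed.
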